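(* Let $\mathcal{G}$ be an étale groupoid with compact unit space $\mathcal{G}^{(0)}$, and let $\ell\colon\mathcal{G}\to[0,\infty)$ be a proper continuous length function. Suppose further that for any $t\in\ell(\mathcal{G})\subseteq\mathbb{R}$ there is some $\delta_t>0$ with $[t,t+\delta_t)\cap\ell(\mathcal{G})=\{t\}$. Furthermore, assume $d$ is a metric on $\mathcal{G}^{(0)}$ inducing the topology. Fix a metric stratification $\mathcal{K}=(K_i)_{i\in I}$ of $\mathcal{G}$ with respect to $d$, and assume moreover that for each $i\in I$ there is $r_i\in\mathbb{R}$ such that $K_i\subseteq\ell^{-1}(\{r_i\})$. If $(\mathcal{G},\ell)$ has rapid decay with constants $C,s>0$, then for any $n\ge\lfloor s\rfloor+1$ the pair $(\mathrm{Lip}_c^{\mathcal{K}}(\mathcal{G}),L^{\mathcal{K},n})$ is a compact quantum metric space. In particular, if $(\mathcal{G},\ell)$ has polynomial growth bounded by some polynomial $p$ of degree $q$, then $(\mathrm{Lip}_c^{\mathcal{K}}(\mathcal{G}),L^{\mathcal{K},n})$ is a compact quantum metric space for all $n>\lfloor q+\tfrac12\rfloor+1$.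
   Context: **Groupoids.** All groupoids are locally compact and Hausdorff. For a groupoid $\mathcal{G}$ with unit space $\mathcal{G}^{(0)}$, $r(\gamma)=\gamma\gamma^{-1}$ and $s(\gamma)=\gamma^{-1}\gamma$; $\mathcal{G}$ is étale if $r$ is a local homeomorphism; $\mathcal{G}_u=s^{-1}(u)$, $\mathcal{G}^u=r^{-1}(u)$. $C_c(\mathcal{G})$ is a $*$-algebra with $f*g(\gamma)=\sum_{\mu\in\mathcal{G}_{s(\gamma)}}f(\gamma\mu^{-1})g(\mu)$ and $f^*(\gamma)=\overline{f(\gamma^{-1})}$. $\mathcal{E}$ is the right Hilbert $C(\mathcal{G}^{(0)})$-module obtained by completing $C_c(\mathcal{G})$ for $\langle\xi,\eta\rangle(u)=\sum_{\mu\in\mathcal{G}_u}\overline{\xi(\mu)}\eta(\mu)$, with $(\xi\cdot h)(\gamma)=\xi(\gamma)h(s(\gamma))$. The left regular representation is $(\Lambda(f)\xi)(\gamma)=\sum_{\mu\in\mathcal{G}_{s(\gamma)}}f(\gamma\mu^{-1})\xi(\mu)$, and $C_r^*(\mathcal{G})$ is the closure of $\Lambda(C_c(\mathcal{G}))$ in the adjointable operators $\mathcal{L}_{C(\mathcal{G}^{(0)})}(\mathcal{E})$; we regard $C_c(\mathcal{G})\subseteq C_r^*(\mathcal{G})$. **Length functions.** A continuous length function is a continuous $\ell\colon\mathcal{G}\to[0,\infty)$ with $\ell(\gamma)=0$ iff $\gamma\in\mathcal{G}^{(0)}$, $\ell(\gamma^{-1})=\ell(\gamma)$, and $\ell(\gamma\mu)\le\ell(\gamma)+\ell(\mu)$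 for composable $\gamma,\mu$. It is proper if $\ell^{-1}([0,t])$ is compact for all $t\ge0$. $B_\ell(t)=\{\gamma\mid\ell(\gamma)\le t\}$. Standing assumption: for every $t\ge0$ there is $F_t\ge1$ with $\sup_{u\in\mathcal{G}^{(0)}}|B_\ell(t)\cap\mathcal{G}_u|\le F_t$. **Rapid decay, polynomial growth.** $\Vert f\Vert_{2,s}$ is the maximum of $\sup_u\big(\sum_{\gamma\in\mathcal{G}_u}|f(\gamma)|^2(1+\ell(\gamma))^{2s}\big)^{1/2}$ and $\sup_u\big(\sum_{\gamma\in\mathcal{G}^u}|f(\gamma)|^2(1+\ell(\gamma))^{2s}\big)^{1/2}$. $(\mathcal{G},\ell)$ has rapid decay with constants $C,s$ if $\Vert\Lambda(f)\Vert\le C\Vert f\Vert_{2,s}$ for all $f\in C_c(\mathcal{G})$. It has polynomial growth bounded by the polynomial $p\colon\mathbb{R}\to\mathbb{R}$ if $\sup_{u}|B_\ell(t)\cap\mathcal{G}_u|\le p(t)$ for all $t\ge0$. **Commutator seminorm.** $D_\ell\colon C_c(\mathcal{G})\to\mathcal{E}$ is $(D_\ell\xi)(\gamma)=\ell(\gamma)\xi(\gamma)$. For $f\in C_c(\mathcal{G})$, $\delta^n(f)$ is the $n$-fold iterated commutator $[D_\ell,[D_\ell,\dots[D_\ell,\Lambda(f)]]]$, which extends to an adjointable operator on $\mathcal{E}$, and $L^n_\ell(f)=\Vert\delta^n(f)\Vert_{\mathcal{L}_{C(\mathcal{G}^{(0)})}(\mathcal{E})}$. **Metric stratification.** Given a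 metric $d$ inducing the topology of the compact space $\mathcal{G}^{(0)}$, a metric stratification of $\mathcal{G}$ with respect to $d$ is a collection $\mathcal{K}=\{K_i\}_{i\in I}$ of subsets of $\mathcal{G}$, $I$ countable, such that: (1) $\mathcal{G}=\bigcup_iK_i$; (2) $K_{i_1}\cap K_{i_2}=\emptyset$ for $i_1\ne i_2$; (3) each $K_i$ is precompact and open; (4) there is a distinguished element $K_e=\mathcal{G}^{(0)}$ in $\mathcal{K}$; (5) $K_i\in\mathcal{K}$ implies $K_i^{-1}\in\mathcal{K}$; (6) for each $i$, $d^{(i)}(\gamma,\mu)=\max\{d(s(\gamma),s(\mu)),d(r(\gamma),r(\mu))\}$ makes $K_i$ a totally bounded metric space. (Some $K_i$ may be empty.) **Total seminorm.** $L^{\mathcal{K}}_{\mathrm{Lip}}(f)=\sup_{i\in I}\sup\{|f(\gamma)-f(\mu)|/d^{(i)}(\gamma,\mu)\mid\gamma\neq\mu\in K_i\}$, $\mathrm{Lip}_c^{\mathcal{K}}(\mathcal{G})=\{f\in C_c(\mathcal{G})\mid L^{\mathcal{K}}_{\mathrm{Lip}}(f)<\infty\}$, and $L^{\mathcal{K},n}(f)=\max\{L^n_\ell(f),L^{\mathcal{K}}_{\mathrm{Lip}}(f)\}$ for $f\in \mathrm{Lip}_c^{\mathcal{K}}(\mathcal{G})$. **Compact quantum metric spaces.** An operator system $\mathcal{X}$ is a unital $*$-invariant (not necessarily closed) subspace of a unital $C^*$-algebra; $S(\mathcal{X})$ is the set of positive unital functionals on $\mathcal{X}$. For a seminorm $L\colon\mathcal{X}\to[0,\infty)$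 with $L(x^* )=L(x)$ and $L(1)=0$, $(\mathcal{X},L)$ is a compact quantum metric space if $\mathrm{mk}_L(\phi,\psi)=\sup\{|\phi(x)-\psi(x)|\mid x\in \mathcal{X}, L(x)\le1\}$ metrizes the weak$^*$ topology on $S(\mathcal{X})$. Here $\mathrm{Lip}_c^{\mathcal{K}}(\mathcal{G})$ is an operator system in $C_r^*(\mathcal{G})$. *)

(* Defs.v *)
From HB Require Import structures.
From mathcomp Require Import all_boot all_order all_algebra.
From mathcomp Require Import finmap complex.
From mathcomp Require Import all_classical all_reals all_analysis.
From mathcomp Require summability.

Set Implicit Arguments.
Unset Strict Implicit.
Unset Printing Implicit Defensive.

Import Order.TTheory GRing.Theory Num.Theory.
Import numFieldNormedType.Exports.

Local Open Scope classical_set_scope.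
Local Open Scope ring_scope.

(* R[i]^o is R[i] as a normed module over itself: this is where the library
   puts the topology of the complex numbers. *)
Notation Cplx R := (GRing.regular (complex R)).

(* Seminorms are suprema in [0, +oo]; the supremum of the empty set is 0
   (ereal_sup set0 would be -oo). *)
Definition nnsup (R : realType) (A : set (\bar R)) : \bar R :=
  maxe 0%E (ereal_sup A).

Section Metrics.
Context {R : realType}.

Definition metric_on (T : Type) (A : set T) (d : T -> T -> R) : Prop :=
  [/\ forall x y, A x -> A y -> 0 <= d x y,
      forall x y, A x -> A y -> (d x y = 0 <-> x = y),
      forall x y, A x -> A y -> d x y = d y x
    & forall x y z, A x -> A y -> A z -> d x z <= d x y + d y z].

Definition metrizes (T : topologicalType) (A : set T) (d : T -> T -> R) : Prop :=
  metric_on A d /\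
  forall x, A x ->
    within A (nbhs x) =
    filter_from [set e : R | 0 < e] (fun e => A `&` [set y | d x y < e]).

Definition totally_bounded_on (T : Type) (A : set T) (d : T -> T -> R) : Prop :=
  forall e : R, 0 < e ->
    exists F : set T, [/\ finite_set F, F `<=` A &
      A `<=` \bigcup_(x in F) [set y | d x y < e]].

End Metrics.

(* f is a local homeomorphism onto its image in the subspace B of U: around
   each point, f restricts to a homeomorphism from an open set V onto a
   relatively open subset of B. *)
Definition local_homeo (T U : topologicalType) (B : set U) (f : T -> U) : Prop :=
  forall x, exists V : set T,
    [/\ open V /\ V x, set_inj V f, {within V, continuous f} &
        forall W, open W -> W `<=` V ->
          exists2 O, open O & f @` W = O `&` B].

(* Axioms of Hahn and Renault. The product is a total function of which only
   the values on composable pairs are constrained; that x, y are composable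
   iff src x = rng y is a consequence. *)
Record groupoid (G : Type) := Groupoid {
  composable : G -> G -> Prop;
  gmul : G -> G -> G;
  ginv : G -> G;
  ginvK : involutive ginv;
  gmulA : forall x y z, composable x y -> composable y z ->
    [/\ composable (gmul x y) z, composable x (gmul y z) &
        gmul (gmul x y) z = gmul x (gmul y z)];
  composableVg : forall x, composable (ginv x) x;
  gmulVK : forall x y, composable x y -> gmul (ginv x) (gmul x y) = y;
  gmulK : forall x y, composable x y -> gmul (gmul x y) (ginv y) = x }.

Section Groupoid.
Context {G : topologicalType} (gr : groupoid G).

Definition rng (x : G) : G := gmul gr x (ginv gr x).
Definition src (x : G) : G := gmul gr (ginv gr x) x.
Definition units : set G := range rng.
Definition fiber_src (u : G) : set G := [set x | src x = u].
Definition fiber_rng (u : G) : set G := [set x | rng x = u].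

Definition lch_groupoid : Prop :=
  [/\ hausdorff_space G, locally_compact [set: G],
      continuous (ginv gr) &
      {within [set p : G * G | composable gr p.1 p.2],
         continuous (fun p : G * G => gmul gr p.1 p.2)}].

Definition etale : Prop := local_homeo units rng.

End Groupoid.

Section GroupoidAlgebra.
Context {R : realType} {G : topologicalType} (gr : groupoid G).

Local Notation C := (Cplx R).
Local Notation normc := (@ComplexField.Normc.normc R).
Implicit Types (f xi eta : G -> C) (T S : (G -> C) -> (G -> C)).

Definition Cc : set (G -> C) :=
  [set f | continuous f /\ compact (closure [set x | f x != 0])].

(* If f is in Cc and the groupoid is étale then only finitely many m in the
   fiber satisfy f (g m^-1) != 0, so that the sum is finite for every xi. *)
Definition Lambda f xi : G -> C := fun g =>
  \sum_(m \in fiber_src gr (src gr g)) f (gmul gr g (ginv gr m)) * xi m.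

Definition star f : G -> C := fun g => conjc (f (ginv gr g)).

Definition one_Cc : G -> C := fun g => (g \in units gr)%:R.

Definition normE xi : \bar R :=
  nnsup [set sqrte (\esum_(m in fiber_src gr u) ((normc (xi m)) ^+ 2)%:E)
        | u in units gr].

(* The completion of Cc, realised as its closure in the Banach space of the
   functions xi : G -> C with normE xi < +oo, i.e. of the bounded sections of
   the Hilbert spaces l^2 (fiber_src u), u in units. *)
Definition E : set (G -> C) :=
  [set xi | forall e : R, 0 < e ->
     exists2 f, Cc f & (normE (xi - f)%R < e%:E)%E].

(* The sum is the unordered (possibly infinite) one. *)
Definition inner xi eta (u : G) : C :=
  summability.sum (fun m : G =>
    (if m \in fiber_src gr u then conjc (xi m) * eta m else 0) : C).

(* Operators on E are maps on functions, of which only the restriction to E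
   matters. *)
Definition adjoint T S : Prop :=
  [/\ forall xi, E xi -> E (T xi),
      forall eta, E eta -> E (S eta) &
      forall xi eta, E xi -> E eta -> forall u, units gr u ->
        inner (T xi) eta u = inner xi (S eta) u].

Definition adjointable T : Prop := exists S, adjoint T S.

Definition opnorm T : \bar R :=
  nnsup [set normE (T xi) | xi in [set xi | E xi /\ (normE xi <= 1)%E]].

Definition Cstar_red : set ((G -> C) -> (G -> C)) :=
  [set T | adjointable T /\ forall e : R, 0 < e ->
     exists2 f, Cc f & (opnorm (fun xi => T xi - Lambda f xi)%R < e%:E)%E].

Definition Cstar_pos T : Prop :=
  exists B Bs, [/\ Cstar_red B, adjoint B Bs &
    forall xi, E xi -> T xi = Bs (B xi)].

(* Lambda identifies Cc with a subspace of Cstar_red. *)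
Definition Cc_pos : set (G -> C) := [set f | Cstar_pos (Lambda f)].

End GroupoidAlgebra.

Section LengthFunctions.
Context {R : realType} {G : topologicalType} (gr : groupoid G) (l : G -> R).

Local Notation C := (Cplx R).
Local Notation normc := (@ComplexField.Normc.normc R).
Implicit Types (f xi : G -> C) (T : (G -> C) -> (G -> C)).

Definition length_function : Prop :=
  [/\ continuous l /\ forall g, 0 <= l g,
      forall g, l g = 0 <-> units gr g,
      forall g, l (ginv gr g) = l g &
      forall g m, composable gr g m -> l (gmul gr g m) <= l g + l m].

Definition lball (t : R) : set G := [set g | l g <= t].

Definition proper_length : Prop := forall t, 0 <= t -> compact (lball t).

(* sup over u of the cardinality of the intersection of lball t and the fiber
   over u is at most M *)
Definition fiber_card_le (t M : R) : Prop :=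
  forall u, units gr u ->
    finite_set (lball t `&` fiber_src gr u) /\
    (#|` fset_set (lball t `&` fiber_src gr u)|)%:R <= M.

Definition norm2 (s : R) f : \bar R :=
  maxe
    (nnsup [set sqrte (\esum_(g in fiber_src gr u)
                  ((normc (f g)) ^+ 2 * (1 + l g) `^ (2 * s))%:E)
           | u in units gr])
    (nnsup [set sqrte (\esum_(g in fiber_rng gr u)
                  ((normc (f g)) ^+ 2 * (1 + l g) `^ (2 * s))%:E)
           | u in units gr]).

Definition rapid_decay (c s : R) : Prop :=
  forall f, Cc f -> (opnorm gr (Lambda gr f) <= c%:E * norm2 s f)%E.

Definition polynomial_growth (p : {poly R}) : Prop :=
  forall t, 0 <= t -> fiber_card_le t p.[t].

Definition Dl xi : G -> C := fun g => (l g)%:C%C * xi g.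

Definition commDl T : (G -> C) -> (G -> C) :=
  fun xi => Dl (T xi) - T (Dl xi).

Definition delta (n : nat) f : (G -> C) -> (G -> C) :=
  iter n commDl (Lambda gr f).

(* The norm of the adjointable extension to E of delta n f, an operator on Cc.
   Such extensions agree on E, so that the infimum is over at most one value;
   it is +oo if there is no extension. *)
Definition Ll (n : nat) f : \bar R :=
  ereal_inf [set opnorm gr T | T in
    [set T | adjointable gr T /\ forall xi, Cc xi -> T xi = delta n f xi]].

End LengthFunctions.

Section Stratification.
Context {R : realType} {G : topologicalType} (gr : groupoid G) (d : G -> G -> R).

Local Notation C := (Cplx R).
Local Notation normc := (@ComplexField.Normc.normc R).

Definition dK (x y : G) : R :=
  Num.max (d (src gr x) (src gr y)) (d (rng gr x) (rng gr y)).

Record metric_stratification (I : Type) (K : I -> set G) : Prop := {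
  strat_countable : countable [set: I];
  strat_cover : \bigcup_i K i = [set: G];
  strat_disjoint : forall i j, i <> j -> K i `&` K j = set0;
  strat_open : forall i, precompact (K i) /\ open (K i);
  strat_units : exists e, K e = units gr;
  strat_inv : forall i, exists j, K j = ginv gr @` K i;
  strat_metric : forall i, metric_on (K i) dK /\ totally_bounded_on (K i) dK }.

Definition LLip (I : Type) (K : I -> set G) (f : G -> C) : \bar R :=
  nnsup [set a | exists i x y, [/\ K i x, K i y, x <> y &
                   a = (normc (f x - f y) / dK x y)%:E]].

Definition Lipc (I : Type) (K : I -> set G) : set (G -> C) :=
  [set f | Cc f /\ (LLip K f < +oo)%E].

Definition Ltotal (l : G -> R) (I : Type) (K : I -> set G) (n : nat)
    (f : G -> C) : \bar R :=
  maxe (Ll gr l n f) (LLip K f).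

End Stratification.

(* An operator system X is given as a subset of a complex vector space V with
   the involution, the unit and the positive elements inherited from the
   ambient C*-algebra. *)
Section CompactQuantumMetricSpaces.
Context {R : realType} {V : lmodType (complex R)}.
Variables (invol : V -> V) (one : V) (pos : set V).

Local Notation C := (Cplx R).

Definition operator_system (X : set V) : Prop :=
  [/\ X one,
      forall (a : R[i]) x y, X x -> X y -> X (a *: x + y) &
      forall x, X x -> X (invol x)].

(* The library topology of {ptws X -> C} is that of pointwise convergence, so
   that its restriction to the states is the weak* topology. *)
Definition state_space (X : set V) : set {ptws X -> C} :=
  [set phi : X -> C |
     [/\ forall (a : R[i]) (x y z : X),
           val z = a *: val x + val y -> phi z = a * phi x + phi y,
         forall x : X, val x = one -> phi x = 1 &
         forall x : X, pos (val x) -> (0 : R[i]) <= phi x]].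

Definition mk (X : set V) (L : V -> \bar R) (phi psi : X -> C) : \bar R :=
  nnsup [set (ComplexField.Normc.normc (phi x - psi x : R[i]))%:E
        | x in [set x : X | (L (val x) <= 1)%E]].

Definition star_seminorm (X : set V) (L : V -> \bar R) : Prop :=
  [/\ forall x, X x -> (L x \is a fin_num) /\ (0 <= L x)%E,
      forall x y, X x -> X y -> (L (x + y)%R <= L x + L y)%E,
      forall (a : R[i]) x, X x ->
        L (a *: x) = ((ComplexField.Normc.normc a)%:E * L x)%E,
      forall x, X x -> L (invol x) = L x &
      L one = 0%E].

Definition compact_quantum_metric_space (X : set V) (L : V -> \bar R) : Prop :=
  [/\ operator_system X, star_seminorm X L,
      forall phi psi : {ptws X -> C}, state_space phi -> state_space psi ->
        mk L phi psi \is a fin_num &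
      metrizes (@state_space X) (fun phi psi : {ptws X -> C} =>
        fine (mk L phi psi))].

End CompactQuantumMetricSpaces.

(* Main.v *)
(* By Rieffel's criterion it suffices that the unit ball of the seminorm is totally
   bounded modulo scalars for a norm controlling all states. For self-adjoint f
   with |Lambda f| < 1 the element 1 - f is the square of a self-adjoint element
   of the reduced C*-algebra, so |phi f| <= 2 |Lambda f| for every state phi.
   Rapid decay bounds |Lambda w| by the weighted l^2 norm of w. Since the commutator
   delta^n w maps the indicator function of the units to l^n w, the l^2 norm of
   l^n w on the fibers is at most the commutator seminorm; as n > s, the part of w
   outside a large ball is therefore uniformly small. The ball is covered by finitely
   many of the K_i, on which the functions in question are Lipschitz and, after
   subtraction of a scalar, uniformly bounded, so that finitely many functions
   approximate all of them there.
   Polynomial growth of degree q gives rapid decay with s = q + 1: the l^1 norm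
   dominates the operator norm by Schur's test, and Cauchy-Schwarz bounds it by the
   weighted l^2 norm because (1 + l)^(-2 s) is uniformly summable over fibers. *)

(* Positivity in [Cc_pos] means a factorization through an element of the reduced C*-algebra, so the
   bound on states needs an actual square root of [1 - a]. It is a norm limit of convolution
   polynomials in [a], and to place the limit and its adjoint in the algebra, the closedness of [E],
   the convergence of inner products and the density of [Cc] have to be worked out. This is done on
   finite sets of points of one source fiber: kernels of finite width make every sum in an operator
   finite, so operators act on arbitrary functions, and bounds tested on finite sets survive
   pointwise limits. The uniform bound after subtracting a scalar has two sources. On the units it
   is the Lipschitz condition with total boundedness. Elsewhere the gap of [l] above 0 gives
   [l >= del], so that [|w| * l ^ n <= 1] turns into [|w| <= del ^ (-n)]. In the polynomial case at
   most about [j ^ q] points of a fiber have length near [j], each of weight about [j ^ (-2 * s)];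
   with [s = q + 1] the exponent [q - 2 * s] is at most [-2]. *)
Require Import Defs.
From mathcomp Require Import all_boot all_order all_algebra.
From mathcomp Require Import finmap complex.
From mathcomp Require Import all_classical all_reals all_analysis.
From mathcomp Require summability.
From mathcomp Require Import ring lra.

Set Implicit Arguments.
Unset Strict Implicit.
Unset Printing Implicit Defensive.

Import Order.TTheory GRing.Theory Num.Theory.
Import numFieldNormedType.Exports.

Local Open Scope classical_set_scope.
Local Open Scope ring_scope.

(** * Modulus and convergence in the complex numbers *)

Section ComplexModulus.
Context {R : realType}.
Local Notation C := (Cplx R).
Local Notation normc := (@ComplexField.Normc.normc R).
Implicit Types (x y z : C).

Lemma normc_ge0 x : 0 <= normc x.
Proof. by case: x => a b; rewrite sqrtr_ge0. Qed.

Lemma normcM x y : normc (x * y) = normc x * normc y.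
Proof. exact: ComplexField.Normc.normcM. Qed.

Lemma normc0 : normc 0 = 0.
Proof. exact: ComplexField.Normc.normc0. Qed.

Lemma normc1 : normc 1 = 1.
Proof. exact: ComplexField.Normc.normc1. Qed.

Lemma normc_eq0 x : (normc x == 0) = (x == 0).
Proof.
apply/eqP/eqP => [|->]; last exact: normc0.
exact: ComplexField.Normc.eq0_normc.
Qed.

Lemma normcD x y : normc (x + y) <= normc x + normc y.
Proof. by have := le_normcD x y. Qed.

Lemma normcN x : normc (- x) = normc x.
Proof. exact: normcN. Qed.

Lemma normcB x y : normc (x - y) = normc (y - x).
Proof. by rewrite -normcN opprB. Qed.

Lemma normcBD x y : normc (x - y) <= normc x + normc y.
Proof. by rewrite -(normcN y) normcD. Qed.

Lemma normc_dist (x y z : C) : normc (x - z) <= normc (x - y) + normc (y - z).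
Proof. by rewrite -[x - z](subrKA y) normcD. Qed.

Lemma normc_conj x : normc (conjc x) = normc x.
Proof. by case: x => a b /=; rewrite sqrrN. Qed.

Lemma normc_real (a : R) : normc (a%:C%C) = `|a|.
Proof. by rewrite /= expr0n addr0 sqrtr_sqr. Qed.

Lemma normcX x n : normc (x ^+ n) = normc x ^+ n.
Proof. by elim: n => [|n IH]; rewrite ?expr0 ?normc1// !exprS normcM IH. Qed.

Lemma normc_sum (T : Type) (s : seq T) (P : pred T) (f : T -> C) :
  normc (\sum_(i <- s | P i) f i) <= \sum_(i <- s | P i) normc (f i).
Proof.
elim: s => [|i s IH]; first by rewrite !big_nil normc0.
by rewrite !big_cons; case: (P i) => //; apply: le_trans (normcD _ _) _; rewrite lerD2l.
Qed.

Lemma normc_ge_Re x : `|complex.Re x| <= normc x.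
Proof. by case: x => a b /=; rewrite -sqrtr_sqr ler_wsqrtr// lerDl sqr_ge0. Qed.

Lemma normc_ge_Im x : `|complex.Im x| <= normc x.
Proof. by case: x => a b /=; rewrite -sqrtr_sqr ler_wsqrtr// lerDr sqr_ge0. Qed.

Lemma normc_le_ReIm x : normc x <= `|complex.Re x| + `|complex.Im x|.
Proof.
case: x => a b /=; rewrite -[leRHS]ger0_norm ?addr_ge0// -sqrtr_sqr ler_wsqrtr//.
by rewrite sqrrD !real_normK ?num_real// lerD2r lerDl mulrn_wge0// mulr_ge0.
Qed.

Lemma cplx_realB (a b : R) : ((a - b)%:C%C : C) = (a%:C%C : C) - (b%:C%C : C).
Proof. by apply/eqP; rewrite eq_complex /= oppr0 addr0 !eqxx. Qed.

Lemma conjM_normc x : conjc x * x = (normc x ^+ 2)%:C%C.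
Proof.
case: x => a b /=; rewrite sqr_sqrtr ?addr_ge0 ?sqr_ge0//.
by apply/eqP; rewrite eq_complex /=; apply/andP; split; apply/eqP; ring.
Qed.

Lemma normc_small x : (forall e : R, 0 < e -> normc x <= e) -> x = 0.
Proof.
move=> h; apply/eqP; rewrite -normc_eq0 eq_le normc_ge0 andbT.
by apply/ler_addgt0Pr => e e0; rewrite add0r h.
Qed.

Lemma gt0_cplx (e : R[i]) : 0 < e -> 0 < complex.Re e /\ e = (complex.Re e)%:C%C.
Proof. by case: e => a b; rewrite ltcE /= => /andP[/eqP -> a0]. Qed.

Lemma normc_lt x (e : R) : (`|x| < e%:C%C) = (normc x < e).
Proof. by rewrite ltcR. Qed.

Lemma cvg_normcP (T : Type) (F : set_system T) (f : T -> C) (a : C) :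
  Filter F ->
  (f @ F --> a) <-> (forall e : R, 0 < e -> \forall x \near F, normc (f x - a) < e).
Proof.
move=> FF; split => [/cvgrPdist_lt h e e0|h].
  have := h e%:C%C; rewrite ltcR => /(_ e0); apply: filterS => x.
  by rewrite distrC normc_lt.
apply/cvgrPdist_lt => e /gt0_cplx[e0 ->].
by apply: filterS (h _ e0) => x; rewrite distrC normc_lt.
Qed.

(** Real and imaginary parts converge by completeness of the reals. The rate passes to the limit
    without loss, because [a] is compared with some later [u j] that is as close to it as
    desired. *)
Lemma normc_cauchy_cvg (u : nat -> C) (c : nat -> R) :
  (forall j k, (k <= j)%N -> normc (u j - u k) <= c k) ->
  c @ \oo --> 0 -> exists a : C, forall k, normc (a - u k) <= c k.
Proof.
move=> hu hc.
have real_lim (v : nat -> R) :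
    (forall j k, (k <= j)%N -> `|v j - v k| <= c k) -> exists b : R, v @ \oo --> b.
  move=> hv; suff cv : cvg (v @ \oo) by exists (lim (v @ \oo)).
  apply: cauchy_cvg; apply/cauchy_exP => e e0.
  have /cvgrPdist_lt/(_ e e0)[k _ hk] := hc.
  exists (v k); exists k => //= j kj; rewrite /ball /= distrC.
  apply: le_lt_trans (hv _ _ kj) _.
  by have := hk k (leqnn k); rewrite /= sub0r normrN; apply: le_lt_trans; rewrite ler_norm.
have [|a ha] := real_lim (fun k => complex.Re (u k)).
  move=> j k /hu; apply: le_trans; rewrite -raddfB; exact: normc_ge_Re.
have [|b hb] := real_lim (fun k => complex.Im (u k)).
  move=> j k /hu; apply: le_trans; rewrite -raddfB; exact: normc_ge_Im.
exists (Complex a b) => k; apply/ler_addgt0Pr => e e0.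
have e2 : 0 < e / 2 by rewrite divr_gt0.
have /cvgrPdist_lt/(_ _ e2) h1 := ha.
have /cvgrPdist_lt/(_ _ e2) h2 := hb.
have [j []] : exists j, [/\ (k <= j)%N, `|a - complex.Re (u j)| < e / 2 &
    `|b - complex.Im (u j)| < e / 2].
  have : \forall j \near \oo, [/\ (k <= j)%N, `|a - complex.Re (u j)| < e / 2 &
    `|b - complex.Im (u j)| < e / 2].
    by near=> j; split; near: j => //; exact: nbhs_infty_ge.
  by move=> [j _ /(_ j (leqnn j)) hj]; exists j.
move=> kj ha' hb'; apply: le_trans (normc_dist _ (u j) _) _.
rewrite [e]splitr [leRHS]addrC lerD ?hu//.
apply: le_trans (normc_le_ReIm _) _; rewrite !raddfB /= lerD// ltW//.
Unshelve. all: by end_near.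
Qed.

End ComplexModulus.

(** * Finite sums and inequalities of Cauchy-Schwarz type *)

Section FiniteSums.
Context {R : realType}.

Lemma sum_uniq_incl (V : zmodType) (T : eqType) (s s' : seq T) (f : T -> V) :
  uniq s -> uniq s' -> {subset s <= s'} ->
  (forall m, m \in s' -> m \notin s -> f m = 0) ->
  \sum_(m <- s) f m = \sum_(m <- s') f m.
Proof.
move=> us us' ss h; rewrite [RHS](bigID (mem s)) /= [X in _ + X]big1_seq ?addr0.
  rewrite -[RHS]big_filter; apply: perm_big; apply: uniq_perm => //; first exact: filter_uniq.
  by move=> m; rewrite mem_filter; case: (boolP (m \in s)) => // /ss ->.
by move=> m /andP[/= ms ms']; exact: h.
Qed.

Lemma sum_uniq_le (T : eqType) (s s' : seq T) (f : T -> R) :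
  uniq s -> uniq s' -> {subset s <= s'} -> (forall m, 0 <= f m) ->
  \sum_(m <- s) f m <= \sum_(m <- s') f m.
Proof.
move=> us us' ss h; rewrite [leRHS](bigID (mem s)) /= -[leLHS]addr0 lerD ?sumr_ge0//.
rewrite -[leRHS]big_filter le_eqVlt; apply/orP; left; apply/eqP/perm_big/uniq_perm => //.
  exact: filter_uniq.
by move=> m; rewrite mem_filter; case: (boolP (m \in s)) => // /ss ->.
Qed.

(** Cauchy-Schwarz with bounds that may vanish. The weighted arithmetic-geometric mean inequality
    divides by the bounds, so it is applied to larger positive [M'] and [N'], which then decrease to
    [M] and [N]. *)
Lemma sum_mul_le (T : Type) (s : seq T) (a b : T -> R) (M N : R) :
  (forall i, 0 <= a i) -> (forall i, 0 <= b i) -> 0 <= M -> 0 <= N ->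
  \sum_(i <- s) a i ^+ 2 <= M ^+ 2 -> \sum_(i <- s) b i ^+ 2 <= N ^+ 2 ->
  \sum_(i <- s) a i * b i <= M * N.
Proof.
move=> a0 b0 M0 N0 hM hN.
have pos (M' N' : R) : M < M' -> N < N' -> \sum_(i <- s) a i * b i <= M' * N'.
  move=> MM NN; have M'0 : 0 < M' by exact: le_lt_trans MM.
  have N'0 : 0 < N' by exact: le_lt_trans NN.
  have -> : M' * N' = (M' ^+ 2 * (N' / M') + N' ^+ 2 * (M' / N')) / 2 by field; lra.
  apply: (@le_trans _ _ ((\sum_(i <- s) a i ^+ 2 * (N' / M') +
                          \sum_(i <- s) b i ^+ 2 * (M' / N')) / 2)).
    rewrite -big_split /= mulr_suml; apply: ler_sum => i _.
    have -> : a i * b i = (a i * N') * (b i * M') / (M' * N') by field; lra.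
    have -> : (a i ^+ 2 * (N' / M') + b i ^+ 2 * (M' / N')) / 2
      = (((a i * N') ^+ 2 + (b i * M') ^+ 2) / 2) / (M' * N') by field; lra.
    rewrite ler_pM2r ?invr_gt0 ?mulr_gt0//.
    by have := sqr_ge0 (a i * N' - b i * M'); lra.
  rewrite ler_pM2r ?invr_gt0// lerD// -mulr_suml ler_pM2r ?divr_gt0//.
    by apply: le_trans hM _; rewrite lerXn2r// ?nnegrE ltW.
  by apply: le_trans hN _; rewrite lerXn2r// ?nnegrE ltW.
apply/ler_addgt0Pr => e e0.
(* Since [t <= 1], the excess [t * (M + N + t)] of [(M + t) * (N + t)] over [M * N] is at most
   [t * (M + N + 1) <= e]. *)
pose t := e / (M + N + 1 + e).
have D0 : 0 < M + N + 1 + e by lra.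
have t0 : 0 < t by rewrite divr_gt0.
have t1 : t <= 1 by rewrite ler_pdivrMr// mul1r; lra.
apply: le_trans (pos (M + t) (N + t) _ _) _; rewrite ?ltrDl//.
have : t * (M + N + 1) <= e.
  rewrite /t mulrAC ler_pdivrMr// ler_wpM2l ?ltW//; lra.
nra.
Qed.

Lemma sum_sq_add_le (T : Type) (s : seq T) (a b : T -> R) (M N : R) :
  (forall i, 0 <= a i) -> (forall i, 0 <= b i) -> 0 <= M -> 0 <= N ->
  \sum_(i <- s) a i ^+ 2 <= M ^+ 2 -> \sum_(i <- s) b i ^+ 2 <= N ^+ 2 ->
  \sum_(i <- s) (a i + b i) ^+ 2 <= (M + N) ^+ 2.
Proof.
move=> a0 b0 M0 N0 hM hN; have := sum_mul_le a0 b0 M0 N0 hM hN.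
under [X in _ -> X <= _]eq_bigr do rewrite sqrrD.
rewrite !big_split /= sqrrD => h; lra.
Qed.

(** Jensen's inequality for the square, with weights [k] of total mass at most [A]: expand the
    nonnegative weighted sum of [(x i - S / A) ^+ 2]. *)
Lemma sum_weighted_sq_le (T : Type) (s : seq T) (k x : T -> R) (A : R) :
  (forall i, 0 <= k i) -> 0 < A -> \sum_(i <- s) k i <= A ->
  (\sum_(i <- s) k i * x i) ^+ 2 <= A * \sum_(i <- s) k i * x i ^+ 2.
Proof.
move=> k0 A0 hA; set S := \sum_(i <- s) k i * x i.
have : 0 <= \sum_(i <- s) k i * (x i - S / A) ^+ 2.
  by apply: sumr_ge0 => i _; rewrite mulr_ge0// sqr_ge0.
have -> : \sum_(i <- s) k i * (x i - S / A) ^+ 2 = \sum_(i <- s) k i * x i ^+ 2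
   - 2 * (S / A) * S + (S / A) ^+ 2 * \sum_(i <- s) k i.
  rewrite [in X in _ - X](mulr_sumr) -sumrB mulr_sumr -big_split /=.
  by apply: eq_bigr => i _; ring.
move=> h; rewrite mulrC -ler_pdivrMr//.
have h2 : (S / A) ^+ 2 * \sum_(i <- s) k i <= (S / A) ^+ 2 * A.
  by rewrite ler_wpM2l// sqr_ge0.
have e1 : (S / A) ^+ 2 * A = S ^+ 2 / A by field; lra.
have e2 : 2 * (S / A) * S = 2 * (S ^+ 2 / A) by field; lra.
lra.
Qed.

Lemma fsbig_seq_supp (V : zmodType) (T : choiceType) (A : set T) (s : seq T) (f : T -> V) :
  uniq s -> (forall m, m \in s -> A m) -> (forall m, A m -> f m != 0 -> m \in s) ->
  \sum_(m \in A) f m = \sum_(m <- s) f m.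
Proof.
move=> us sA hs.
have -> : \sum_(m <- s) f m = \sum_(m \in [set` s]) f m by rewrite -fsbig_seq.
symmetry; apply: fsbig_widen => //= m [Am ms] /=.
by apply/eqP/negPn/negP => /(hs _ Am) /ms.
Qed.

End FiniteSums.

(** * Groupoid identities from the Hahn-Renault axioms *)

Section GroupoidIdentities.
Context {G : topologicalType} (gr : groupoid G).
Local Notation mul := (gmul gr).
Local Notation inv := (ginv gr).
Local Notation src := (src gr).
Local Notation rng := (rng gr).
Local Notation comp := (composable gr).

Lemma ginv_inj : injective inv.
Proof. exact: can_inj (ginvK gr). Qed.

Lemma src_inv x : src (inv x) = rng x.
Proof. by rewrite /Defs.src ginvK. Qed.

Lemma rng_inv x : rng (inv x) = src x.
Proof. by rewrite /Defs.rng ginvK. Qed.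

Lemma composablegV x : comp x (inv x).
Proof. by have := composableVg gr (inv x); rewrite ginvK. Qed.

Lemma src_mull x y : comp x y -> comp (src x) y /\ mul (src x) y = y.
Proof.
move=> xy; have [h _ e] := gmulA (composableVg gr x) xy.
by split=> //; rewrite /Defs.src e gmulVK.
Qed.

Lemma composable_src_rng x y : comp x y -> src x = rng y.
Proof. by move=> /src_mull [h e]; rewrite -(gmulK h) e. Qed.

Lemma mulg_src x : comp x (src x) /\ mul x (src x) = x.
Proof.
have [_ h _] := gmulA (composablegV x) (composableVg gr x); split=> //.
by have := gmulVK (composableVg gr x); rewrite ginvK.
Qed.

Lemma mulg_rng x : comp (rng x) x /\ mul (rng x) x = x.
Proof.
have [h _ e] := gmulA (composablegV x) (composableVg gr x); split=> //.
by rewrite /Defs.rng e; case: (mulg_src x).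
Qed.

(** For the converse, insert the common unit: [x] composes with [src x = rng y], which composes with
    [y], and associativity makes [x] composable with the product of [rng y] and [y], which is
    [y]. *)
Lemma composableE x y : comp x y <-> src x = rng y.
Proof.
split; first exact: composable_src_rng.
move=> e; have [h1 _] := mulg_src x; have [h2 e2] := mulg_rng y.
by rewrite e in h1; have [_ + _] := gmulA h1 h2; rewrite e2.
Qed.

Lemma rng_src x : rng (src x) = src x.
Proof. by have [/composable_src_rng] := mulg_src x. Qed.

Lemma src_rng x : src (rng x) = rng x.
Proof. by have [/composable_src_rng] := mulg_rng x. Qed.

Lemma rng_unit u : units gr u -> rng u = u.
Proof. by move=> [x _ <-]; rewrite -(src_inv x) rng_src. Qed.

Lemma src_unit u : units gr u -> src u = u.
Proof. by move=> [x _ <-]; rewrite src_rng. Qed.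

Lemma units_src x : units gr (src x).
Proof. by exists (inv x) => //; rewrite rng_inv. Qed.

Lemma units_rng x : units gr (rng x).
Proof. by exists x. Qed.

Lemma inv_unit u : units gr u -> inv u = u.
Proof.
move=> hu; have [_ e] := src_mull (composablegV u).
by rewrite -[LHS]e (src_unit hu) -[mul _ _]/(rng u) rng_unit.
Qed.

Lemma src_mul x y : comp x y -> src (mul x y) = src y.
Proof.
by move=> xy; have [/composable_src_rng -> _ _] := gmulA xy (composablegV y); rewrite rng_inv.
Qed.

Lemma rng_mul x y : comp x y -> rng (mul x y) = rng x.
Proof.
by move=> xy; have [_ /composable_src_rng <- _] := gmulA (composableVg gr x) xy; rewrite src_inv.
Qed.

Lemma inv_mul x y : comp x y -> inv (mul x y) = mul (inv y) (inv x).
Proof.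
move=> xy.
have c1 : comp (mul x y) (inv y) by apply/composableE; rewrite src_mul// rng_inv.
have e1 := gmulVK c1; rewrite (gmulK xy) in e1.
have c2 : comp (inv (mul x y)) x by apply/composableE; rewrite src_inv rng_mul.
by rewrite -(gmulK c2) e1.
Qed.

(** For two points of one source fiber this is the arrow taking [y] to [x]; the kernel of [Lambda f]
    depends on it alone. *)
Definition gdiv x y := mul x (inv y).

Lemma gdivE x y : gdiv x y = mul x (inv y). Proof. by []. Qed.

Lemma composable_div x y : src x = src y -> comp x (inv y).
Proof. by move=> e; apply/composableE; rewrite rng_inv. Qed.

Lemma src_div x y : src x = src y -> src (gdiv x y) = rng y.
Proof. by move=> e; rewrite src_mul ?src_inv//; exact: composable_div. Qed.

Lemma rng_div x y : src x = src y -> rng (gdiv x y) = rng x.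
Proof. by move=> e; rewrite rng_mul//; exact: composable_div. Qed.

Lemma inv_div x y : src x = src y -> inv (gdiv x y) = gdiv y x.
Proof. by move=> e; rewrite inv_mul ?ginvK//; exact: composable_div. Qed.

Lemma mul_divK x y : src x = src y -> mul (gdiv x y) y = x.
Proof. by move=> e; have := gmulK (composable_div e); rewrite ginvK. Qed.

Lemma composable_div_den x y : src x = src y -> comp (gdiv x y) y.
Proof. by move=> e; apply/composableE; rewrite src_div. Qed.

(** Invariance under right translation, which justifies the change of variables in [Lambda_comp]. *)
Lemma gdiv_div x y z : src x = src z -> src y = src z ->
  gdiv (gdiv x z) (gdiv y z) = gdiv x y.
Proof.
move=> e1 e2.
have c1 : comp x (inv z) by exact: composable_div.
have c2 : comp (inv z) (gdiv z y) by apply/composableE; rewrite src_inv rng_div.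
have [_ _ e] := gmulA c1 c2.
rewrite {1}/gdiv inv_div// e; congr mul.
by rewrite gmulVK//; exact: composable_div.
Qed.

Lemma gdiv_src x : gdiv x (src x) = x.
Proof. by rewrite /gdiv (inv_unit (units_src x)); case: (mulg_src x). Qed.

Lemma gdiv_unit x y : src x = src y -> units gr (gdiv x y) -> x = y.
Proof.
move=> e u; rewrite -(mul_divK e) -{1}(src_unit u).
have [_] := mulg_rng y; by rewrite src_div.
Qed.

End GroupoidIdentities.

(** * Triangle inequalities for the length *)

Section LengthIdentities.
Context {R : realType} {G : topologicalType} (gr : groupoid G) (l : G -> R).
Hypothesis hl : length_function gr l.
Local Notation inv := (ginv gr).
Local Notation src := (src gr).
Local Notation gdiv := (gdiv gr).

Lemma length_ge0 g : 0 <= l g.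
Proof. by case: hl => -[]. Qed.

Lemma length_inv g : l (inv g) = l g.
Proof. by case: hl. Qed.

Lemma length_div_sym g m : src g = src m -> l (gdiv g m) = l (gdiv m g).
Proof. by move=> e; rewrite -length_inv inv_div. Qed.

Lemma length_le_div g m : src g = src m -> l g <= l (gdiv g m) + l m.
Proof.
move=> e; rewrite -{1}(mul_divK e); case: hl => _ _ _; apply.
exact: composable_div_den.
Qed.

(** Each commutator with [Dl] multiplies a kernel by [l g - l m]; on a band this factor is bounded
    by the width. *)
Lemma length_dist_le g m : src g = src m -> `|l g - l m| <= l (gdiv g m).
Proof.
move=> e; rewrite ler_norml; have := length_le_div e.
have := length_le_div (esym e); rewrite (length_div_sym (esym e)) => h1 h2.
by apply/andP; split; lra.
Qed.

Lemma length_continuous : continuous l.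
Proof. by case: hl => -[]. Qed.

Lemma length_eq0 g : l g = 0 <-> units gr g.
Proof. by case: hl. Qed.

End LengthIdentities.

(** * Local sections of the source map *)

Section EtaleTopology.
Context {G : topologicalType} (gr : groupoid G).
Hypothesis hlch : lch_groupoid gr.
Hypothesis het : etale gr.
Local Notation inv := (ginv gr).
Local Notation src := (src gr).
Local Notation rng := (rng gr).
Local Notation gdiv := (gdiv gr).

Lemma ginv_continuous : continuous inv.
Proof. by case: hlch. Qed.

Lemma rng_continuous : continuous rng.
Proof.
move=> x; have [V [[oV Vx] _ cV _]] := het x.
by rewrite continuous_open_subspace// in cV; apply: cV; rewrite inE.
Qed.

Lemma src_continuous : continuous src.
Proof.
have -> : src = rng \o inv by apply/funext => x /=; rewrite rng_inv.
by move=> x; apply: continuous_comp; [exact: ginv_continuous|exact: rng_continuous].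
Qed.

(** [etale] speaks of [rng]; the homeomorphism [inv] exchanges it with [src]. *)
Lemma src_local_homeo x : exists V : set G, [/\ open V, V x, set_inj V src &
  forall W, open W -> W `<=` V -> exists2 O, open O & src @` W = O `&` units gr].
Proof.
have [V [[oV Vx] injV _ hV]] := het (inv x).
exists (inv @^-1` V); split => //.
- by move/continuousP : ginv_continuous; apply.
- move=> y z; rewrite !inE /= => Vy Vz; rewrite -!rng_inv => e.
  by apply: (@ginv_inj _ gr); apply: injV; rewrite ?inE.
move=> W oW WV; have [||O oO e] := hV (inv @^-1` W).
- by move/continuousP : ginv_continuous; apply.
- by move=> y /= /WV /=; rewrite ginvK.
exists O => //; rewrite -e; apply/seteqP; split => y [z /= Wz <-].
  by exists (inv z); rewrite /= ?ginvK// rng_inv.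
by exists (inv z) => //=; rewrite src_inv.
Qed.

(** Multiplication is continuous only relative to the composable pairs, hence the restriction to
    pairs with a common source. *)
Lemma gdiv_continuous g m (U : set G) : src g = src m -> nbhs (gdiv g m) U ->
  exists A B, [/\ nbhs g A, nbhs m B &
    forall g' m', A g' -> B m' -> src g' = src m' -> U (gdiv g' m')].
Proof.
move=> e nU; have [_ _ _ cm] := hlch.
have cgm : composable gr g (inv m) by exact: composable_div.
have : within [set p : G * G | composable gr p.1 p.2] (nbhs (g, inv m))
    ((fun p : G * G => gmul gr p.1 p.2) @^-1` U).
  by rewrite nbhs_subspace_in//; exact: (cm (g, inv m) U nU).
move=> [[A B] /= [nA nB] AB].
exists A, (inv @^-1` B); split => //; first exact: ginv_continuous.
move=> g' m' Ag Bm e'; apply: (AB (g', inv m')) => //=.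
exact: composable_div.
Qed.

(** Openness of [src] onto the unit space, used to continue a point of one fiber to the nearby
    fibers. *)
Lemma src_section_nbhs (x : G) (W : set G) :
  nbhs x W -> \forall u \near src x, units gr u -> exists2 y, W y & src y = u.
Proof.
rewrite nbhsE => -[W' [oW Wx] WW'].
have [V [oV Vx injV hV]] := src_local_homeo x.
have [|O oO e] := hV (W' `&` V) (openI oW oV); first by move=> ? [].
have Ox : O (src x) by have : (src @` (W' `&` V)) (src x) by [exists x]; rewrite e => -[].
apply: filterS (open_nbhs_nbhs (conj oO Ox)) => u Ou uu.
have : (O `&` units gr) u by [].
by rewrite -e => -[y [/WW' Wy _] <-]; exists y.
Qed.

End EtaleTopology.

Lemma near_all_seq (T : Type) (F : set_system T) (S : eqType) (s : seq S)
    (P : S -> T -> Prop) : Filter F ->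
  (forall x, x \in s -> \forall y \near F, P x y) ->
  \forall y \near F, forall x, x \in s -> P x y.
Proof.
move=> FF; elim: s => [|a s IH] h; first exact: filterE.
have h1 := h a (mem_head _ _).
have h2 : \forall y \near F, forall x, x \in s -> P x y.
  by apply: IH => x xs; apply: h; rewrite inE xs orbT.
apply: filterS2 h1 h2 => y Pa Ps x; rewrite inE => /orP[/eqP ->//|]; exact: Ps.
Qed.

(** Separating sets are chosen for ordered pairs without any symmetry, so [V m] intersects the first
    set for [(m, m')] with the second one for [(m', m)]. *)
Lemma hausdorff_separate_seq (T : topologicalType) (s : seq T) :
  hausdorff_space T -> exists V : T -> set T, (forall m, nbhs m (V m)) /\
    forall m m' y, m \in s -> m' \in s -> V m y -> V m' y -> m = m'.
Proof.
move=> hT.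
have sep (p : T * T) : exists AB : set T * set T, p.1 <> p.2 ->
    [/\ nbhs p.1 AB.1, nbhs p.2 AB.2 & AB.1 `&` AB.2 = set0].
  have [e|ne] := eqVneq p.1 p.2; first by exists (set0, set0).
  have := hT; rewrite open_hausdorff => /(_ p.1 p.2 ne) [[A B]] /= [h1 h2] [oA oB /eqP dAB].
  exists (A, B) => _; split=> //=; apply: open_nbhs_nbhs; split=> //; exact/set_mem.
have [AB hAB] := choice sep.
exists (fun m => [set y | forall m', m' \in s -> m' <> m -> (AB (m, m')).1 y /\ (AB (m', m)).2 y]).
split=> [m|m m' y ms m's h h'].
  apply: near_all_seq => m' m's.
  have [->|/eqP ne] := eqVneq m' m; first exact: filterE.
  have [h1 _ _] := hAB (m, m') (nesym ne); have [_ h2 _] := hAB (m', m) ne.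
  by apply: filterS2 h1 h2.
apply: contrapT => ne; have [h1 _] := h _ m's (nesym ne); have [_ h2] := h' _ ms ne.
have [_ _ e] := hAB (m, m') ne.
by have : ((AB (m, m')).1 `&` (AB (m, m')).2) y by []; rewrite e.
Qed.

(** * Balls in fibers and continuity of sums over fibers *)

Section Kernels.
Context {R : realType} {G : topologicalType} (gr : groupoid G) (l : G -> R).
Hypotheses (hlch : lch_groupoid gr) (het : etale gr).
Hypotheses (hl : length_function gr l) (hproper : proper_length l).
Hypothesis hunif : forall t, 0 <= t -> exists2 F : R, 1 <= F & fiber_card_le gr l t F.
Local Notation C := (Cplx R).
Local Notation normc := (@ComplexField.Normc.normc R).
Local Notation inv := (ginv gr).
Local Notation src := (src gr).
Local Notation rng := (rng gr).
Local Notation gdiv := (gdiv gr).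
Implicit Types (f xi eta : G -> C) (K : G -> G -> C).

Definition fball (u : G) (t : R) : seq G := fset_set (lball l t `&` fiber_src gr u).

Lemma finite_fball u t : units gr u -> finite_set (lball l t `&` fiber_src gr u).
Proof.
move=> uu; have [t0|t0] := leP 0 t.
  by have [F _ /(_ _ uu)[]] := hunif t0.
have -> : lball l t = set0; last by rewrite set0I.
apply/seteqP; split=> // g /=; rewrite /lball /= => h.
by have := le_lt_trans h t0; rewrite ltNge (length_ge0 hl).
Qed.

Lemma mem_fball u t g : units gr u -> (g \in fball u t) <-> src g = u /\ l g <= t.
Proof.
move=> uu; rewrite /fball in_fset_set; last exact: finite_fball.
by rewrite inE /lball /fiber_src /=; split=> -[].
Qed.

Lemma uniq_fball u t : uniq (fball u t).
Proof. exact: fset_uniq. Qed.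

Lemma size_fball_le t F u (s : seq G) : fiber_card_le gr l t F -> units gr u ->
  uniq s -> (forall m, m \in s -> src m = u /\ l m <= t) -> (size s)%:R <= F.
Proof.
move=> hF uu us hs; have [_] := hF u uu; apply: le_trans.
rewrite ler_nat; apply: uniq_leq_size => // m /hs h.
exact/(mem_fball t m uu).
Qed.

(** A continuous [l] is bounded on the compact support; conversely a ball is compact by properness,
    hence closed, and so contains the closure. Later arguments use compact support mostly in this
    form. *)
Lemma Cc_bounded_support f :
  Cc f <-> continuous f /\ exists2 t, 0 <= t & forall g, f g != 0 -> l g <= t.
Proof.
split=> [[cf kf]|[cf [t t0 ht]]]; split=> //.
  have : compact (l @` closure [set x | f x != 0]).
    apply: continuous_compact => //; apply: continuous_subspaceT.
    exact: (length_continuous hl).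
  move/compact_bounded => [M [Mr hM]].
  exists (Num.max 0 (M + 1)); first by rewrite le_max lexx.
  move=> g fg; rewrite le_max; apply/orP; right.
  apply: le_trans (ler_norm _) _; apply: hM; first by rewrite ltrDl.
  by exists g => //; exact: subset_closure.
apply: (@subclosed_compact _ _ (lball l t)); [exact: closed_closure|exact: hproper|].
have cl : closed (lball l t).
  by apply: compact_closed; [case: hlch|exact: hproper].
rewrite closureE => g; apply; split=> //; exact: ht.
Qed.

(* Near [g0], the points of the fiber over [src g] at which the summand does not
   vanish lie on the local sections of [src] through the points of the fiber
   over [src g0], by compactness of the ball of radius [t]. *)
Lemma fiber_sum_cvg (h : G -> G -> C) (g0 : G) (t : R) :
  0 <= t ->
  (forall g m, src g = src m -> h g m != 0 -> l m <= t) ->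
  (forall m, src g0 = src m -> forall e : R, 0 < e -> exists A B,
    [/\ nbhs g0 A, nbhs m B & forall g' m', A g' -> B m' -> src g' = src m' ->
        normc (h g' m' - h g0 m) < e]) ->
  (fun g => \sum_(m \in fiber_src gr (src g)) h g m) @ g0 -->
  (\sum_(m \in fiber_src gr (src g0)) h g0 m : C).
Proof.
move=> t0 hsupp hc; apply/cvg_normcP => e e0.
have u0 := units_src gr g0.
set M := fball (src g0) t.
pose e' := e / ((size M)%:R + 1).
have e'0 : 0 < e' by rewrite divr_gt0// ltr_wpDl.
have [hT _ _ _] := hlch.
have [V [nV sepV]] := hausdorff_separate_seq M hT.
have hAB m : exists AB : set G * set G, src g0 = src m ->
    [/\ nbhs g0 AB.1, nbhs m AB.2 & forall g' m', AB.1 g' -> AB.2 m' ->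
       src g' = src m' -> normc (h g' m' - h g0 m) < e'].
  have [em|nem] := pselect (src g0 = src m); last by exists (set0, set0).
  by have [A [B hh]] := hc m em e' e'0; exists (A, B).
have [AB {}hAB] := choice hAB.
have [J hJ] := choice (src_local_homeo hlch het).
(* The three factors make the [W m] disjoint, make [src] injective on each, and keep the summand
   close to [h g0 m]. *)
pose W m := (V m `&` J m) `&` (AB m).2.
have memM m : m \in M -> src g0 = src m by move/(mem_fball _ _ u0) => [].
have nW m : m \in M -> nbhs m (W m).
  move=> mM; apply: filterI; last by have [] := hAB m (memM _ mM).
  by apply: filterI => //; have [oJ Jm _ _] := hJ m; exact: open_nbhs_nbhs.
have near_src (P : set G) : (\forall u \near src g0, P u) -> \forall g \near g0, P (src g).
  exact: (src_continuous hlch het).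
have nA : \forall g \near g0, forall m, m \in M -> (AB m).1 g.
  by apply: near_all_seq => m /memM em; have [] := hAB m em.
have nsec : \forall g \near g0, forall m, m \in M -> exists2 y, W m y & src y = src g.
  apply: near_all_seq => m mM.
  have := src_section_nbhs hlch het (nW _ mM); rewrite -(memM _ mM) => /near_src.
  by apply: filterS => g; apply; exact: units_src.
have nout : \forall g \near g0, forall y, src y = src g -> l y <= t ->
    exists2 m, m \in M & W m y.
  (* [Q] is what the sets [W m] leave uncovered in the ball. Its image under [src] is compact, hence
     closed, and misses [src g0], so fibers over nearby units avoid [Q]. *)
  pose Q := lball l t `&` ~` \bigcup_(m in [set` M]) interior (W m).
  have cQ : compact (src @` Q).
    apply: continuous_compact.
      exact: continuous_subspaceT (src_continuous hlch het).
    apply: (subclosed_compact _ (hproper t0)); last by move=> ? [].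
    apply: closedI; first by apply: compact_closed => //; exact: hproper.
    by apply: open_closedC; apply: bigcup_open => m _; exact: open_interior.
  have oQ : open (~` (src @` Q)) by apply: closed_openC; exact: compact_closed.
  have : \forall u \near src g0, (~` (src @` Q)) u.
    apply: open_nbhs_nbhs; split=> // -[y [ly hy] e0'].
    apply: hy; exists y => /=; last by apply: nW; apply/(mem_fball _ _ u0).
    exact/(mem_fball _ _ u0).
  move/near_src; apply: filterS => g hg y ey ly.
  apply: contrapT => hy; apply: hg; exists y => //; split=> // -[m mM Wy].
  by apply: hy; exists m => //; exact: interior_subset Wy.
near=> g.
(* [sg m] is the point of the fiber over [src g] on the section through [m]. The points [sg m] are
   distinct and include all that contribute to the sum at [g]. *)
have : forall m, exists y, m \in M -> W m y /\ src y = src g.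
  move=> m; have [mM|mM] := boolP (m \in M); last by exists m.
  have : exists2 y, W m y & src y = src g.
    by move: m mM; near: g.
  by move=> [y]; exists y.
move=> /choice [sg hsg].
have inj m m' y : m \in M -> m' \in M -> W m y -> W m' y -> m = m'.
  by move=> mM m'M [[h1 _] _] [[h2 _] _]; exact: sepV h1 h2.
have umap : uniq (map sg M).
  rewrite map_inj_in_uniq ?uniq_fball// => m m' mM m'M es.
  have [h1 _] := hsg _ mM; have [h2 _] := hsg _ m'M; rewrite -es in h2.
  exact: inj h1 h2.
rewrite (@fsbig_seq_supp _ _ _ (map sg M)) //; last 2 first.
- by move=> y /mapP[m mM ->]; have [] := hsg _ mM.
- move=> y ey hy; have ly : l y <= t by apply: (hsupp g) => //; exact: esym.
  have [m mM Wy] : exists2 m, m \in M & W m y.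
    by move: y ey ly {hy}; near: g.
  apply/mapP; exists m => //; have [Ws es] := hsg _ mM.
  have [_ _ injJ _] := hJ m; apply: injJ; rewrite ?inE.
  + by case: Wy => -[].
  + by case: Ws => -[].
  + by rewrite es.
rewrite (@fsbig_seq_supp _ _ _ M) ?uniq_fball//; last 2 first.
- by move=> y /memM/esym.
- move=> y ey hy; apply/(mem_fball _ _ u0); split=> //.
  by apply: (hsupp g0) => //; exact: esym.
rewrite big_map -sumrB; apply: le_lt_trans (normc_sum _ _ _) _.
apply: (@le_lt_trans _ _ (\sum_(m <- M) e')).
  rewrite !big_seq; apply: ler_sum => m mM.
  have [Ws es] := hsg _ mM; have [_ _ hlt] := hAB m (memM _ mM).
  apply/ltW/hlt => //; last by case: Ws.
  by move: m mM {Ws es hlt}; near: g.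
rewrite big_const_seq iter_addr_0 count_predT -mulr_natr /e' mulrAC.
rewrite ltr_pdivrMr ?ltr_wpDl// ltr_pM2l// ltrDl//.
Unshelve. all: by end_near.
Qed.

End Kernels.

(** * Operators given by banded continuous kernels *)

Section KernelOperators.
Context {R : realType} {G : topologicalType} (gr : groupoid G) (l : G -> R).
Hypotheses (hlch : lch_groupoid gr) (het : etale gr).
Hypotheses (hl : length_function gr l) (hproper : proper_length l).
Hypothesis hunif : forall t, 0 <= t -> exists2 F : R, 1 <= F & fiber_card_le gr l t F.
Local Notation C := (Cplx R).
Local Notation normc := (@ComplexField.Normc.normc R).
Local Notation inv := (ginv gr).
Local Notation src := (src gr).
Local Notation rng := (rng gr).
Local Notation gdiv := (gdiv gr).
Local Notation fball := (fball gr l).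
Implicit Types (f xi eta : G -> C) (K : G -> G -> C).

(* Both [Lambda f] and the iterated commutators [delta n f] are of this form, with
   kernels supported near the diagonal. *)
Definition kop K xi : G -> C := fun g =>
  \sum_(m \in fiber_src gr (src g)) K g m * xi m.

Definition banded (t : R) K :=
  forall g m, src g = src m -> K g m != 0 -> l (gdiv g m) <= t.

(** Continuity on the fibered product over [src], since the values of a kernel at pairs with
    different sources are irrelevant. *)
Definition kernel_continuous K :=
  forall g m, src g = src m -> forall e : R, 0 < e -> exists A B,
    [/\ nbhs g A, nbhs m B & forall g' m', A g' -> B m' -> src g' = src m' ->
        normc (K g' m' - K g m) < e].

Lemma kop_seq K xi g (s : seq G) : uniq s -> (forall m, m \in s -> src m = src g) ->
  (forall m, src g = src m -> K g m != 0 -> xi m != 0 -> m \in s) ->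
  kop K xi g = \sum_(m <- s) K g m * xi m.
Proof.
move=> us sg hs; apply: fsbig_seq_supp => // m em; rewrite mulf_eq0 negb_or => /andP[].
exact: hs.
Qed.

Lemma banded_mem_fball t K g m T : banded t K -> src g = src m -> K g m != 0 ->
  l g + t <= T -> m \in fball (src g) T.
Proof.
move=> bK e /(bK _ _ e) h hT; apply/(mem_fball hl hunif _ _ (units_src gr g)).
split=> //; have := length_le_div hl (esym e).
by rewrite (length_div_sym hl (esym e)); lra.
Qed.

(** The radius [T] is left free so that several kernels can be summed over one finite set. *)
Lemma kop_fball t K xi g T : banded t K -> l g + t <= T ->
  kop K xi g = \sum_(m <- fball (src g) T) K g m * xi m.
Proof.
move=> bK hT; apply: kop_seq; first exact: uniq_fball.
  by move=> m /(mem_fball hl hunif _ _ (units_src gr g)) [].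
by move=> m e h _; exact: (banded_mem_fball bK).
Qed.

Lemma kopD t K xi eta : banded t K -> kop K (xi + eta) = kop K xi + kop K eta.
Proof.
move=> bK; apply/funext => g.
rewrite -[RHS]/(kop K xi g + kop K eta g) !(kop_fball _ bK (lexx (l g + t))) -big_split /=.
by apply: eq_bigr => m _; exact: mulrDr.
Qed.

Lemma kopZ t K (a : R[i]) xi : banded t K -> kop K (a *: xi) = a *: kop K xi.
Proof.
move=> bK; apply/funext => g.
rewrite -[RHS]/(a *: kop K xi g) !(kop_fball _ bK (lexx (l g + t))) scaler_sumr.
by apply: eq_bigr => m _; exact: mulrCA.
Qed.

Lemma mulc_continuous (a b : C) (e : R) : 0 < e -> exists2 d : R, 0 < d &
  forall a' b', normc (a' - a) < d -> normc (b' - b) < d -> normc (a' * b' - a * b) < e.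
Proof.
move=> e0; pose D := normc a + normc b + 1.
have D0 : 0 < D by rewrite /D ltr_wpDl// addr_ge0 ?normc_ge0.
exists (Num.min 1 (e / D)); first by rewrite lt_min ltr01 divr_gt0.
move=> a' b'; rewrite !lt_min => /andP[_ ha] /andP[hb1 hb].
have -> : a' * b' - a * b = (a' - a) * b' + a * (b' - b) by ring.
apply: le_lt_trans (normcD _ _) _; rewrite !normcM.
have hb' : normc b' <= normc b + 1.
  have := normcD (b' - b) b; rewrite subrK => h; lra.
have := normc_ge0 (a' - a); have := normc_ge0 (b' - b); have := normc_ge0 a => h1 h2 h3.
have h4 := normc_ge0 b'.
have hb0 := normc_ge0 b; pose d := e / D.
have d0 : 0 < d by rewrite divr_gt0.
have ed : e = d * (normc b + 1) + normc a * d by rewrite /d /D; field; rewrite -/D; lra.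
rewrite ed; apply: ltr_leD; last by rewrite ler_wpM2l// ltW.
apply: (@le_lt_trans _ _ (normc (a' - a) * (normc b + 1))); first by rewrite ler_wpM2l.
by rewrite ltr_pM2r//; lra.
Qed.

Lemma kernel_continuousM K K' : kernel_continuous K -> kernel_continuous K' ->
  kernel_continuous (fun g m => K g m * K' g m).
Proof.
move=> cK cK' g m em e e0.
have [d d0 hd] := mulc_continuous (K g m) (K' g m) e0.
have [A [B [nA nB h]]] := cK g m em d d0.
have [A' [B' [nA' nB' h']]] := cK' g m em d d0.
exists (A `&` A'), (B `&` B'); split; [exact: filterI|exact: filterI|].
by move=> g' m' [Ag Ag'] [Bm Bm'] e'; apply: hd; [apply: h|apply: h'].
Qed.

Lemma kernel_continuous_snd xi : continuous xi -> kernel_continuous (fun _ m => xi m).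
Proof.
move=> cxi g m em e e0; have /cvg_normcP/(_ e e0) h := cxi m.
exists setT, [set m' | normc (xi m' - xi m) < e]; split => //; exact: filterT.
Qed.

Lemma kernel_continuous_div f : continuous f -> kernel_continuous (fun g m => f (gdiv g m)).
Proof.
move=> cf g m em e e0; have /cvg_normcP/(_ e e0) h := cf (gdiv g m).
have [A [B [nA nB hAB]]] := gdiv_continuous hlch em h.
by exists A, B; split.
Qed.

Lemma kernel_continuous_length : kernel_continuous (fun g m => (l g - l m)%:C%C).
Proof.
move=> g m em e e0; have e2 : 0 < e / 2 by rewrite divr_gt0.
have /cvgrPdist_lt/(_ _ e2) h1 := length_continuous hl (x:=g).
have /cvgrPdist_lt/(_ _ e2) h2 := length_continuous hl (x:=m).
exists [set g' | `|l g - l g'| < e / 2], [set m' | `|l m - l m'| < e / 2]; split=> //.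
move=> g' m' /= hg hm _.
apply: (@le_lt_trans _ _ (normc ((l g' - l m' - (l g - l m))%:C%C))).
  by rewrite [X in _ <= normc X]cplx_realB.
rewrite normc_real.
have -> : l g' - l m' - (l g - l m) = (l m - l m') - (l g - l g') by ring.
by apply: le_lt_trans (ler_normB _ _) _; rewrite [e]splitr ltrD.
Qed.

Lemma kernel_continuousX K n : kernel_continuous K -> kernel_continuous (fun g m => K g m ^+ n).
Proof.
move=> cK; elim: n => [|n IH]; last first.
  by under eq_fun do under eq_fun do rewrite exprS; exact: kernel_continuousM.
move=> g m em e e0; exists setT, setT; split; [exact: filterT|exact: filterT|].
by move=> *; rewrite !expr0 subrr normc0.
Qed.

(** Continuity comes from [fiber_sum_cvg], where the support of [xi] bounds the summation; the
    support grows by at most the band width. *)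
Lemma kop_Cc t K xi : 0 <= t -> banded t K -> kernel_continuous K -> Cc xi -> Cc (kop K xi).
Proof.
move=> t0 bK cK /(Cc_bounded_support hlch hl hproper) [cxi [T T0 hT]].
apply/(Cc_bounded_support hlch hl hproper); split.
  move=> g0; apply: (fiber_sum_cvg hlch het hl hproper hunif (t:=T)) => //.
    by move=> g m _; rewrite mulf_eq0 negb_or => /andP[_ /hT].
  by apply: kernel_continuousM => //; exact: kernel_continuous_snd.
exists (t + T); first exact: addr_ge0.
move=> g; apply: contraR; rewrite -ltNge => hg.
apply/eqP; rewrite (kop_fball _ bK (lexx _)) big1_seq// => m /andP[_].
move=> /(mem_fball hl hunif _ _ (units_src gr g)) [em lm].
have [->|K0] := eqVneq (K g m) 0; first by rewrite mul0r.
have [->|/hT x0] := eqVneq (xi m) 0; first by rewrite mulr0.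
by exfalso; have := bK g m (esym em) K0; have := length_le_div hl (esym em); lra.
Qed.

Lemma LambdaE f xi : Lambda gr f xi = kop (fun g m => f (gdiv g m)) xi.
Proof. by []. Qed.

Lemma banded_Lambda f t : (forall g, f g != 0 -> l g <= t) ->
  banded t (fun g m => f (gdiv g m)).
Proof. by move=> hf g m _ /hf. Qed.

Lemma Lambda_Cc f xi : Cc f -> Cc xi -> Cc (Lambda gr f xi).
Proof.
move=> /(Cc_bounded_support hlch hl hproper) [cf [t t0 ht]].
apply: (kop_Cc (t:=t)) => //; first exact: banded_Lambda.
exact: kernel_continuous_div.
Qed.

(** [Lambda gr f h] is the convolution, so this is multiplicativity of the regular representation.
    The substitution of [gdiv q m] for the convolution variable turns its first factor into
    [f (gdiv g q)]; then two finite sums are exchanged, so no decay of [xi] is required. *)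
Lemma Lambda_comp f h xi : Cc f -> Cc h ->
  Lambda gr (Lambda gr f h) xi = Lambda gr f (Lambda gr h xi).
Proof.
move=> Cf Ch; have /(Cc_bounded_support hlch hl hproper) [_ [t t0 ht]] := Cf.
have /(Cc_bounded_support hlch hl hproper) [_ [t' t'0 ht']] := Ch.
have ug g := units_src gr g.
apply/funext => g; set s := fball (src g) (l g + t + t'); set s' := fball (src g) (l g + t).
have es m : m \in s -> src m = src g by move/(mem_fball hl hunif _ _ (ug g)) => [].
have es' m : m \in s' -> src m = src g by move/(mem_fball hl hunif _ _ (ug g)) => [].
have inner_sum m : src m = src g ->
    Lambda gr f h (gdiv g m) = \sum_(q <- s') f (gdiv g q) * h (gdiv q m).
  move=> em; rewrite LambdaE (@kop_seq _ _ _ (map (fun q => gdiv q m) s')).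
  - rewrite big_map big_seq [RHS]big_seq; apply: eq_bigr => q /es' eq.
    by rewrite gdiv_div// eq.
  - rewrite map_inj_in_uniq ?uniq_fball// => q q' /es' eq /es' eq' e.
    by rewrite -(@mul_divK _ gr q m) ?em// e mul_divK// em.
  - by move=> p /mapP[q /es' eq ->]; rewrite !src_div// ?em// eq.
  - move=> p ep fp _; apply/mapP; exists (gmul gr p m).
      have cpm : composable gr p m by apply/composableE; rewrite -ep src_div ?em.
      apply/(mem_fball hl hunif _ _ (ug g)); rewrite src_mul//; split=> //.
      have e1 : gdiv (gdiv g m) p = gdiv g (gmul gr p m).
        rewrite -{1}(gmulK cpm) -[gmul gr (gmul gr p m) _]/(gdiv _ _) gdiv_div// ?em//.
        by rewrite src_mul// em.
      have es1 : src g = src (gmul gr p m) by rewrite src_mul// em.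
      rewrite e1 in fp; have := ht _ fp; have := length_le_div hl (esym es1).
      by rewrite (length_div_sym hl (esym es1)); lra.
    rewrite gdivE gmulK//; apply/composableE.
    by rewrite -ep src_div ?em.
rewrite LambdaE (@kop_seq _ _ _ s); first last.
- move=> m em; rewrite inner_sum// => h0 _.
  apply/negPn/negP => ms; case/negP: h0; rewrite big1_seq// => q /andP[_ qs'].
  have [->|fq] := eqVneq (f (gdiv g q)) 0; first by rewrite mul0r.
  have [->|hq] := eqVneq (h (gdiv q m)) 0; first by rewrite mulr0.
  case/negP: ms; apply/(mem_fball hl hunif _ _ (ug g)); split=> //.
  move/(mem_fball hl hunif _ _ (ug g)) : qs' => [eq lq].
  have eqm : src m = src q by rewrite eq.
  have := ht' _ hq; have := length_le_div hl eqm; rewrite (length_div_sym hl eqm); lra.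
- exact: es.
- exact: uniq_fball.
rewrite [RHS](kop_fball _ (banded_Lambda ht) (lexx _)) -/s'.
transitivity (\sum_(m <- s) \sum_(q <- s') f (gdiv g q) * h (gdiv q m) * xi m).
  rewrite !big_seq; apply: eq_bigr => m /es em; rewrite inner_sum// mulr_suml//.
rewrite exchange_big /= !big_seq; apply: eq_bigr => q qs'.
have /(mem_fball hl hunif _ _ (ug g)) [eq lq] := qs'.
have lT : l q + t' <= l g + t + t' by rewrite lerD2r.
rewrite [Lambda _ _ _ _](kop_fball _ (banded_Lambda ht') lT) eq -/s mulr_sumr; apply: eq_bigr => m _; by rewrite mulrA.
Qed.

(** The kernel of the iterated commutator: commuting with multiplication by [l] multiplies a kernel
    by [l g - l m]. *)
Definition dkernel (n : nat) f : G -> G -> C := fun g m =>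
  (l g - l m)%:C%C ^+ n * f (gdiv g m).

Lemma banded_dkernel n f t : (forall g, f g != 0 -> l g <= t) -> banded t (dkernel n f).
Proof. by move=> hf g m _; rewrite mulf_eq0 negb_or => /andP[_ /hf]. Qed.

Lemma kernel_continuous_dkernel n f : continuous f -> kernel_continuous (dkernel n f).
Proof.
move=> cf; apply: kernel_continuousM; last exact: kernel_continuous_div.
by apply: kernel_continuousX; exact: kernel_continuous_length.
Qed.

(** The identity holds on all functions, so [delta n f] is defined on [E] as it stands and can serve
    as its own extension in [Ll]. *)
Lemma delta_kop n f : Cc f -> delta gr l n f = kop (dkernel n f).
Proof.
move=> /(Cc_bounded_support hlch hl hproper) [_ [t t0 ht]].
elim: n => [|n IH]; apply/funext => xi; apply/funext => g.
  rewrite /delta /= LambdaE; apply: eq_fsbigr => m _; by rewrite /dkernel expr0 mul1r.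
have ex (K : G -> G -> C) x : banded t K -> kop K x g = _ := fun b => kop_fball x b (lexx _).
rewrite /delta iterS -/(delta gr l n f) IH /commDl /Dl -[LHS]/(_ * _ - _).
rewrite !ex; try exact: banded_dkernel.
rewrite mulr_sumr -sumrB; apply: eq_bigr => m _.
by rewrite /dkernel exprS cplx_realB; ring.
Qed.

End KernelOperators.

(** * Extended suprema and infinite sums tested on finite sequences *)

Section NonnegativeSuprema.
Context {R : realType}.

Lemma nnsup_leP (A : set (\bar R)) (M : R) : 0 <= M ->
  (nnsup A <= M%:E)%E <-> forall a, A a -> (a <= M%:E)%E.
Proof.
move=> M0; rewrite /nnsup ge_max lee_fin M0 /=; split.
  by move=> h a Aa; apply: le_trans h; exact: ereal_sup_ubound.
by move=> h; apply: ge_ereal_sup => a /h.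
Qed.

Lemma nnsup_ge0 (A : set (\bar R)) : (0 <= nnsup A)%E.
Proof. by rewrite /nnsup le_max lexx. Qed.

(** The bridge from the norms of the definitions to bounds over duplicate-free finite sequences, in
    which the estimates are carried out. *)
Lemma sqrte_esum_leP (T : choiceType) (A : set T) (a : T -> R) (M : R) : 0 <= M ->
  (forall i, 0 <= a i) ->
  (sqrte (\esum_(i in A) (a i)%:E) <= M%:E)%E <->
  forall s, uniq s -> (forall i, i \in s -> A i) -> \sum_(i <- s) a i <= M ^+ 2.
Proof.
move=> M0 a0; have -> : M%:E = sqrte (M ^+ 2)%:E by rewrite /= sqrtr_sqr ger0_norm.
rewrite lee_sqrt ?lee_fin ?sqr_ge0//; split=> [h s us sA|h].
  rewrite -lee_fin; apply: le_trans h; rewrite -sumEFin (fsbig_seq _ _ us).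
  apply: esum_ge; exists [set` s]; last by [].
  by split=> //; exact: finite_seq.
apply: ge_ereal_sup => _ [F [fF FA] <-].
rewrite fsbig_finite// sumEFin lee_fin; apply: h => // i.
by rewrite in_fset_set// inE => /FA.
Qed.

End NonnegativeSuprema.

(** * The module [E] and the density of [Cc] in it *)

Section HilbertModule.
Context {R : realType} {G : topologicalType} (gr : groupoid G) (l : G -> R).
Hypotheses (hlch : lch_groupoid gr) (het : etale gr).
Hypotheses (hl : length_function gr l) (hproper : proper_length l).
Hypothesis hunif : forall t, 0 <= t -> exists2 F : R, 1 <= F & fiber_card_le gr l t F.
Local Notation C := (Cplx R).
Local Notation normc := (@ComplexField.Normc.normc R).
Local Notation inv := (ginv gr).
Local Notation src := (src gr).
Local Notation rng := (rng gr).
Local Notation gdiv := (gdiv gr).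
Local Notation fball := (fball gr l).
Implicit Types (f xi eta : G -> C) (K : G -> G -> C).

Local Notation E := (@E R G gr).

(* [sec_le xi M] is [normE xi <= M] expressed through finite sums. *)
Definition sec_le (M : R) xi := 0 <= M /\ forall u (s : seq G), uniq s ->
  (forall m, m \in s -> src m = u) -> \sum_(m <- s) normc (xi m) ^+ 2 <= M ^+ 2.

(** [sec_le] lets [u] range over all of [G]: the empty sequence is harmless, and a member of a
    nonempty one shows that [u] is a source, hence a unit. *)
Lemma normE_leP M xi : 0 <= M -> (normE gr xi <= M%:E)%E <-> sec_le M xi.
Proof.
move=> M0; rewrite /normE nnsup_leP//; split=> [h|[_ h] _ [u _ <-]].
  split=> // u [|m s] us su; first by rewrite big_nil sqr_ge0.
  have : (sqrte (\esum_(m in fiber_src gr u) (normc (xi m) ^+ 2)%:E) <= M%:E)%E.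
    by apply: h; exists u => //; rewrite -(su m (mem_head _ _)); exact: units_src.
  by move/(sqrte_esum_leP _ M0 (fun i => sqr_ge0 (normc (xi i)))); apply.
by apply/(sqrte_esum_leP _ M0 (fun i => sqr_ge0 (normc (xi i)))) => s us su; exact: (h u).
Qed.

Lemma normE_ge0 xi : (0 <= normE gr xi)%E.
Proof. exact: nnsup_ge0. Qed.

Lemma sec_le_ge0 M xi : sec_le M xi -> 0 <= M. Proof. by case. Qed.

Lemma sec_le_weaken M N xi : M <= N -> sec_le M xi -> sec_le N xi.
Proof.
move=> MN [M0 h]; have N0 := le_trans M0 MN; split=> // u s us su.
by apply: le_trans (h u s us su) _; rewrite lerXn2r.
Qed.

Lemma sec_le_at M xi g : sec_le M xi -> normc (xi g) <= M.
Proof.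
move=> [M0 /(_ (src g) [:: g])]; rewrite big_seq1 => h.
rewrite -(ler_pXn2r (n:=2))// ?nnegrE ?normc_ge0//; apply: h => // m.
by rewrite inE => /eqP ->.
Qed.

Lemma sec_leD M N xi eta : sec_le M xi -> sec_le N eta -> sec_le (M + N) (xi + eta).
Proof.
move=> [M0 hM] [N0 hN]; split; first exact: addr_ge0.
move=> u s us su.
apply: le_trans (sum_sq_add_le (fun i => normc_ge0 (xi i)) (fun i => normc_ge0 (eta i))
  M0 N0 (hM u s us su) (hN u s us su)).
by apply: ler_sum => i _; rewrite lerXn2r ?nnegrE ?addr_ge0 ?normc_ge0//; exact: normcD.
Qed.

Lemma sec_leZ M (a : R[i]) xi : sec_le M xi -> sec_le (normc a * M) (a *: xi).
Proof.
move=> [M0 h]; split; first by rewrite mulr_ge0 ?normc_ge0.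
move=> u s us su; rewrite exprMn.
have -> : \sum_(m <- s) normc ((a *: xi) m) ^+ 2 = normc a ^+ 2 * \sum_(m <- s) normc (xi m) ^+ 2.
  by rewrite mulr_sumr; apply: eq_bigr => m _; rewrite -exprMn -normcM.
by rewrite ler_wpM2l ?sqr_ge0//; exact: (h u).
Qed.

Lemma sec_leN M xi : sec_le M xi -> sec_le M (- xi).
Proof. by move=> h; rewrite -scaleN1r -[M]mul1r -normc1 -normcN; exact: sec_leZ. Qed.

Lemma sec_leB M N xi eta : sec_le M xi -> sec_le N eta -> sec_le (M + N) (xi - eta).
Proof. by move=> h /sec_leN; exact: sec_leD. Qed.

Lemma sec_le0 xi : sec_le 0 xi -> xi = 0.
Proof.
move=> h; apply/funext => g; apply: normc_small => e e0.
by apply: le_trans (sec_le_at g h) _; exact: ltW.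
Qed.

Lemma sec_le_addgt0 M xi : 0 <= M -> (forall e, 0 < e -> sec_le (M + e) xi) -> sec_le M xi.
Proof.
move=> M0 h; split=> // u s us su.
rewrite -[leLHS]sqr_sqrtr ?sumr_ge0//; last by move=> *; exact: sqr_ge0.
rewrite lerXn2r ?nnegrE ?sqrtr_ge0//; apply/ler_addgt0Pr => e e0.
rewrite -[leRHS]ger0_norm ?addr_ge0 ?(ltW e0)// -sqrtr_sqr ler_wsqrtr//.
by have [_ he] := h e e0; exact: (he u).
Qed.

(** A form of Fatou's lemma: the bound is tested on finite sets, on which pointwise convergence is
    uniform. *)
Lemma sec_le_lim M xi (x : nat -> G -> C) (k0 : nat) :
  (forall k, (k0 <= k)%N -> sec_le M (x k)) ->
  (forall g e, 0 < e -> \forall k \near \oo, normc (xi g - x k g) <= e) ->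
  sec_le M xi.
Proof.
move=> hM hx; have M0 : 0 <= M by case: (hM k0 (leqnn _)).
apply: sec_le_addgt0 => // e e0; split=> [|u s us su]; first by rewrite addr_ge0// ltW.
(* Chosen so that [size s] terms of size [d ^+ 2] add up to at most [e ^+ 2]. *)
pose d := e / ((size s)%:R + 1).
have d0 : 0 < d by rewrite divr_gt0// ltr_wpDl.
have near_s : \forall k \near \oo, forall m, m \in s -> normc (xi m - x k m) <= d.
  by apply: near_all_seq => m _; exact: hx.
have [k [k0k hk]] : exists k, (k0 <= k)%N /\ forall m, m \in s -> normc (xi m - x k m) <= d.
  have : \forall k \near \oo, (k0 <= k)%N /\ forall m, m \in s -> normc (xi m - x k m) <= d.
    by apply: filterS2 near_s (nbhs_infty_ge k0).
  by move=> [k _ /(_ k (leqnn k)) hk]; exists k.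
have [_ hMk] := hM k k0k.
pose z m := normc (x k m); pose w m := normc (xi m - x k m).
have hw : \sum_(m <- s) w m ^+ 2 <= e ^+ 2.
  apply: (@le_trans _ _ (\sum_(m <- s) d ^+ 2)).
    by rewrite !big_seq; apply: ler_sum => m ms; rewrite lerXn2r ?nnegrE ?normc_ge0 ?(ltW d0)// hk.
  rewrite big_const_seq iter_addr_0 count_predT -mulr_natr /d exprMn -mulrA.
  rewrite ler_piMr ?sqr_ge0// exprVn ler_pdivrMl ?exprn_gt0 ?ltr_wpDl// mulr1.
  have := ler0n R (size s); nra.
apply: le_trans (sum_sq_add_le (a:=z) (b:=w) _ _ M0 (ltW e0) (hMk u s us su) hw).
- apply: ler_sum => m _; rewrite lerXn2r ?nnegrE ?addr_ge0 ?normc_ge0//.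
  by have := normcD (x k m) (xi m - x k m); rewrite addrC subrK.
- by move=> i; exact: normc_ge0.
- by move=> i; exact: normc_ge0.
Qed.

Lemma E_dense xi e : E xi -> 0 < e -> exists2 f, Cc f & sec_le e (xi - f).
Proof.
move=> h e0; have [f Cf /ltW hf] := h e e0; exists f => //.
by apply/normE_leP => //; exact: ltW.
Qed.

Lemma E_intro xi : (forall e, 0 < e -> exists2 f, Cc f & sec_le e (xi - f)) -> E xi.
Proof.
move=> h e e0; have [|f Cf hf] := h (e / 2); first by rewrite divr_gt0.
exists f => //; apply: (@le_lt_trans _ _ (e / 2)%:E).
  by apply/normE_leP => //; case: hf.
by rewrite lte_fin ltr_pdivrMr// mulr_natr mulr2n ltrDl.
Qed.

Lemma E_closed xi : (forall e, 0 < e -> exists2 eta, E eta & sec_le e (xi - eta)) -> E xi.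
Proof.
move=> h; apply: E_intro => e e0; have e2 : 0 < e / 2 by rewrite divr_gt0.
have [eta Eeta h1] := h _ e2; have [f Cf h2] := E_dense Eeta e2.
by exists f => //; rewrite [e]splitr -(subrKA eta xi (- f)); exact: sec_leD.
Qed.

Lemma Cc_bounded f : Cc f -> exists2 B : R, 0 <= B & forall g, normc (f g) <= B.
Proof.
move=> [cf kf].
have : compact ((fun g => normc (f g)) @` closure [set x | f x != 0]).
  apply: continuous_compact => //; apply: continuous_subspaceT => g.
  apply/cvgrPdist_lt => e e0; have /cvg_normcP/(_ e e0) := cf g.
  apply: filterS => g'; apply: le_lt_trans; rewrite normcB ler_norml.
  have := normcD (f g - f g') (f g'); have := normcD (f g' - f g) (f g).
  by rewrite !subrK (normcB (f g')) => h1 h2; apply/andP; split; lra.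
move/compact_bounded => [M [Mr hM]].
exists (Num.max 0 (M + 1)); first by rewrite le_max lexx.
move=> g; rewrite le_max; have [->|fg] := eqVneq (f g) 0; first by rewrite normc0 lexx.
apply/orP; right; apply: le_trans (ler_norm _) _; apply: hM; first by rewrite ltrDl.
by exists g => //; exact: subset_closure.
Qed.

(** At most [F] points of a fiber lie in the support, so the sum of squares is at most [F * B ^+ 2],
    and [F <= F ^+ 2] because [1 <= F]. *)
Lemma Cc_sec_le f : Cc f -> exists M, sec_le M f.
Proof.
move=> Cf; have [B B0 hB] := Cc_bounded Cf.
have /(Cc_bounded_support hlch hl hproper) [_ [t t0 ht]] := Cf.
have [F F1 hF] := hunif t0; have F0 : 0 <= F by exact: le_trans F1.
exists (F * B); split; first exact: mulr_ge0.
move=> u [|m0 s0] us su; first by rewrite big_nil sqr_ge0.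
move: us su; set s := m0 :: s0 => us su.
have uu : units gr u by rewrite -(su m0 (mem_head _ _)); exact: units_src.
rewrite (bigID (fun m => l m <= t)) /= [X in _ + X]big1 ?addr0; last first.
  move=> m; rewrite -ltNge => lt; have [->|/ht] := eqVneq (f m) 0.
    by rewrite normc0 expr0n.
  by rewrite leNgt lt.
rewrite -big_filter; set s' := [seq m <- s | l m <= t].
apply: (@le_trans _ _ (\sum_(m <- s') B ^+ 2)).
  by apply: ler_sum => m _; rewrite lerXn2r ?nnegrE ?normc_ge0.
rewrite big_const_seq iter_addr_0 count_predT -mulr_natr mulrC exprMn ler_wpM2r ?sqr_ge0//.
apply: (@le_trans _ _ F); last by rewrite expr2 ler_peMr.
apply: (size_fball_le hl hunif hF uu); first exact: filter_uniq.
by move=> m; rewrite mem_filter => /andP[lm /su].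
Qed.

Lemma Cc_E f : Cc f -> E f.
Proof.
move=> Cf; apply: E_intro => e e0; exists f => //; rewrite subrr; split; first exact: ltW.
by move=> u s _ _; rewrite big1 ?sqr_ge0// => m _; rewrite normc0 expr0n.
Qed.

Lemma E_sec_le xi : E xi -> exists M, sec_le M xi.
Proof.
move=> /E_dense/(_ ltr01) [f /Cc_sec_le[M hM] h]; exists (1 + M).
by rewrite -[xi](subrK f); exact: sec_leD.
Qed.

Lemma CcZ (a : R[i]) f : Cc f -> Cc (a *: f).
Proof.
move=> /(Cc_bounded_support hlch hl hproper) [cf [t t0 ht]].
apply/(Cc_bounded_support hlch hl hproper); split.
  move=> g; apply/cvg_normcP => e e0.
  have D0 : 0 < normc a + 1 by rewrite ltr_wpDl ?normc_ge0.
  have /cvg_normcP/(_ (e / (normc a + 1))) := cf g; rewrite divr_gt0// => /(_ isT).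
  apply: filterS => g'; rewrite ltr_pdivlMr// => h.
  rewrite -[X in normc X]scalerBr normcM; apply: le_lt_trans h.
  rewrite mulrC ler_wpM2l ?normc_ge0// lerDl//.
by exists t => // g h; apply: ht; apply: contraNneq h => e; rewrite -[_ g]/(a * f g) e mulr0.
Qed.

Lemma CcD f h : Cc f -> Cc h -> Cc (f + h).
Proof.
move=> /(Cc_bounded_support hlch hl hproper) [cf [t t0 ht]].
move=> /(Cc_bounded_support hlch hl hproper) [cf' [t' t0' ht']].
apply/(Cc_bounded_support hlch hl hproper); split.
  by move=> g; apply: cvgD; [exact: cf|exact: cf'].
exists (Num.max t t'); first by rewrite le_max t0.
move=> g hg; rewrite le_max; have [e|/ht ->//] := eqVneq (f g) 0.
by rewrite ht' ?orbT//; apply: contraNneq hg => e'; rewrite -[_ g]/(f g + h g) e e' addr0.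
Qed.

Lemma CcB f h : Cc f -> Cc h -> Cc (f - h).
Proof. by move=> Cf Ch; apply: CcD => //; rewrite -scaleN1r; exact: CcZ. Qed.

Lemma E_D xi eta : E xi -> E eta -> E (xi + eta).
Proof.
move=> h1 h2; apply: E_intro => e e0; have e2 : 0 < e / 2 by rewrite divr_gt0.
have [f Cf hf] := E_dense h1 e2; have [f' Cf' hf'] := E_dense h2 e2.
exists (f + f'); first exact: CcD.
by rewrite [e]splitr opprD addrACA; exact: sec_leD.
Qed.

Lemma E_Z (a : R[i]) xi : E xi -> E (a *: xi).
Proof.
move=> h; apply: E_intro => e e0.
have D0 : 0 < normc a + 1 by rewrite ltr_wpDl ?normc_ge0.
have [|f Cf hf] := @E_dense _ (e / (normc a + 1)) h; first by rewrite divr_gt0.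
exists (a *: f); first exact: CcZ.
rewrite -scalerBr; apply: sec_le_weaken (sec_leZ a hf).
by rewrite mulrCA ler_piMr ?(ltW e0)// ler_pdivrMr// mul1r lerDl.
Qed.

Lemma E_B xi eta : E xi -> E eta -> E (xi - eta).
Proof. by move=> h1 h2; apply: E_D => //; rewrite -scaleN1r; exact: E_Z. Qed.

End HilbertModule.

(** * Bounded operators and Schur's test *)

Section Operators.
Context {R : realType} {G : topologicalType} (gr : groupoid G) (l : G -> R).
Hypotheses (hlch : lch_groupoid gr) (het : etale gr).
Hypotheses (hl : length_function gr l) (hproper : proper_length l).
Hypothesis hunif : forall t, 0 <= t -> exists2 F : R, 1 <= F & fiber_card_le gr l t F.
Local Notation C := (Cplx R).
Local Notation normc := (@ComplexField.Normc.normc R).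
Local Notation inv := (ginv gr).
Local Notation src := (src gr).
Local Notation rng := (rng gr).
Local Notation gdiv := (gdiv gr).
Local Notation fball := (fball gr l).
Implicit Types (f xi eta : G -> C) (K : G -> G -> C).
Local Notation E := (@E R G gr).
Local Notation sec_le := (sec_le gr).

Implicit Types (T S : (G -> C) -> (G -> C)).

(** The homogeneous form of an operator norm bound, which composes and adds without any linearity
    assumption on the maps. *)
Definition op_le (M : R) T :=
  0 <= M /\ forall xi N, E xi -> sec_le N xi -> sec_le (M * N) (T xi).

Lemma opnorm_le M T : op_le M T -> (opnorm gr T <= M%:E)%E.
Proof.
move=> [M0 h]; apply/nnsup_leP => // _ [xi [Exi /normE_leP h1] <-].
by apply/normE_leP => //; rewrite -[M]mulr1; apply: h => //; exact: h1.
Qed.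

Lemma opnorm_leP M T : (forall (a : R[i]) xi, E xi -> T (a *: xi) = a *: T xi) ->
  0 <= M -> (opnorm gr T <= M%:E)%E <-> op_le M T.
Proof.
move=> hT M0; split; last exact: opnorm_le.
(* If [N = 0] then [xi = 0], and homogeneity with the scalar 0 gives [T xi = 0]. Otherwise [xi] is
   rescaled into the unit ball. *)
move=> h; split=> // xi N Exi hN; have [N0|N0] := ltP 0 N; last first.
  have N0' : N = 0 by apply/eqP; rewrite eq_le N0 (sec_le_ge0 hN).
  rewrite N0' in hN *; have xi0 := sec_le0 hN; rewrite mulr0.
  by have := hT 0 xi Exi; rewrite !scale0r xi0 => ->; rewrite -xi0.
have nN : normc (N^-1%:C%C : C) = N^-1 by rewrite normc_real gtr0_norm ?invr_gt0.
have h1 : sec_le 1 (N^-1%:C%C *: xi).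
  have -> : 1 = normc (N^-1%:C%C : C) * N by rewrite nN mulVf ?lt0r_neq0.
  exact: sec_leZ.
have h2 : sec_le M (T (N^-1%:C%C *: xi)).
  apply/normE_leP => //; move/(nnsup_leP _ M0) : h; apply.
  exists (N^-1%:C%C *: xi) => //; split; first exact: (E_Z hlch hl hproper).
  by apply/normE_leP.
have -> : T xi = N%:C%C *: T (N^-1%:C%C *: xi).
  rewrite hT// scalerA -rmorphM /= mulfV ?lt0r_neq0//.
  by rewrite scale1r.
have -> : M * N = normc (N%:C%C : C) * M by rewrite normc_real gtr0_norm// mulrC.
exact: sec_leZ.
Qed.

Lemma op_leD M N T S : op_le M T -> op_le N S -> op_le (M + N) (fun xi => T xi + S xi).
Proof.
move=> [M0 hT] [N0 hS]; split; first exact: addr_ge0.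
by move=> xi L Exi hxi; rewrite mulrDl; apply: sec_leD; [exact: hT|exact: hS].
Qed.

Lemma op_leZ M (a : R[i]) T : op_le M T -> op_le (normc a * M) (fun xi => a *: T xi).
Proof.
move=> [M0 hT]; split; first by rewrite mulr_ge0 ?normc_ge0.
by move=> xi L Exi hxi; rewrite -mulrA; apply: sec_leZ; exact: hT.
Qed.

Lemma op_le_comp M N T S : (forall xi, E xi -> E (S xi)) -> op_le M T -> op_le N S ->
  op_le (M * N) (fun xi => T (S xi)).
Proof.
move=> ES [M0 hT] [N0 hS]; split; first exact: mulr_ge0.
by move=> xi L Exi hxi; rewrite -mulrA; apply: hT; [exact: ES|exact: hS].
Qed.

Lemma op_le_weaken M N T : M <= N -> op_le M T -> op_le N T.
Proof.
move=> MN [M0 hT]; split; first exact: le_trans MN.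
move=> xi L Exi hxi; apply: sec_le_weaken (hT xi L Exi hxi).
by rewrite ler_wpM2r// (sec_le_ge0 hxi).
Qed.

Lemma op_le_eq M T S : (forall xi, E xi -> T xi = S xi) -> op_le M T -> op_le M S.
Proof. by move=> e [M0 h]; split=> // xi N Exi hxi; rewrite -e//; exact: h. Qed.

Lemma op_leB M N T S : op_le M T -> op_le N S -> op_le (M + N) (fun xi => T xi - S xi).
Proof.
move=> hT hS; apply: (op_leD hT); have := op_leZ (-1) hS.
rewrite normcN normc1 mul1r; apply: op_le_eq => xi _; exact: scaleN1r.
Qed.

(* The hypothesis of Schur's test for boundedness on each fiber. *)
Definition schur_le (A : R) K := 0 <= A /\ forall g (s : seq G), uniq s ->
  (forall m, m \in s -> src m = src g) ->
  \sum_(m <- s) normc (K g m) <= A /\ \sum_(m <- s) normc (K m g) <= A.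

(** Schur's test: Jensen's inequality with the weights [normc (K g m)] uses the row sums, and after
    exchanging the sums over [g] and [m] the column sums finish. The larger [A'] supplies the
    positive mass that Jensen's inequality asks for. *)
Lemma kop_sec_le t K A xi N : banded gr l t K -> schur_le A K -> sec_le N xi ->
  sec_le (A * N) (kop gr K xi).
Proof.
move=> bK [A0 hA] [N0 hN].
suff pos A' : A < A' -> sec_le (A' * N) (kop gr K xi).
  apply: sec_le_addgt0 => [|e e0]; first exact: mulr_ge0.
  pose A' := A + e / (N + 1).
  have AA' : A < A' by rewrite ltrDl divr_gt0// ltr_wpDl.
  apply: sec_le_weaken (pos A' AA').
  by rewrite mulrDl lerD2l mulrAC ler_pdivrMr ?ltr_wpDl// ler_wpM2l ?(ltW e0)// lerDl.
move=> AA'; have A'0 : 0 < A' by exact: le_lt_trans AA'.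
split; first by rewrite mulr_ge0// ltW.
move=> u s us su.
(* One finite set that contains, for all [g] in [s], every [m] with [K g m != 0]. *)
pose F := undup (flatten [seq fball u (l g + t) | g <- s]).
have uu g : g \in s -> units gr u by move=> /su <-; exact: units_src.
have FE m : m \in F -> src m = u.
  rewrite mem_undup => /flatten_mapP[g gs].
  by move/(mem_fball hl hunif _ _ (uu _ gs)) => [].
have kE g : g \in s -> kop gr K xi g = \sum_(m <- F) K g m * xi m.
  move=> gs; apply: kop_seq; first exact: undup_uniq.
    by move=> m /FE ->; rewrite su.
  move=> m em h0 _; rewrite mem_undup; apply/flatten_mapP; exists g => //.
  by rewrite -(su g gs); exact: (banded_mem_fball hl hunif bK em h0).
apply: (@le_trans _ _ (\sum_(g <- s) A' * \sum_(m <- F) normc (K g m) * normc (xi m) ^+ 2)).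
  rewrite !big_seq; apply: ler_sum => g gs; rewrite kE//.
  apply: (@le_trans _ _ ((\sum_(m <- F) normc (K g m) * normc (xi m)) ^+ 2)).
    rewrite lerXn2r ?nnegrE ?normc_ge0 ?sumr_ge0//; first by move=> *; rewrite mulr_ge0 ?normc_ge0.
    by apply: le_trans (normc_sum _ _ _) _; apply: ler_sum => m _; rewrite normcM.
  apply: sum_weighted_sq_le => //; first by move=> i; exact: normc_ge0.
  apply: le_trans (ltW AA'); have [] := hA g F (undup_uniq _) => // m /FE ->; by rewrite su.
rewrite -mulr_sumr exchange_big /= exprMn expr2 -mulrA ler_wpM2l ?(ltW A'0)//.
apply: (@le_trans _ _ (\sum_(m <- F) A' * normc (xi m) ^+ 2)); last first.
  by rewrite -mulr_sumr ler_wpM2l ?(ltW A'0)//; apply: (hN u) => //; exact: undup_uniq.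
rewrite !big_seq; apply: ler_sum => m mF; rewrite -mulr_suml ler_wpM2r ?sqr_ge0//.
apply: le_trans (ltW AA'); have [] := hA m s us => // g gs; by rewrite su// FE.
Qed.

(** Right translation by [inv g] maps the nonzero entries of a row or column at [g] injectively into
    the ball of radius [t] in the fiber over [rng g], so there are at most [F] of them. *)
Lemma banded_schur t K B : 0 <= t -> 0 <= B -> banded gr l t K ->
  (forall g m, src g = src m -> normc (K g m) <= B) -> exists A, schur_le A K.
Proof.
move=> t0 B0 bK hB; have [F F1 hF] := hunif t0.
have F0 : 0 <= F by exact: le_trans F1.
exists (B * F); split; first exact: mulr_ge0.
move=> g s us su.
have card (P : pred G) (x : G -> R) : (forall m, m \in s -> ~~ P m -> x m = 0) ->
    (forall m, m \in s -> P m -> l (gdiv m g) <= t) -> (forall m, m \in s -> x m <= B) ->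
    \sum_(m <- s) x m <= B * F.
  move=> hP hl' hx; rewrite big_seq (bigID P) /= [X in _ + X]big1 ?addr0; last first.
    by move=> m /andP[ms Pm]; exact: hP.
  rewrite -big_filter.
  set s' := [seq m <- s | _].
  have s'E m : m \in s' -> m \in s /\ P m by rewrite mem_filter => /andP[/andP[]].
  apply: (@le_trans _ _ (\sum_(m <- s') B)).
    by rewrite !big_seq; apply: ler_sum => m /s'E[ms _]; exact: hx.
  rewrite big_const_seq iter_addr_0 count_predT -mulr_natr ler_wpM2l//.
  rewrite -(size_map (fun m => gdiv m g)).
  apply: (size_fball_le hl hunif hF (units_rng gr g)).
    rewrite map_inj_in_uniq ?filter_uniq// => m m' /s'E[ms _] /s'E[m's _] e.
    by rewrite -(mul_divK (su m ms)) e mul_divK// su.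
  by move=> _ /mapP[m /s'E[ms Pm] ->]; split; [rewrite src_div ?su//|exact: hl'].
split; [apply: (card (fun m => K g m != 0))|apply: (card (fun m => K m g != 0))].
- by move=> m ms; rewrite negbK => /eqP ->; rewrite normc0.
- move=> m ms h0; rewrite (length_div_sym hl (su _ ms)); apply: bK => //; by rewrite su.
- by move=> m ms; apply: hB; rewrite su.
- by move=> m ms; rewrite negbK => /eqP ->; rewrite normc0.
- move=> m ms h0; apply: bK => //; by rewrite su.
- by move=> m ms; apply: hB; rewrite su.
Qed.

Lemma kopB t K xi eta : banded gr l t K ->
  kop gr K (xi - eta) = kop gr K xi - kop gr K eta.
Proof.
move=> bK; rewrite (kopD hl hunif _ _ bK) -[in LHS]scaleN1r (kopZ hl hunif _ _ bK).
by rewrite scaleN1r.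
Qed.

Lemma kop_E t K A xi : 0 <= t -> banded gr l t K -> kernel_continuous gr K ->
  schur_le A K -> E xi -> E (kop gr K xi).
Proof.
move=> t0 bK cK hA Exi; apply: E_intro => e e0.
have A0 : 0 <= A by case: hA.
have D0 : 0 < A + 1 by rewrite ltr_wpDl.
have [|f Cf hf] := @E_dense _ _ gr _ (e / (A + 1)) Exi; first by rewrite divr_gt0.
exists (kop gr K f); first exact: (kop_Cc hlch het hl hproper hunif t0).
rewrite -(kopB _ _ bK); apply: sec_le_weaken (kop_sec_le bK hA hf).
by rewrite mulrCA ler_piMr ?(ltW e0)// ler_pdivrMr// mul1r lerDl.
Qed.

Lemma schur_op_le t K A : banded gr l t K -> schur_le A K -> op_le A (kop gr K).
Proof. by move=> bK hA; split; [case: hA|move=> xi N _; exact: (kop_sec_le bK)]. Qed.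

End Operators.

(** * Inner products as limits of finite pairings *)

Section InnerProduct.
Context {R : realType} {G : topologicalType} (gr : groupoid G) (l : G -> R).
Hypotheses (hlch : lch_groupoid gr) (het : etale gr).
Hypotheses (hl : length_function gr l) (hproper : proper_length l).
Hypothesis hunif : forall t, 0 <= t -> exists2 F : R, 1 <= F & fiber_card_le gr l t F.
Local Notation C := (Cplx R).
Local Notation normc := (@ComplexField.Normc.normc R).
Local Notation inv := (ginv gr).
Local Notation src := (src gr).
Local Notation rng := (rng gr).
Local Notation gdiv := (gdiv gr).
Local Notation fball := (fball gr l).
Implicit Types (f xi eta : G -> C) (K : G -> G -> C).
Local Notation E := (@E R G gr).
Local Notation sec_le := (sec_le gr).
Local Notation op_le := (@op_le R G gr).
Implicit Types (T S : (G -> C) -> (G -> C)).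

Local Notation pairing s xi eta := (\sum_(m <- s) conjc (xi m) * eta m : C).

Lemma pairing_le (s : seq G) u M N xi eta : uniq s -> (forall m, m \in s -> src m = u) ->
  sec_le M xi -> sec_le N eta -> normc (pairing s xi eta) <= M * N.
Proof.
move=> us su [M0 hM] [N0 hN]; apply: le_trans (normc_sum _ _ _) _.
under eq_bigr do rewrite normcM normc_conj.
apply: sum_mul_le => //; try (by move=> i; exact: normc_ge0); [exact: (hM u)|exact: (hN u)].
Qed.

Lemma pairingB (s : seq G) xi eta xi' eta' :
  pairing s xi eta - pairing s xi' eta' = pairing s (xi - xi') eta + pairing s xi' (eta - eta').
Proof.
rewrite -sumrB -big_split /=; apply: eq_bigr => m _.
rewrite -[(xi - xi') m]/(xi m - xi' m) -[(eta - eta') m]/(eta m - eta' m) rmorphB /=.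
ring.
Qed.

Lemma pairing_close (s : seq G) u xi eta xi' eta' d d' M N : uniq s ->
  (forall m, m \in s -> src m = u) -> sec_le d (xi - xi') -> sec_le d' (eta - eta') ->
  sec_le N eta -> sec_le M xi' ->
  normc (pairing s xi eta - pairing s xi' eta') <= d * N + M * d'.
Proof.
move=> us su h1 h2 h3 h4; rewrite pairingB; apply: le_trans (normcD _ _) _.
apply: lerD; exact: (pairing_le us su).
Qed.

(** Replacing both arguments by elements of [Cc] within [d k] leaves a finite pairing [p k]. Every
    finite pairing over a set containing [S k] is within a multiple of [d k] of it, so the [p k]
    form a Cauchy sequence. *)
Lemma inner_exists xi eta u : E xi -> E eta -> units gr u ->
  exists L : C, forall e : R, 0 < e -> exists s0 : seq G,
    [/\ uniq s0, forall m, m \in s0 -> src m = u & forall s, uniq s ->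
      (forall m, m \in s -> src m = u) -> {subset s0 <= s} ->
      normc (pairing s xi eta - L) <= e].
Proof.
move=> Exi Eeta uu.
have [M hM] := E_sec_le hlch hl hproper hunif Exi.
have [N hN] := E_sec_le hlch hl hproper hunif Eeta.
pose d (k : nat) : R := k.+1%:R^-1.
have d0 k : 0 < d k by rewrite invr_gt0.
have d1 k : d k <= 1 by rewrite invf_le1// ler1n.
have hx k : exists f : (G -> C) * (G -> C), [/\ Cc f.1, sec_le (d k) (xi - f.1),
    Cc f.2 & sec_le (d k) (eta - f.2)].
  have [f Cf hf] := E_dense Exi (d0 k); have [h Ch hh] := E_dense Eeta (d0 k).
  by exists (f, h).
have {hx} [x hx] := choice hx.
have hsup k : exists s : seq G, [/\ uniq s, forall m, m \in s -> src m = u &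
    forall m, src m = u -> (x k).1 m != 0 -> m \in s].
  have [/(Cc_bounded_support hlch hl hproper) [_ [t t0 ht]] _ _ _] := hx k.
  exists (fball u t); split; first exact: uniq_fball.
    by move=> m /(mem_fball hl hunif _ _ uu) [].
  by move=> m em /ht h; exact/(mem_fball hl hunif _ _ uu).
have {hsup} [S hS] := choice hsup.
pose p k : C := pairing (S k) (x k).1 (x k).2.
(* [M + 1] bounds the approximants [(x k).1], which lie within [d k <= 1] of [xi]. *)
have D0 : 0 <= N + (M + 1) by have := sec_le_ge0 hN; have := sec_le_ge0 hM; lra.
have hp k s : uniq s -> (forall m, m \in s -> src m = u) -> {subset S k <= s} ->
    normc (pairing s xi eta - p k) <= d k * (N + (M + 1)).
  move=> us su ss; have [uS Su hsupp] := hS k; have [Cf hf Ch hh] := hx k.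
  have -> : p k = pairing s (x k).1 (x k).2.
    apply: sum_uniq_incl => // m ms mS; have [->|h0] := eqVneq ((x k).1 m) 0.
      by rewrite conjc0 mul0r.
    by rewrite hsupp// su in mS.
  rewrite mulrDr [d k * (M + 1)]mulrC; apply: (pairing_close us su) => //.
  have -> : (x k).1 = xi - (xi - (x k).1) by rewrite subKr.
  by apply: sec_leB => //; exact: sec_le_weaken hf.
have [L hL] : exists L : C, forall k, normc (L - p k) <= 2 * (N + (M + 1)) * d k.
  apply: normc_cauchy_cvg; last first.
    rewrite -[X in _ --> X](mulr0 (2 * (N + (M + 1)))); apply: cvgMr.
    exact: cvg_harmonic.
  move=> j k kj; pose s := undup (S j ++ S k).
  have [_ Suj _] := hS j; have [_ Suk _] := hS k.
  have us : uniq s by exact: undup_uniq.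
  have su m : m \in s -> src m = u.
    by rewrite mem_undup mem_cat => /orP[]; [exact: Suj|exact: Suk].
  have h1 : normc (pairing s xi eta - p j) <= d j * (N + (M + 1)).
    by apply: hp => // m mS; rewrite mem_undup mem_cat mS.
  have h2 : normc (pairing s xi eta - p k) <= d k * (N + (M + 1)).
    by apply: hp => // m mS; rewrite mem_undup mem_cat mS orbT.
  have djk : d j <= d k by rewrite lef_pV2 ?posrE// ler_nat.
  apply: le_trans (normc_dist _ (pairing s xi eta) _) _; rewrite normcB.
  have h3 : d j * (N + (M + 1)) <= d k * (N + (M + 1)) by rewrite ler_wpM2r.
  rewrite -mulrA mulr_natl mulr2n [_ * d k]mulrC lerD//; exact: le_trans h3.
exists L => e e0.
have [k hk] : exists k, 3 * (N + (M + 1)) * d k <= e.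
  have : (fun k => 3 * (N + (M + 1)) * d k) @ \oo --> (0 : R).
    rewrite -[X in _ --> X](mulr0 (3 * (N + (M + 1)))); apply: cvgMr.
    exact: cvg_harmonic.
  move=> /cvgrPdist_lt/(_ e e0) [k _ /(_ k (leqnn k))] /=; rewrite sub0r normrN => h.
  by exists k; apply: le_trans (ler_norm _) (ltW h).
have [uS Su _] := hS k; exists (S k); split => // s us su ss.
apply: le_trans hk; apply: le_trans (normc_dist _ (p k) _) _.
have := hp k s us su ss; have := hL k; rewrite (normcB L) => h1 h2; lra.
Qed.

(** Identifies the unordered sum in [inner] with that limit. Inner products are handled only through
    this finite form from here on. *)
Lemma inner_approx xi eta u : E xi -> E eta -> units gr u ->
  forall e : R, 0 < e -> exists s0 : seq G,
    [/\ uniq s0, forall m, m \in s0 -> src m = u & forall s, uniq s ->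
      (forall m, m \in s -> src m = u) -> {subset s0 <= s} ->
      normc (pairing s xi eta - inner gr xi eta u) <= e].
Proof.
move=> Exi Eeta uu; have [L hL] := inner_exists Exi Eeta uu.
suff -> : inner gr xi eta u = L by [].
have PF := @summability.totally_filter G.
have FF : Filter (@summability.totally G) by exact: filter_filter.
rewrite /inner /summability.sum; apply: cvg_lim => //.
apply/cvg_normcP => e e0; have e2 : 0 < e / 2 by rewrite divr_gt0.
have [s0 [us0 su0 hs]] := hL _ e2.
exists [fset x in s0]%fset => // J /= hJ.
have -> : summability.partial_sum (fun m : G =>
    (if m \in fiber_src gr u then conjc (xi m) * eta m else 0) : C) J
  = pairing [seq m <- J | m \in fiber_src gr u] xi eta.
  rewrite /summability.partial_sum big_filter [RHS]big_mkcond.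
  by rewrite [RHS]big_seq_fsetE.
apply: (@le_lt_trans _ _ (e / 2)).
  apply: hs; first exact: filter_uniq (fset_uniq J).
    by move=> m; rewrite mem_filter => /andP[/set_mem].
  move=> m ms; rewrite mem_filter; apply/andP; split; first by apply/mem_set; exact: su0.
  by apply: (fsubsetP hJ); rewrite inE.
by rewrite ltr_pdivrMr// mulr_natr mulr2n ltrDl.
Qed.

Lemma inner_close xi eta xi' eta' u d d' M N : E xi -> E eta -> E xi' -> E eta' ->
  units gr u -> sec_le d (xi - xi') -> sec_le d' (eta - eta') ->
  sec_le N eta -> sec_le M xi' ->
  normc (inner gr xi eta u - inner gr xi' eta' u) <= d * N + M * d'.
Proof.
move=> E1 E2 E3 E4 uu h1 h2 h3 h4; apply/ler_addgt0Pr => e e0.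
have e2 : 0 < e / 2 by rewrite divr_gt0.
have [s [us su hs]] := inner_approx E1 E2 uu e2.
have [s' [us' su' hs']] := inner_approx E3 E4 uu e2.
pose r := undup (s ++ s').
have ur : uniq r by exact: undup_uniq.
have ru m : m \in r -> src m = u.
  by rewrite mem_undup mem_cat => /orP[]; [exact: su|exact: su'].
have h5 : normc (pairing r xi eta - inner gr xi eta u) <= e / 2.
  by apply: hs => // m mS; rewrite mem_undup mem_cat mS.
have h6 : normc (pairing r xi' eta' - inner gr xi' eta' u) <= e / 2.
  by apply: hs' => // m mS; rewrite mem_undup mem_cat mS orbT.
have h7 := pairing_close ur ru h1 h2 h3 h4.
apply: le_trans (normc_dist _ (pairing r xi eta) _) _; rewrite normcB.
have := normc_dist (pairing r xi eta) (pairing r xi' eta') (inner gr xi' eta' u).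
lra.
Qed.

Lemma inner_finite f h u (s : seq G) : Cc f -> Cc h -> units gr u -> uniq s ->
  (forall m, m \in s -> src m = u) ->
  (forall m, src m = u -> f m != 0 -> h m != 0 -> m \in s) ->
  inner gr f h u = pairing s f h.
Proof.
move=> Cf Ch uu us su hs; apply/eqP; rewrite eq_sym -subr_eq0; apply/eqP; apply: normc_small => e e0.
have [s0 [us0 su0 hs0]] := inner_approx (Cc_E gr Cf) (Cc_E gr Ch) uu e0.
have -> : pairing s f h = pairing (undup (s ++ s0)) f h.
  apply: sum_uniq_incl => //; first exact: undup_uniq.
    by move=> m ms; rewrite mem_undup mem_cat ms.
  move=> m ms; have em : src m = u.
    by move: ms; rewrite mem_undup mem_cat => /orP[]; [exact: su|exact: su0].
  have [->|f0] := eqVneq (f m) 0; first by rewrite conjc0 mul0r.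
  have [->|h0] := eqVneq (h m) 0; first by rewrite mulr0.
  by rewrite hs.
apply: hs0; first exact: undup_uniq.
  by move=> m; rewrite mem_undup mem_cat => /orP[]; [exact: su|exact: su0].
by move=> m ms; rewrite mem_undup mem_cat ms orbT.
Qed.

(** Both sides of the adjoint identity are continuous in the two arguments, so it extends from the
    dense subspace [Cc] to [E]. *)
Lemma adjoint_dense T S A : (forall xi, E xi -> E (T xi)) -> (forall xi, E xi -> E (S xi)) ->
  (forall xi eta, E xi -> E eta -> T (xi - eta) = T xi - T eta) ->
  (forall xi eta, E xi -> E eta -> S (xi - eta) = S xi - S eta) ->
  op_le A T -> op_le A S ->
  (forall f h u, Cc f -> Cc h -> units gr u -> inner gr (T f) h u = inner gr f (S h) u) ->
  adjoint gr T S.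
Proof.
move=> ET ES TB SB [A0 hT] [_ hS] hC; split=> // xi eta Exi Eeta u uu.
apply/eqP; rewrite -subr_eq0; apply/eqP; apply: normc_small => e e0.
have [M hM] := E_sec_le hlch hl hproper hunif Exi.
have [N hN] := E_sec_le hlch hl hproper hunif Eeta.
have M0 := sec_le_ge0 hM; have N0 := sec_le_ge0 hN.
(* [(A + 1) * d] dominates both [d] and [A * d]; with it the two approximation errors add up to
   [d * (D - 1)]. The summand 1 keeps [D] positive. *)
pose D := (A + 1) ^+ 2 * (N + (M + 1)) + 1.
have D0 : 0 < D by rewrite ltr_wpDl// mulr_ge0 ?sqr_ge0//; lra.
pose d := Num.min 1 (e / D).
have d0 : 0 < d by rewrite lt_min ltr01 divr_gt0.
have d1 : d <= 1 by rewrite ge_min lexx.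
have dD : d * D <= e by rewrite -ler_pdivlMr// ge_min lexx orbT.
have [f Cf hf] := E_dense Exi d0; have [h Ch hh] := E_dense Eeta d0.
have Ef := Cc_E gr Cf; have Eh := Cc_E gr Ch.
have hM' : sec_le (M + 1) f.
  have -> : f = xi - (xi - f) by rewrite subKr.
  by apply: sec_leB => //; exact: sec_le_weaken hf.
have Ad : d <= (A + 1) * d by rewrite ler_peMl ?(ltW d0)// lerDr.
have Ad' : A * d <= (A + 1) * d by rewrite ler_wpM2r ?(ltW d0)// lerDl.
have h1 : normc (inner gr (T xi) eta u - inner gr (T f) h u) <= ((A + 1) * d) * (N + A * (M + 1)).
  rewrite mulrDr [_ * (A * (M + 1))]mulrC; apply: inner_close => //; try exact: ET.
  - by rewrite -TB//; apply: (sec_le_weaken Ad'); apply: hT => //; exact: (E_B hlch hl hproper).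
  - exact: sec_le_weaken hh.
  - exact: hT.
have h2 : normc (inner gr xi (S eta) u - inner gr f (S h) u) <= ((A + 1) * d) * (A * N + (M + 1)).
  rewrite mulrDr [_ * (M + 1)]mulrC; apply: inner_close => //; try exact: ES.
  - exact: sec_le_weaken hf.
  - by rewrite -SB//; apply: (sec_le_weaken Ad'); apply: hS => //; exact: (E_B hlch hl hproper).
  - exact: hS.
rewrite (hC f h u Cf Ch uu) in h1.
have h3 := normc_dist (inner gr (T xi) eta u) (inner gr f (S h) u) (inner gr xi (S eta) u).
rewrite (normcB (inner gr f (S h) u)) in h3.
have h4 := lerD h1 h2; apply: (le_trans h3); apply: (le_trans h4); apply: le_trans dD.
rewrite -subr_ge0 (_ : _ - _ = d) ?(ltW d0)//; rewrite /D; ring.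
Qed.

End InnerProduct.

(** * Boundedness and adjoints of the iterated commutators *)

Section DeltaOperators.
Context {R : realType} {G : topologicalType} (gr : groupoid G) (l : G -> R).
Hypotheses (hlch : lch_groupoid gr) (het : etale gr).
Hypotheses (hl : length_function gr l) (hproper : proper_length l).
Hypothesis hunif : forall t, 0 <= t -> exists2 F : R, 1 <= F & fiber_card_le gr l t F.
Local Notation C := (Cplx R).
Local Notation normc := (@ComplexField.Normc.normc R).
Local Notation inv := (ginv gr).
Local Notation src := (src gr).
Local Notation rng := (rng gr).
Local Notation gdiv := (gdiv gr).
Local Notation fball := (fball gr l).
Implicit Types (f xi eta : G -> C) (K : G -> G -> C).
Local Notation E := (@E R G gr).
Local Notation sec_le := (sec_le gr).
Local Notation op_le := (@op_le R G gr).
Implicit Types (T S : (G -> C) -> (G -> C)).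

(** The adjoint kernel is the conjugate transpose. A ball of radius [a + b + t] carries both
    supports, so both inner products are double sums over the same finite set. *)
Lemma kop_adjoint_Cc t K f h u : banded gr l t K -> 0 <= t -> kernel_continuous gr K ->
  Cc f -> Cc h -> units gr u ->
  inner gr (kop gr K f) h u = inner gr f (kop gr (fun g m => conjc (K m g)) h) u.
Proof.
move=> bK t0 cK Cf Ch uu.
have cK' : kernel_continuous gr (fun g m => conjc (K m g)).
  move=> g m em e e0; have [A [B [nA nB hAB]]] := cK m g (esym em) e e0.
  by exists B, A; split=> // g' m' hg hm em'; rewrite -rmorphB normc_conj; exact: hAB.
have bK' : banded gr l t (fun g m => conjc (K m g)).
  by move=> g m em; rewrite conjc_eq0 => h0; rewrite (length_div_sym hl em); exact: bK.
have /(Cc_bounded_support hlch hl hproper) [_ [a a0 ha]] := Cf.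
have /(Cc_bounded_support hlch hl hproper) [_ [b b0 hb]] := Ch.
set s := fball u (a + b + t).
have us : uniq s by exact: uniq_fball.
have su m : m \in s -> src m = u by move/(mem_fball hl hunif _ _ uu) => [].
have ms m c : src m = u -> l m <= c -> c <= a + b + t -> m \in s.
  by move=> em lm hc; apply/(mem_fball hl hunif _ _ uu); split=> //; exact: le_trans hc.
rewrite (inner_finite hlch hl hproper hunif _ _ uu us su); first last.
- by move=> m em _ /hb h0; apply: (ms m b) => //; lra.
- by [].
- exact: (kop_Cc hlch het hl hproper hunif t0).
rewrite (inner_finite hlch hl hproper hunif _ _ uu us su); first last.
- by move=> m em /ha h0 _; apply: (ms m a) => //; lra.
- exact: (kop_Cc hlch het hl hproper hunif t0).
- by [].
have k1 g : g \in s -> kop gr K f g = \sum_(m <- s) K g m * f m.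
  move=> gs; apply: kop_seq => //; first by move=> m /su ->; rewrite su.
  by move=> m em _ /ha h0; apply: (ms m a) => //; [rewrite -em su|lra].
have k2 m : m \in s -> kop gr (fun g m => conjc (K m g)) h m = \sum_(g <- s) conjc (K g m) * h g.
  move=> gs; apply: kop_seq => //; first by move=> g /su ->; rewrite su.
  by move=> g em _ /hb h0; apply: (ms g b) => //; [rewrite -em su|lra].
transitivity (\sum_(g <- s) \sum_(m <- s) conjc (K g m) * conjc (f m) * h g : C).
  rewrite !big_seq; apply: eq_bigr => g gs; rewrite k1// rmorph_sum mulr_suml.
  by apply: eq_bigr => m _; rewrite rmorphM.
rewrite exchange_big /= !big_seq; apply: eq_bigr => m gs; rewrite k2// mulr_sumr.
by apply: eq_bigr => g _; rewrite mulrCA mulrA.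
Qed.

Lemma inner_le xi eta u M N : E xi -> E eta -> units gr u -> sec_le M xi -> sec_le N eta ->
  normc (inner gr xi eta u) <= M * N.
Proof.
move=> E1 E2 uu h1 h2; apply/ler_addgt0Pr => e e0.
have [s [us su hs]] := inner_approx hlch hl hproper hunif E1 E2 uu e0.
have := hs s us su (fun _ => id); have := pairing_le us su h1 h2.
set p := \sum_(_ <- _) _; have := normcD (inner gr xi eta u - p) p.
rewrite subrK normcB; lra.
Qed.

Lemma sum_sq_le_inner xi u (s : seq G) : E xi -> units gr u -> uniq s ->
  (forall m, m \in s -> src m = u) ->
  \sum_(m <- s) normc (xi m) ^+ 2 <= normc (inner gr xi xi u).
Proof.
move=> Exi uu us su; apply/ler_addgt0Pr => e e0.
have [s0 [us0 su0 hs]] := inner_approx hlch hl hproper hunif Exi Exi uu e0.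
pose r := undup (s ++ s0).
have ur : uniq r by exact: undup_uniq.
have ru m : m \in r -> src m = u.
  by rewrite mem_undup mem_cat => /orP[]; [exact: su|exact: su0].
have := hs r ur ru; set p := \sum_(_ <- _) _ => h.
have {}h : normc (p - inner gr xi xi u) <= e.
  by apply: h => m ms; rewrite mem_undup mem_cat ms orbT.
have hp : p = (\sum_(m <- r) normc (xi m) ^+ 2)%:C%C.
  rewrite /p rmorph_sum; apply: eq_bigr => m _; exact: conjM_normc.
clearbody p.
have : \sum_(m <- s) normc (xi m) ^+ 2 <= \sum_(m <- r) normc (xi m) ^+ 2.
  apply: sum_uniq_le => //; first by move=> m ms; rewrite mem_undup mem_cat ms.
  by move=> m; exact: sqr_ge0.
have := normcD (p - inner gr xi xi u) (inner gr xi xi u).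
rewrite subrK {1}hp normc_real ger0_norm; last by apply: sumr_ge0 => *; exact: sqr_ge0.
lra.
Qed.

Lemma sec_le_normE xi : E xi -> exists2 p, normE gr xi = p%:E & sec_le p xi.
Proof.
move=> Exi; have [M hM] := E_sec_le hlch hl hproper hunif Exi.
have M0 := sec_le_ge0 hM.
have h : (normE gr xi <= M%:E)%E by apply/normE_leP.
have fin : normE gr xi \is a fin_num.
  by rewrite ge0_fin_numE ?normE_ge0//; apply: le_lt_trans h _; rewrite ltry.
exists (fine (normE gr xi)); first by rewrite fineK.
by apply/normE_leP; rewrite ?fine_ge0 ?normE_ge0// fineK.
Qed.

(** For [p] the norm of [S eta], the adjoint relation and Cauchy-Schwarz give [p ^+ 2 <= M * N * p];
    divide by [p] unless it is 0. *)
Lemma adjoint_op_le T S M : adjoint gr T S -> op_le M T -> op_le M S.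
Proof.
move=> [ET ES hTS] [M0 hT]; split=> // eta N Eeta hN.
have N0 := sec_le_ge0 hN.
have [p hp sp] := sec_le_normE (ES _ Eeta).
have p0 := sec_le_ge0 sp.
suff pMN : p <= M * N by exact: sec_le_weaken sp.
have : sec_le (Num.sqrt (M * N * p)) (S eta).
  split; first exact: sqrtr_ge0.
  move=> u [|m0 s0] us su; first by rewrite big_nil sqr_ge0.
  have uu : units gr u by rewrite -(su m0 (mem_head _ _)); exact: units_src.
  rewrite sqr_sqrtr ?mulr_ge0//; apply: le_trans (sum_sq_le_inner (ES _ Eeta) uu us su) _.
  rewrite -hTS//; last exact: ES.
  rewrite mulrAC; apply: inner_le => //; first by apply: ET; exact: ES.
  by apply: hT => //; exact: ES.
move=> /(normE_leP gr _ (sqrtr_ge0 _)); rewrite hp lee_fin => h.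
have : p ^+ 2 <= M * N * p.
  by rewrite -[leRHS]sqr_sqrtr ?mulr_ge0// lerXn2r ?nnegrE ?sqrtr_ge0.
have [->|pn0] := eqVneq p 0; first by rewrite mulr_ge0.
by rewrite expr2 ler_pM2r// lt0r pn0.
Qed.

Lemma star_Cc f : Cc f -> Cc (star gr f).
Proof.
move=> /(Cc_bounded_support hlch hl hproper) [cf [t t0 ht]].
apply/(Cc_bounded_support hlch hl hproper); split; last first.
  exists t => // g; rewrite /star conjc_eq0 => /ht.
  by rewrite (length_inv hl).
move=> g; apply/cvg_normcP => e e0.
have /cvg_normcP/(_ e e0) h := cf (inv g).
have h2 : \forall x \near g, normc (f (inv x) - f (inv g)) < e.
  exact: (@ginv_continuous _ _ hlch g _ h).
apply: filterS h2 => g'.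
by rewrite /star -rmorphB normc_conj.
Qed.

Lemma delta_bound n f : Cc f -> exists2 t, 0 <= t & exists A, [/\ forall g, f g != 0 -> l g <= t,
  banded gr l t (dkernel gr l n f), kernel_continuous gr (dkernel gr l n f) &
  schur_le gr A (dkernel gr l n f)].
Proof.
move=> Cf; have [B B0 hB] := Cc_bounded Cf.
have /(Cc_bounded_support hlch hl hproper) [cf [t t0 ht]] := Cf.
have bK := banded_dkernel (n:=n) (gr:=gr) ht.
exists t => //; have [A hA] : exists A, schur_le gr A (dkernel gr l n f).
  apply: (banded_schur hl hunif t0 (B := t ^+ n * B)) => //; first by rewrite mulr_ge0 ?exprn_ge0.
  move=> g m em; rewrite /dkernel normcM normcX normc_real.
  have [->|/ht h] := eqVneq (f (gdiv g m)) 0.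
    by rewrite normc0 mulr0 mulr_ge0 ?exprn_ge0.
  apply: ler_pM; rewrite ?exprn_ge0 ?normc_ge0//.
  by apply: lerXn2r; rewrite ?nnegrE//; exact: le_trans (length_dist_le hl em) h.
by exists A; split => //; exact: kernel_continuous_dkernel.
Qed.

Lemma delta_op_le n f : Cc f -> exists A, op_le A (delta gr l n f).
Proof.
move=> Cf; have [t t0 [A [_ bK _ hA]]] := delta_bound n Cf; exists A.
by rewrite (delta_kop hlch hl hproper hunif n Cf); exact: (schur_op_le hl hunif bK).
Qed.

Lemma delta_E n f xi : Cc f -> E xi -> E (delta gr l n f xi).
Proof.
move=> Cf; have [t t0 [A [_ bK cK hA]]] := delta_bound n Cf.
rewrite (delta_kop hlch hl hproper hunif n Cf).
exact: (kop_E hlch het hl hproper hunif t0 bK cK hA).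
Qed.

Lemma delta_D n f xi eta : Cc f ->
  delta gr l n f (xi + eta) = delta gr l n f xi + delta gr l n f eta.
Proof.
move=> Cf; have [t t0 [A [_ bK cK hA]]] := delta_bound n Cf.
by rewrite (delta_kop hlch hl hproper hunif n Cf); exact: (kopD hl hunif _ _ bK).
Qed.

Lemma delta_Z n f (a : R[i]) xi : Cc f ->
  delta gr l n f (a *: xi) = a *: delta gr l n f xi.
Proof.
move=> Cf; have [t t0 [A [_ bK cK hA]]] := delta_bound n Cf.
by rewrite (delta_kop hlch hl hproper hunif n Cf); exact: (kopZ hl hunif _ _ bK).
Qed.

Lemma delta_B n f xi eta : Cc f ->
  delta gr l n f (xi - eta) = delta gr l n f xi - delta gr l n f eta.
Proof. by move=> Cf; rewrite delta_D// -scaleN1r delta_Z// scaleN1r. Qed.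

Lemma delta_linear n f h (a : R[i]) xi : Cc f -> Cc h ->
  delta gr l n (a *: f + h) xi = a *: delta gr l n f xi + delta gr l n h xi.
Proof.
move=> Cf Ch; have Cfh : Cc (a *: f + h).
  by apply: (CcD hlch hl hproper) => //; exact: (CcZ hlch hl hproper).
have [t t0 [_ [_ bf _ _]]] := delta_bound n Cf.
have [t' t'0 [_ [_ bh _ _]]] := delta_bound n Ch.
have [t'' t''0 [_ [_ bfh _ _]]] := delta_bound n Cfh.
rewrite !(delta_kop hlch hl hproper hunif n)//; apply/funext => g.
pose M := l g + (t + t' + t'').
have hM1 : l g + t <= M by rewrite /M; lra.
have hM2 : l g + t' <= M by rewrite /M; lra.
have hM3 : l g + t'' <= M by rewrite /M; lra.
rewrite -[RHS]/(a * kop gr (dkernel gr l n f) xi g + kop gr (dkernel gr l n h) xi g).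
rewrite (kop_fball hl hunif _ bf hM1) (kop_fball hl hunif _ bh hM2) (kop_fball hl hunif _ bfh hM3).
rewrite mulr_sumr -big_split; apply: eq_bigr => m _.
rewrite /dkernel -[(a *: f + h) _]/(a * f (gdiv g m) + h (gdiv g m)) /=; ring.
Qed.

(** Transposing the kernel replaces [l g - l m] by its negative, which is the origin of the sign. *)
Lemma delta_adjoint n f : Cc f ->
  adjoint gr (delta gr l n f) (fun xi => (-1) ^+ n *: delta gr l n (star gr f) xi).
Proof.
move=> Cf; have Cs := star_Cc Cf.
have [A hA] := delta_op_le n Cf; have [A' hA'] := delta_op_le n Cs.
have hs : op_le A' (fun xi => (-1) ^+ n *: delta gr l n (star gr f) xi).
  by have := op_leZ ((-1) ^+ n) hA'; rewrite normcX normcN normc1 expr1n mul1r.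
have A0 : 0 <= A by case: hA.
have A'0 : 0 <= A' by case: hA'.
apply: (adjoint_dense hlch hl hproper hunif (A := A + A')).
- by move=> xi; exact: delta_E.
- by move=> xi Exi; apply: (E_Z hlch hl hproper); exact: delta_E.
- by move=> *; exact: delta_B.
- by move=> *; rewrite delta_B// scalerBr.
- by apply: op_le_weaken hA; rewrite lerDl.
- by apply: op_le_weaken hs; rewrite lerDr.
move=> f' h' u Cf' Ch' uu.
have [t t0 [_ [_ bK cK _]]] := delta_bound n Cf.
have [t' t'0 [_ [_ bK' cK' _]]] := delta_bound n Cs.
have eqK : forall g m, src g = src m -> conjc (dkernel gr l n f m g) =
    (-1) ^+ n * dkernel gr l n (star gr f) g m.
  move=> g m em; rewrite /dkernel rmorphM rmorphXn [X in X ^+ n]conjc_real.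
  rewrite /star inv_div// mulrA -exprMn; congr (_ ^+ n * _).
  by rewrite -opprB raddfN mulN1r.
rewrite (delta_kop hlch hl hproper hunif n Cf) (kop_adjoint_Cc bK t0)//.
congr (inner gr _ _ u); apply/funext => g.
rewrite (delta_kop hlch hl hproper hunif n Cs).
rewrite -[RHS]/((-1) ^+ n * kop gr (dkernel gr l n (star gr f)) h' g).
rewrite (kop_fball hl hunif _ bK' (lexx _)) mulr_sumr.
rewrite (@kop_seq _ _ _ _ _ _ (fball (src g) (l g + t'))).
- rewrite !big_seq; apply: eq_bigr => m /(mem_fball hl hunif _ _ (units_src gr g)) [em _].
  by rewrite mulrA eqK.
- exact: uniq_fball.
- by move=> m /(mem_fball hl hunif _ _ (units_src gr g)) [].
- move=> m em; rewrite eqK// mulf_eq0 negb_or => /andP[_ h0] _.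
  exact: (banded_mem_fball hl hunif bK' em h0).
Qed.

(** A bound passes to the adjoint, and the sign squares to 1. The case [n = 0] concerns [Lambda]
    itself. *)
Lemma delta_star n f M : Cc f -> op_le M (delta gr l n f) -> op_le M (delta gr l n (star gr f)).
Proof.
move=> Cf /(adjoint_op_le (delta_adjoint n Cf)) h.
have := op_leZ ((-1) ^+ n) h; rewrite normcX normcN normc1 expr1n mul1r.
by apply: op_le_eq => xi _; rewrite scalerA -exprMn mulN1r opprK expr1n scale1r.
Qed.

(** A competitor [T] in the infimum agrees with [delta n f] on [Cc]. Its bound therefore holds for
    [delta n f] on [Cc], after rescaling to the unit ball, and extends to [E] by density because
    [delta n f] is already known to be bounded by some [A]. *)
Lemma Ll_leP n f M : Cc f -> 0 <= M -> (Ll gr l n f <= M%:E)%E <-> op_le M (delta gr l n f).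
Proof.
move=> Cf M0; split=> [h|h]; last first.
  apply: (@le_trans _ _ (opnorm gr (delta gr l n f))); last exact: opnorm_le.
  apply: ereal_inf_lbound; exists (delta gr l n f) => //; split=> //.
  by eexists; exact: delta_adjoint.
suff ext T N : (forall xi, Cc xi -> T xi = delta gr l n f xi) -> 0 <= N ->
    (opnorm gr T <= N%:E)%E -> op_le N (delta gr l n f).
  split=> // xi L Exi hL; have L0 := sec_le_ge0 hL.
  apply: sec_le_addgt0 => [|e e0]; first exact: mulr_ge0.
  have L1 : 0 < L + 1 by rewrite ltr_wpDl.
  have : (Ll gr l n f < (M + e / (L + 1))%:E)%E.
    by apply: le_lt_trans h _; rewrite lte_fin ltrDl divr_gt0.
  move=> /ereal_inf_lt [_ [T [_ hT] <-]] /ltW hlt.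
  have M'0 : 0 <= M + e / (L + 1) by rewrite addr_ge0// ltW// divr_gt0.
  have [_ /(_ xi L Exi hL)] := ext T _ hT M'0 hlt; apply: sec_le_weaken.
  rewrite mulrDl lerD2l mulrAC ler_pdivrMr// ler_wpM2l ?(ltW e0)// lerDl//.
move=> {h} hT N0 hN; split=> // xi L Exi hL; have L0 := sec_le_ge0 hL.
have [A [A0 hA]] := delta_op_le n Cf.
apply: sec_le_addgt0 => [|e e0]; first exact: mulr_ge0.
(* The total bound is [A * d + N * (L + d)], which exceeds [N * L] by at most [e]. *)
pose d := e / (A + N + 1).
have D0 : 0 < A + N + 1 by lra.
have d0 : 0 < d by rewrite divr_gt0.
have [h Ch hh] := E_dense Exi d0; have Eh := Cc_E gr Ch.
have hLh : sec_le (L + d) h.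
  by have -> : h = xi - (xi - h) by [rewrite subKr]; exact: sec_leB.
have Ld : 0 < L + d by rewrite ltr_wpDl.
have Th : sec_le (N * (L + d)) (delta gr l n f h).
  pose a : R[i] := (L + d)^-1%:C%C.
  have na : normc (a : C) = (L + d)^-1 by rewrite normc_real gtr0_norm ?invr_gt0.
  have h1 : sec_le 1 (a *: h).
    have -> : 1 = normc (a : C) * (L + d) by rewrite na mulVf ?lt0r_neq0.
    exact: sec_leZ.
  have Cah : Cc (a *: h) by exact: (CcZ hlch hl hproper).
  have h2 : sec_le N (T (a *: h)).
    apply/normE_leP => //; move/(nnsup_leP _ N0) : hN; apply.
    exists (a *: h) => //; split; first exact: Cc_E.
    by apply/normE_leP.
  rewrite hT// delta_Z// in h2.
  have := sec_leZ ((L + d)%:C%C) h2.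
  rewrite normc_real gtr0_norm// mulrC scalerA -rmorphM /= mulfV ?lt0r_neq0//.
  by rewrite scale1r.
have -> : delta gr l n f xi = delta gr l n f (xi - h) + delta gr l n f h.
  by rewrite -delta_D// subrK.
have h3 : sec_le (A * d) (delta gr l n f (xi - h)).
  by apply: hA => //; exact: (E_B hlch hl hproper).
apply: sec_le_weaken (sec_leD h3 Th).
have : d * (A + N + 1) = e by rewrite /d divfK// lt0r_neq0.
have := ltW d0; nra.
Qed.

End DeltaOperators.

(** * Positivity of [1 - a] through a square root *)

Section SquareRoot.
Context {R : realType} {G : topologicalType} (gr : groupoid G) (l : G -> R).
Hypotheses (hlch : lch_groupoid gr) (het : etale gr).
Hypotheses (hl : length_function gr l) (hproper : proper_length l).
Hypothesis hunif : forall t, 0 <= t -> exists2 F : R, 1 <= F & fiber_card_le gr l t F.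
Local Notation C := (Cplx R).
Local Notation normc := (@ComplexField.Normc.normc R).
Local Notation inv := (ginv gr).
Local Notation src := (src gr).
Local Notation rng := (rng gr).
Local Notation gdiv := (gdiv gr).
Local Notation fball := (fball gr l).
Implicit Types (f xi eta : G -> C) (K : G -> G -> C).
Local Notation E := (@E R G gr).
Local Notation sec_le := (sec_le gr).
Local Notation op_le := (@op_le R G gr).
Implicit Types (T S : (G -> C) -> (G -> C)).

Hypothesis hopen : open (units gr).
Local Notation one := (@one_Cc R G gr).
Local Notation Lam := (Lambda gr).

Lemma one_neq0 g : one g != 0 -> units gr g.
Proof.
rewrite /one_Cc; case: (boolP (g \in units gr)) => [/set_mem//|_].
by rewrite eqxx.
Qed.

Lemma one_unit g : units gr g -> one g = 1.
Proof. by move=> u; rewrite /one_Cc mem_set. Qed.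

Lemma one_nunit g : ~ units gr g -> one g = 0.
Proof. by move=> u; rewrite /one_Cc memNset. Qed.

(** The units are open by assumption and closed as the zero set of [l], so their indicator is
    continuous; it is supported in the ball of radius 0. *)
Lemma one_in_Cc : Cc one.
Proof.
apply/(Cc_bounded_support hlch hl hproper); split; last first.
  by exists 0 => // g /one_neq0 /(length_eq0 hl) ->.
have ou : open (~` units gr).
  have -> : ~` units gr = l @^-1` [set x | x != 0].
    apply/seteqP; split => g /=; first by move=> h; apply/eqP => /(length_eq0 hl).
    by move=> /eqP h /(length_eq0 hl).
  apply: open_comp; first by move=> x _; exact: length_continuous hl _.
  exact: open_neq.
move=> g; apply/cvg_normcP => e e0.
have [u|nu] := pselect (units gr g).
  apply: filterS (open_nbhs_nbhs (conj hopen u)) => g' u'.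
  by rewrite !one_unit// subrr normc0.
apply: filterS (open_nbhs_nbhs (conj ou nu)) => g' u'.
by rewrite !one_nunit// subrr normc0.
Qed.

Lemma Lambda_one xi : Lam one xi = xi.
Proof.
apply/funext => g; rewrite LambdaE (@kop_seq _ _ _ _ _ _ [:: g])//.
- by rewrite big_seq1 one_unit ?mul1r//; exact: units_rng.
- by move=> m; rewrite inE => /eqP ->.
- by move=> m em /one_neq0 /(gdiv_unit em) ->; rewrite inE.
Qed.

Lemma star_one : star gr one = one.
Proof.
apply/funext => g; rewrite /star; have [u|nu] := pselect (units gr g).
  by rewrite inv_unit// one_unit// conjc1.
rewrite !one_nunit ?conjc0// => u; apply: nu.
by rewrite -(ginvK gr g) inv_unit.
Qed.

Lemma sec_le_one : sec_le 1 one.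
Proof.
split=> // u s us su; rewrite expr1n.
have [us'|nus] := boolP (u \in s); last first.
  rewrite big1_seq// => m /andP[_ ms]; rewrite one_nunit ?normc0 ?expr0n//.
  by move=> um; move: nus; rewrite -(su m ms) src_unit// ms.
rewrite (bigD1_seq u)//= big1_seq ?addr0.
  rewrite one_unit ?normc1 ?expr1n//.
  by rewrite -(su _ us'); exact: units_src.
move=> m /andP[mu ms]; rewrite one_nunit ?normc0 ?expr0n// => um.
by move: mu; rewrite -(su m ms) src_unit// eqxx.
Qed.

(** The kernel of [one] lives on the diagonal, where the factor [l g - l m] vanishes. *)
Lemma delta_one n xi : (0 < n)%N -> delta gr l n one xi = 0.
Proof.
move=> n0; rewrite (delta_kop hlch hl hproper hunif n one_in_Cc); apply/funext => g.
rewrite /kop fsbig1// => m /esym em.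
have [u|nu] := pselect (units gr (gdiv g m)).
  by rewrite /dkernel (gdiv_unit em u) subrr expr0n (gtn_eqF n0) !mul0r.
by rewrite /dkernel one_nunit// mulr0 mul0r.
Qed.

Lemma delta_at_one n f g : Cc f -> delta gr l n f one g = (l g)%:C%C ^+ n * f g.
Proof.
move=> Cf; rewrite (delta_kop hlch hl hproper hunif n Cf).
have us := units_src gr g.
rewrite (@kop_seq _ _ _ _ _ _ [:: src g])//.
- rewrite big_seq1 one_unit// mulr1 /dkernel gdiv_src.
  by have /(length_eq0 hl) -> := us; rewrite subr0.
- by move=> m; rewrite inE => /eqP ->; rewrite src_unit.
- by move=> m em _ /one_neq0 um; rewrite inE em src_unit.
Qed.

Lemma star_Lambda f h : Cc f -> Cc h -> star gr (Lam f h) = Lam (star gr h) (star gr f).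
Proof.
move=> Cf Ch; apply/funext => g.
have /(Cc_bounded_support hlch hl hproper) [_ [t t0 ht]] := Cf.
set s := fball (src g) t.
have es m : m \in s -> src m = src g by move/(mem_fball hl hunif _ _ (units_src gr g)) => [].
rewrite [in RHS]LambdaE (@kop_seq _ _ _ _ _ _ s); first last.
- move=> m em _; rewrite /star conjc_eq0 => /ht hm.
  by apply/(mem_fball hl hunif _ _ (units_src gr g)); split=> //; rewrite -(length_inv hl).
- exact: es.
- exact: uniq_fball.
rewrite /star LambdaE (@kop_seq _ _ _ _ _ _ (map (fun p => gdiv p g) s)).
- rewrite big_map rmorph_sum !big_seq; apply: eq_bigr => p /es ep.
  rewrite rmorphM mulrC (inv_div (esym ep)); congr (_ * conjc (f _)).
  have c1 : composable gr (inv g) (gdiv g p) by apply/composableE; rewrite src_inv rng_div.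
  rewrite {1}gdivE inv_div// gdivE gmulVK//; exact: composable_div.
- rewrite map_inj_in_uniq ?uniq_fball// => p q /es ep /es eq e.
  by rewrite -(mul_divK ep) e mul_divK.
- by move=> _ /mapP[p /es ep ->]; rewrite src_div// src_inv.
- move=> m em fm _; rewrite src_inv in em.
  have c1 : composable gr m g by apply/composableE.
  have e1 : gdiv (gmul gr m g) g = m by exact: gmulK.
  apply/mapP; exists (gmul gr m g) => //.
  apply/(mem_fball hl hunif _ _ (units_src gr g)); split; first exact: src_mul.
  rewrite -(length_inv hl) inv_mul//; exact: ht.
Qed.

Lemma Lambda_linear f h (a : R[i]) xi : Cc f -> Cc h ->
  Lam (a *: f + h) xi = a *: Lam f xi + Lam h xi.
Proof. exact: (delta_linear hlch hl hproper hunif 0). Qed.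

Lemma Lambda0 xi : Lam 0 xi = 0.
Proof. by apply/funext => g; rewrite LambdaE /kop fsbig1// => m _; exact: mul0r. Qed.

Lemma Lambda_scale f (a : R[i]) xi : Cc f -> Lam (a *: f) xi = a *: Lam f xi.
Proof.
move=> Cf; have C0 : Cc (0 : G -> C) by rewrite -(subrr f); exact: (CcB hlch hl hproper).
by rewrite -[a *: f]addr0 Lambda_linear// Lambda0 addr0.
Qed.

Lemma Lambda_subl f h xi : Cc f -> Cc h -> Lam (f - h) xi = Lam f xi - Lam h xi.
Proof.
by move=> Cf Ch; rewrite addrC -scaleN1r Lambda_linear// scaleN1r addrC.
Qed.

Lemma Lambda_sub f xi eta : Cc f -> Lam f (xi - eta) = Lam f xi - Lam f eta.
Proof. exact: (delta_B hlch hl hproper hunif 0). Qed.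

Lemma Lambda_E f xi : Cc f -> E xi -> E (Lam f xi).
Proof. exact: (delta_E hlch het hl hproper hunif 0). Qed.

(** The limit is taken value by value, which avoids completing a space of operators. [sec_le_lim]
    then turns the Cauchy rate into a norm rate, and self-adjointness and membership in the algebra
    follow from that rate. *)
Lemma limit_operator (b : nat -> G -> C) (c : nat -> R) :
  (forall k, Cc (b k)) -> (forall k, star gr (b k) = b k) ->
  c @ \oo --> 0 ->
  (forall j k, (k <= j)%N -> op_le (c k) (Lam (b j - b k))) ->
  exists B, [/\ adjoint gr B B, Cstar_red gr B &
    forall k, op_le (c k) (fun xi => B xi - Lam (b k) xi)].
Proof.
move=> Cb sb c0 hc.
have lim xi : exists zeta : G -> C, E xi -> forall g e, 0 < e ->
    \forall k \near \oo, normc (zeta g - Lam (b k) xi g) <= e.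
  have [Exi|nE] := pselect (E xi); last by exists 0.
  have [p _ hp] := sec_le_normE hlch hl hproper hunif Exi.
  have cp0 : (fun k => c k * p) @ \oo --> (0 : R).
    by rewrite -[X in _ --> X](mul0r p); apply: cvgMl.
  have ex g : exists a : C, forall k, normc (a - Lam (b k) xi g) <= c k * p.
    apply: normc_cauchy_cvg => // j k kj.
    have [_ /(_ xi p Exi hp) /(sec_le_at g)] := hc j k kj.
    by rewrite Lambda_subl.
  have [z hz] := choice ex; exists z => _ g e e0.
  have /cvgrPdist_lt/(_ e e0) := cp0; apply: filterS => k.
  rewrite sub0r normrN => /ltW h; apply: le_trans (hz g k) _.
  exact: le_trans (ler_norm _) h.
have {lim} [B hB] := choice lim.
have hBk k : op_le (c k) (fun xi => B xi - Lam (b k) xi).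
  split=> [|xi N Exi hN]; first by have [] := hc k k (leqnn k).
  apply: (@sec_le_lim _ _ _ _ _ (fun j => Lam (b j) xi - Lam (b k) xi) k).
    by move=> j kj; rewrite -Lambda_subl//; have [_] := hc j k kj; apply.
  move=> g e e0; apply: filterS (hB xi Exi g e e0) => j.
  by rewrite -[(B xi - _) g]/(B xi g - Lam (b k) xi g)
    -[(Lam (b j) xi - _) g]/(Lam (b j) xi g - Lam (b k) xi g) opprB addrA subrK.
have small e : 0 < e -> exists k, c k <= e.
  move=> e0; have /cvgrPdist_lt/(_ e e0) [k _ /(_ k (leqnn k))] := c0.
  by rewrite /= sub0r normrN => /ltW h; exists k; exact: le_trans (ler_norm _) h.
have EB xi : E xi -> E (B xi).
  move=> Exi; have [p _ hp] := sec_le_normE hlch hl hproper hunif Exi.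
  have p0 := sec_le_ge0 hp; have D0 : 0 < p + 1 by rewrite ltr_wpDl.
  apply: E_closed => e e0; have [|k hk] := small (e / (p + 1)); first by rewrite divr_gt0.
  exists (Lam (b k) xi); first exact: Lambda_E.
  have [_ h] := hBk k; apply: sec_le_weaken (h xi p Exi hp).
  apply: (@le_trans _ _ (e / (p + 1) * p)); first by rewrite ler_wpM2r.
  by rewrite mulrAC ler_pdivrMr// ler_wpM2l ?(ltW e0)// lerDl.
have adjB : adjoint gr B B.
  split=> // xi eta Exi Eeta u uu; apply/eqP; rewrite -subr_eq0; apply/eqP.
  apply: normc_small => e e0.
  have [p _ hp] := sec_le_normE hlch hl hproper hunif Exi.
  have [q _ hq] := sec_le_normE hlch hl hproper hunif Eeta.
  have p0 := sec_le_ge0 hp; have q0 := sec_le_ge0 hq.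
  have D0 : 0 < 2 * (p * q) + 1 by rewrite ltr_wpDl// !mulr_ge0.
  have [|k hk] := small (e / (2 * (p * q) + 1)); first by rewrite divr_gt0.
  have [ck0 h] := hBk k.
  have z0 (zeta : G -> C) : sec_le 0 (zeta - zeta).
    by rewrite subrr; split=> // v s _ _; rewrite big1 ?expr0n// => m _; rewrite normc0 expr0n.
  have h1 : normc (inner gr (B xi) eta u - inner gr (Lam (b k) xi) eta u) <= c k * p * q.
    have [M hM] := E_sec_le hlch hl hproper hunif (Lambda_E (Cb k) Exi).
    rewrite -[leRHS]addr0 -{1}(mulr0 M).
    apply: (inner_close hlch hl hproper hunif) => //; [exact: EB|exact: Lambda_E|exact: h].
  have h2 : normc (inner gr xi (B eta) u - inner gr xi (Lam (b k) eta) u) <= c k * p * q.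
    have [M hM] := E_sec_le hlch hl hproper hunif (EB _ Eeta).
    rewrite -[leRHS]add0r -{1}(mul0r M) mulrAC [_ * p]mulrC.
    apply: (inner_close hlch hl hproper hunif) => //; [exact: EB|exact: Lambda_E|exact: h].
  have [_ _ /(_ xi eta Exi Eeta u uu)] := delta_adjoint hlch het hl hproper hunif 0 (Cb k).
  rewrite expr0 sb /delta /= scale1r => e1; rewrite e1 in h1.
  have h3 := normc_dist (inner gr (B xi) eta u) (inner gr xi (Lam (b k) eta) u) (inner gr xi (B eta) u).
  rewrite (normcB (inner gr xi (Lam (b k) eta) u)) in h3.
  have h4 : c k * (2 * (p * q) + 1) <= e by rewrite -ler_pdivlMr.
  lra.
exists B; split => //; split; first by exists B.
move=> e e0; have [|k hk] := small (e / 2); first by rewrite divr_gt0.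
exists (b k) => //; apply: (@le_lt_trans _ _ (e / 2)%:E).
  by apply: opnorm_le; apply: op_le_weaken (hBk k).
by rewrite lte_fin ltr_pdivrMr// mulr_natr mulr2n ltrDl.
Qed.

(* The square root of [1 - a] is [1 - y] where [y] is the fixed point of the
   contraction [y |-> (a + y^2) / 2] of the ball of radius [rho]. *)
Lemma one_sub_Cc_pos a rho : Cc a -> star gr a = a -> 0 <= rho < 1 -> op_le rho (Lam a) ->
  Cc_pos gr (one - a).
Proof.
move=> Ca sa /andP[rho0 rho1] ha.
pose h2 : R[i] := (2^-1)%:C%C.
have nh2 : normc (h2 : C) = 2^-1 by rewrite normc_real ger0_norm ?invr_ge0.
pose y := fix y k : G -> C := if k is k'.+1 then h2 *: (a + Lam (y k') (y k')) else 0.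
have C0 : Cc (0 : G -> C) by rewrite -(subrr a); exact: (CcB hlch hl hproper).
have Cy k : Cc (y k).
  elim: k => [|k IH] //=; apply: (CcZ hlch hl hproper); apply: (CcD hlch hl hproper) => //.
  exact: (Lambda_Cc hlch het hl hproper hunif).
have sy k : star gr (y k) = y k.
  elim: k => [|k IH] /=; first by apply/funext => g; rewrite /star conjc0.
  have e1 := star_Lambda (Cy k) (Cy k); rewrite IH in e1.
  apply/funext => g; rewrite -[RHS]/(h2 * (a g + Lam (y k) (y k) g)) -{2}sa -{2}e1.
  rewrite /star -[(h2 *: _) _]/(h2 * (a (inv g) + Lam (y k) (y k) (inv g))).
  by rewrite rmorphM rmorphD; congr (_ * _); exact: conjc_real.
have yS k xi : Lam (y k.+1) xi = h2 *: (Lam a xi + Lam (y k) (Lam (y k) xi)).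
  have CL : Cc (Lam (y k) (y k)) by exact: (Lambda_Cc hlch het hl hproper hunif).
  rewrite /= -[h2 *: _]addr0 Lambda_linear//; last by exact: (CcD hlch hl hproper).
  rewrite -[a in LHS]scale1r Lambda_linear// scale1r.
  rewrite (Lambda_comp hlch hl hproper hunif)//.
  by rewrite Lambda0 addr0.
have EL k xi : E xi -> E (Lam (y k) xi) by exact: Lambda_E.
(* The ball is preserved because [(rho + rho ^+ 2) / 2 <= rho]. *)
have by_ k : op_le rho (Lam (y k)).
  elim: k => [|k IH].
    apply: (op_le_eq (T := fun=> 0)).
      by move=> xi _; rewrite /= Lambda0.
    split=> // xi N _ hN; split; first by rewrite mulr_ge0 ?(sec_le_ge0 hN).
    by move=> u s _ _; rewrite big1 ?sqr_ge0// => m _; rewrite normc0 expr0n.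
  have := op_leZ h2 (op_leD ha (op_le_comp (EL k) IH IH)).
  rewrite nh2 => h; apply: (op_le_eq (T := fun xi => h2 *: (Lam a xi + Lam (y k) (Lam (y k) xi)))).
    by move=> xi _; rewrite yS.
  by apply: op_le_weaken h; nra.
(* Write the difference of the squares of [v = y k.+1] and [u = y k] as [v * (v - u) + (v - u) * u],
   which needs no commutation; each product costs a factor [rho], and the coefficient [1 / 2]
   averages the two. *)
have dy k : op_le (rho ^+ k.+1) (fun xi => Lam (y k.+1) xi - Lam (y k) xi).
  elim: k => [|k IH].
    apply: (op_le_eq (T := Lam (y 1%N))); last by rewrite expr1; exact: by_.
    by move=> xi _; rewrite [Lam (y 0%N) xi]Lambda0 subr0.
  have [ED EDs] : (forall xi, E xi -> E (Lam (y k.+1) xi)) /\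
      (forall xi, E xi -> E (Lam (y k.+1) xi - Lam (y k) xi)).
    by split=> xi Exi; [exact: EL|apply: (E_B hlch hl hproper); exact: EL].
  have := op_leZ h2 (op_leD (op_le_comp EDs (by_ k.+1) IH) (op_le_comp (EL k) IH (by_ k))).
  rewrite nh2 => h.
  apply: (@op_le_eq _ _ _ _ _ _ _ (op_le_weaken _ h)); last first.
    by rewrite [rho ^+ k.+2]exprS; lra.
  move=> xi Exi; rewrite (yS k.+1 xi) [in X in _ = _ - X](yS k xi).
  rewrite -scalerBr; congr (_ *: _).
  by rewrite Lambda_sub// subrKA opprD addrACA subrr add0r.
have r1 : 1 - rho != 0 by rewrite subr_eq0 eq_sym lt_eqF.
have geom (p q : R) : rho * q + (p - q) * (rho / (1 - rho)) = (p - rho * q) * (rho / (1 - rho)).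
  by field.
pose kap := rho / (1 - rho).
have kap0 : 0 <= kap by rewrite divr_ge0//; lra.
(* The factor [(rho ^+ k - rho ^+ (i + k)) * kap] is exactly the geometric sum of the increments
   [rho ^+ j.+1] for [k <= j < i + k]. *)
have dyj k i : op_le ((rho ^+ k - rho ^+ (i + k)) * kap) (fun xi => Lam (y (i + k)%N) xi - Lam (y k) xi).
  elim: i => [|i IH].
    rewrite add0n subrr mul0r; split=> // xi N _ hN; rewrite mul0r subrr; split=> // u s _ _.
    by rewrite big1 ?expr0n// => m _; rewrite normc0 expr0n.
  have := op_leD (dy (i + k)%N) IH => h.
  apply: (@op_le_eq _ _ _ _ _ _ _ (op_le_weaken _ h)); last first.
    by rewrite addSn !exprS geom.
  by move=> xi Exi; rewrite addSn subrKA.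
have Cb k : Cc (one - y k) by apply: (CcB hlch hl hproper) => //; exact: one_in_Cc.
have [||j k kj|B [adjB CB hB]] := @limit_operator (fun k => one - y k) (fun k => rho ^+ k * kap) Cb.
- move=> k; apply/funext => g; rewrite /star.
  rewrite -[(one - y k) (inv g)]/(one (inv g) - y k (inv g)) rmorphB.
  by rewrite -[X in X - _]/(star gr one g) -[X in _ - X]/(star gr (y k) g) sy star_one.
- rewrite -[X in _ --> X](mul0r kap); apply: cvgMl.
  by apply: cvg_expr; rewrite ger0_norm.
- have {dyj} := dyj k (j - k)%N; rewrite subnK// => h.
  have {}h := op_leZ (-1) h; rewrite normcN normc1 mul1r in h.
  apply: (@op_le_eq _ _ _ _ _ _ _ (op_le_weaken _ h)); last first.
    by rewrite ler_wpM2r// gerBl exprn_ge0.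
  move=> xi Exi; rewrite Lambda_subl// !Lambda_subl//; try exact: one_in_Cc.
  by rewrite scaleN1r !opprB [RHS]addrC subrKA.
exists B, B; split=> // xi Exi.
have [_ EB _] := adjB.
apply/eqP; rewrite -subr_eq0; apply/eqP; apply: sec_le0.
have [p _ hp] := sec_le_normE hlch hl hproper hunif Exi.
have p0 := sec_le_ge0 hp.
have C1 := one_in_Cc.
have [M M0 hM] : exists2 M, 0 <= M & forall k, op_le M (Lam (one - y k)).
  have [A hA] := delta_op_le hlch hl hproper hunif 0 C1.
  exists (A + rho); first by rewrite addr_ge0//; case: hA.
  move=> k; apply: (op_le_eq _ (op_leB hA (by_ k))) => eta _.
  by rewrite Lambda_subl.
have [q _ hq] := sec_le_normE hlch hl hproper hunif (EB _ Exi).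
have q0 := sec_le_ge0 hq.
(* With [b = 1 - y k], the square of [B] differs from [1 - a] by [(B - b) * B + b * (B - b) + 2 * (y
   k.+1 - y k)], because the recursion gives [b * b = 1 - a + 2 * (y k.+1 - y k)]. The three terms
   yield the three summands of [D]. *)
pose D := kap * q + M * kap * p + 2 * p.
have D0 : 0 <= D.
  have h1 : 0 <= kap * q by exact: mulr_ge0.
  have h3 : 0 <= M * kap * p by apply: mulr_ge0 => //; exact: mulr_ge0.
  by rewrite /D; lra.
apply: sec_le_addgt0 => // e e0; rewrite add0r.
have [k hk] : exists k, rho ^+ k * D <= e.
  have : (fun k => rho ^+ k * D) @ \oo --> (0 : R).
    by rewrite -[X in _ --> X](mul0r D); apply: cvgMl; apply: cvg_expr; rewrite ger0_norm.
  move=> /cvgrPdist_lt/(_ e e0) [k _ /(_ k (leqnn k))] /=.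
  by rewrite sub0r normrN => h; exists k; apply: le_trans (ler_norm _) (ltW h).
apply: (sec_le_weaken hk).
have [_ hBk] := hB k.
have h1 : sec_le (rho ^+ k * kap * q) (B (B xi) - Lam (one - y k) (B xi)).
  by apply: hBk => //; exact: EB.
have h2' : sec_le (M * (rho ^+ k * kap * p)) (Lam (one - y k) (B xi - Lam (one - y k) xi)).
  have [_ h] := hM k; apply: h; last exact: hBk.
  by apply: (E_B hlch hl hproper); [exact: EB|exact: Lambda_E].
have h3 : sec_le (2 * (rho ^+ k.+1 * p)) (2 *: (Lam (y k.+1) xi - Lam (y k) xi)).
  have n2 : normc (2 : C) = 2.
    have -> : (2 : C) = (2 : R)%:C%C by rewrite rmorph_nat.
    by rewrite normc_real ger0_norm.
  rewrite -{1}n2; apply: sec_leZ; have [_ h] := dy k; exact: h.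
have e1 : Lam (one - a) xi - B (B xi) = - ((B (B xi) - Lam (one - y k) (B xi)) +
   Lam (one - y k) (B xi - Lam (one - y k) xi) + 2 *: (Lam (y k.+1) xi - Lam (y k) xi)).
  rewrite [Lam (one - y k) (B xi - _)]Lambda_sub// subrKA.
  have -> : Lam (one - y k) (Lam (one - y k) xi) =
      Lam (one - a) xi + 2 *: (Lam (y k.+1) xi - Lam (y k) xi).
    rewrite (Lambda_subl _ C1 (Cy k)) Lambda_one (Lambda_subl _ C1 (Cy k)) Lambda_one.
    rewrite Lambda_sub// (Lambda_subl _ C1 Ca) Lambda_one yS.
    apply/funext => g; rewrite -[LHS]/(xi g - Lam (y k) xi g -
      (Lam (y k) xi g - Lam (y k) (Lam (y k) xi) g)).
    rewrite -[RHS]/(xi g - Lam a xi g + 2 * (h2 * (Lam a xi g + Lam (y k) (Lam (y k) xi) g) - Lam (y k) xi g)).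
    have e2 : (2 : C) * h2 = 1.
      have -> : (2 : C) = (2 : R)%:C%C by rewrite rmorph_nat.
      by rewrite /h2 -rmorphM mulfV ?pnatr_eq0.
    rewrite mulrBr mulrA e2; ring.
  by rewrite opprD opprB addrAC addrK.
rewrite e1; apply: sec_leN; apply: sec_le_weaken (sec_leD (sec_leD h1 h2') h3).
rewrite /D exprS !mulrDr; have : 0 <= rho ^+ k by exact: exprn_ge0.
have : rho * (rho ^+ k * p) <= rho ^+ k * p by rewrite ler_piMl ?mulr_ge0 ?exprn_ge0// ltW.
lra.
Qed.

End SquareRoot.

(** * Rieffel's criterion for the pointwise topology on states *)

Lemma ptws_cvg (I : choiceType) (T : topologicalType) (F : set_system {ptws I -> T})
    (f : {ptws I -> T}) : Filter F ->
  (forall i, (fun g : {ptws I -> T} => g i) @ F --> f i) -> F --> f.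
Proof.
move=> FF h; apply/cvg_sup => i.
apply/cvg_image; first by rewrite eqEsubset; split=> v // _; exists (cst v).
move=> W /= /h Q; exists (@^~ i @^-1` W) => //.
by rewrite eqEsubset; split => [j [? + <-//]|j Wj]; exists (fun _ => j).
Qed.

Lemma ptws_near (R : realType) (I : choiceType) (phi : {ptws I -> Cplx R}) (i : I) (e : R) :
  0 < e -> nbhs phi
    [set psi : {ptws I -> Cplx R} | ComplexField.Normc.normc (psi i - phi i : R[i]) < e].
Proof.
move=> e0; have nb : nbhs (phi i : Cplx R)
    [set z : Cplx R | ComplexField.Normc.normc (z - phi i : R[i]) < e].
  exact: ((@cvg_normcP R _ (nbhs (phi i : Cplx R)) id (phi i) _).1 cvg_id e e0).
exact: (@proj_continuous I (fun=> Cplx R) i phi _ nb).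
Qed.

Section QuantumMetric.
Context {R : realType} {V : lmodType (complex R)}.
Variables (invol : V -> V) (one : V) (pos : set V) (X : set V) (L : V -> \bar R).
Local Notation C := (Cplx R).
Local Notation normc := (@ComplexField.Normc.normc R).
Hypotheses (hX : operator_system invol one X) (hL : star_seminorm invol one X L).
Local Notation state := (@state_space R V one pos X).

Definition inX (x : V) (h : X x) : X := SigSub (mem_set h).

Lemma X_val (x : X) : X (val x). Proof. exact: set_mem (valP x). Qed.

Lemma X_zero : X 0.
Proof. by case: hX => X1 Xl _; rewrite -(addNr one) -scaleN1r; exact: Xl. Qed.

Lemma X_lin (a : R[i]) x y : X x -> X y -> X (a *: x + y).
Proof. by case: hX => _ h _; exact: h. Qed.

Lemma X_scale (a : R[i]) x : X x -> X (a *: x).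
Proof. by move=> Xx; rewrite -[_ *: _]addr0; apply: X_lin => //; exact: X_zero. Qed.

Lemma state_lin (phi : X -> C) (a : R[i]) (x y z : X) : state phi ->
  val z = a *: val x + val y -> phi z = a * phi x + phi y.
Proof. by case=> h _ _; exact: h. Qed.

Lemma state_zero (phi : X -> C) (x : X) : state phi -> val x = 0 -> phi x = 0.
Proof.
move=> sphi x0; have := @state_lin phi 1 x x x sphi.
rewrite x0 scaler0 addr0 mul1r => /(_ erefl) e.
by apply: (addIr (phi x)); rewrite add0r -e.
Qed.

Lemma state_scale (phi : X -> C) (a : R[i]) (x z : X) : state phi ->
  val z = a *: val x -> phi z = a * phi x.
Proof.
move=> sphi e; have e0 : val (inX X_zero) = 0 by [].
rewrite -[RHS]addr0 -(state_zero sphi e0); apply: state_lin => //.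
by rewrite e0 addr0.
Qed.

Lemma mk_leP (phi psi : X -> C) (M : R) : 0 <= M -> (mk L phi psi <= M%:E)%E <->
  forall x : X, (L (val x) <= 1)%E -> normc (phi x - psi x) <= M.
Proof.
move=> M0; rewrite /mk nnsup_leP//; split=> [h x Lx|h _ [x /= Lx <-]].
  by rewrite -lee_fin; apply: h; exists x.
by rewrite lee_fin; exact: h.
Qed.

Lemma mk_ge0 (phi psi : X -> C) : (0 <= mk L phi psi)%E.
Proof. exact: nnsup_ge0. Qed.

Lemma mk_dist (phi psi : X -> C) (x : X) (c M : R) : state phi -> state psi ->
  (mk L phi psi <= M%:E)%E -> 0 <= M -> 0 < c -> (L (val x) <= c%:E)%E ->
  normc (phi x - psi x) <= c * M.
Proof.
move=> sphi spsi hM M0 c0 Lx; have [_ _ Lhom _ _] := hL.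
pose a : R[i] := c^-1%:C%C.
have na : normc (a : C) = c^-1 by rewrite normc_real gtr0_norm ?invr_gt0.
pose z := inX (X_scale a (X_val x)).
have ez : val z = a *: val x by [].
have Lz : (L (val z) <= 1)%E.
  rewrite ez Lhom; last exact: X_val.
  by rewrite na muleC lee_pdivrMr// mul1e.
have := (mk_leP phi psi M0).1 hM z Lz.
rewrite (state_scale sphi ez) (state_scale spsi ez) -mulrBr normcM na.
by rewrite ler_pdivrMl.
Qed.

(* Total boundedness of the unit ball of [L] modulo scalars, as seen by states. *)
Hypothesis net : forall e : R, 0 < e -> exists H : seq X,
  forall x : X, (L (val x) <= 1)%E -> exists2 h, h \in H &
    forall phi psi : X -> C, state phi -> state psi ->
      normc ((phi x - psi x) - (phi h - psi h)) <= e.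

(** A net at scale 1 suffices: its finitely many elements bound the difference of [phi] and [psi] on
    the whole unit ball up to 1. *)
Lemma mk_fin (phi psi : X -> C) : state phi -> state psi -> mk L phi psi \is a fin_num.
Proof.
move=> sphi spsi; have [H hH] := net ltr01.
rewrite ge0_fin_numE ?mk_ge0//.
apply: (@le_lt_trans _ _ (\sum_(h <- H) normc (phi h - psi h) + 1)%:E); last exact: ltry.
apply/mk_leP; first by rewrite addr_ge0// sumr_ge0// => *; exact: normc_ge0.
move=> x Lx; have [h hH' hh] := hH x Lx.
have := hh phi psi sphi spsi.
have := normcD (phi x - psi x - (phi h - psi h)) (phi h - psi h); rewrite subrK.
have : normc (phi h - psi h) <= \sum_(h <- H) normc (phi h - psi h).
  rewrite (big_rem h)//= lerDl sumr_ge0// => *; exact: normc_ge0.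
lra.
Qed.

Lemma mk_fine_leP (phi psi : X -> C) (M : R) : state phi -> state psi ->
  (fine (mk L phi psi) <= M) = (mk L phi psi <= M%:E)%E.
Proof. by move=> sphi spsi; rewrite -lee_fin fineK//; exact: mk_fin. Qed.

Lemma mk_fine_ge0 (phi psi : X -> C) : 0 <= fine (mk L phi psi).
Proof. by rewrite fine_ge0// mk_ge0. Qed.

(** The summand 1 keeps the scaling factor positive for elements with [L (val x) = 0]. *)
Lemma mk_fine_dist (phi psi : X -> C) (x : X) : state phi -> state psi ->
  normc (phi x - psi x) <= (fine (L (val x)) + 1) * fine (mk L phi psi).
Proof.
move=> sphi spsi; have [Lfin _ _ _ _] := hL; have [fL L0] := Lfin _ (X_val x).
apply: mk_dist => //.
- by rewrite -mk_fine_leP.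
- exact: mk_fine_ge0.
- by rewrite ltr_wpDl// fine_ge0.
by rewrite -[leLHS]fineK// lee_fin lerDl.
Qed.

Lemma mk_metric_on : metric_on (@state_space R V one pos X)
  (fun phi psi : {ptws X -> C} => fine (mk L phi psi)).
Proof.
split=> [phi psi _ _|phi psi sphi spsi|phi psi sphi spsi|phi psi chi sphi spsi schi].
- exact: mk_fine_ge0.
- split=> [h|->].
    apply/funext => x; apply/eqP; rewrite -subr_eq0; apply/eqP.
    apply: normc_small => e e0; apply: le_trans (mk_fine_dist x sphi spsi) _.
    by rewrite h mulr0 ltW.
  apply/eqP; rewrite eq_le mk_fine_ge0 andbT mk_fine_leP//.
  by apply/mk_leP => // x _; rewrite subrr normc0.
- suff h (f g : X -> C) : state f -> state g -> fine (mk L f g) <= fine (mk L g f).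
    by apply/eqP; rewrite eq_le !h.
  move=> sf sg; rewrite mk_fine_leP//; apply/mk_leP; first exact: mk_fine_ge0.
  move=> x Lx; rewrite normcB; apply: ((mk_leP g f _).1 _ x Lx); first exact: mk_fine_ge0.
  by rewrite -mk_fine_leP.
rewrite mk_fine_leP//; apply/mk_leP; first by rewrite addr_ge0 ?mk_fine_ge0.
move=> x Lx; apply: le_trans (normc_dist _ (psi x) _) _.
have h (f g : X -> C) : state f -> state g -> normc (f x - g x) <= fine (mk L f g).
  move=> sf sg; apply: ((mk_leP f g _).1 _ x Lx); first exact: mk_fine_ge0.
  by rewrite -mk_fine_leP.
by apply: lerD; exact: h.
Qed.

(** Evaluations are Lipschitz for the metric, so every pointwise neighbourhood contains a metric
    ball of states. Conversely a finite net turns closeness at its elements into closeness that is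
    uniform over the unit ball of [L]. *)
Theorem cqms_of_net : compact_quantum_metric_space invol one pos X L.
Proof.
split=> //; first by move=> phi psi; exact: mk_fin.
split; first exact: mk_metric_on.
move=> phi sphi; apply/seteqP; split => P.
  rewrite /within /= => nP.
  pose B (e : R) := @state_space R V one pos X `&`
    [set psi : {ptws X -> C} | fine (mk L phi psi) < e].
  pose F := filter_from [set e : R | 0 < e] B.
  have FF : Filter F.
    apply: filter_from_filter; first by exists 1; exact: ltr01.
    move=> e e' /= e0 e'0; exists (Num.min e e'); first by rewrite /= lt_min e0.
    by move=> psi [spsi]; rewrite /= lt_min => /andP[h h']; split; split.
  have cF : F --> (phi : {ptws X -> C}).
    apply: ptws_cvg => x; apply/cvg_normcP => e e0.
    have [Lfin _ _ _ _] := hL; have [fL L0] := Lfin _ (X_val x).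
    have c0 : 0 < fine (L (val x)) + 1 by rewrite ltr_wpDl// fine_ge0.
    exists (e / (fine (L (val x)) + 1)); first by rewrite /= divr_gt0.
    move=> psi [spsi /=]; rewrite ltr_pdivlMr// => h; rewrite normcB.
    by apply: le_lt_trans (mk_fine_dist x sphi spsi) _; rewrite mulrC.
  have [e e0 he] := cF _ nP.
  by exists e => // psi [spsi h]; apply: (he psi).
move=> [e /= e0 he].
(* One quarter for the net and one for closeness at its elements leave [e / 2], so the final
   inequality is strict. *)
have e4 : 0 < e / 4 by rewrite divr_gt0.
have [H hH] := net e4.
have : \forall psi \near (phi : {ptws X -> C}), forall h, h \in H ->
    normc ((psi : X -> C) h - phi h) < e / 4.
  apply: (@near_all_seq {ptws X -> C} (nbhs (phi : {ptws X -> C})) X H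
    (fun h psi => normc ((psi : X -> C) h - phi h) < e / 4)) => h _.
  exact: ptws_near.
rewrite /within /=; apply: (@filterS _ _ (nbhs_filter (phi : {ptws X -> C}))) => psi hpsi spsi; apply: he; split=> //=.
apply: (@le_lt_trans _ _ (e / 2)); last by rewrite ltr_pdivrMr// mulr_natr mulr2n ltrDl.
rewrite mk_fine_leP//; apply/mk_leP; first by rewrite divr_ge0// ltW.
move=> x Lx; have [h hH' hh] := hH x Lx.
have h1 : normc (phi h - psi h) < e / 4 by rewrite normcB; exact: hpsi.
have := hh phi psi sphi spsi.
have := normcD (phi x - psi x - (phi h - psi h)) (phi h - psi h); rewrite subrK.
lra.
Qed.

End QuantumMetric.

(** * States are bounded by the operator norm *)

Section StateBound.
Context {R : realType} {G : topologicalType} (gr : groupoid G) (l : G -> R).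
Hypotheses (hlch : lch_groupoid gr) (het : etale gr).
Hypotheses (hl : length_function gr l) (hproper : proper_length l).
Hypothesis hunif : forall t, 0 <= t -> exists2 F : R, 1 <= F & fiber_card_le gr l t F.
Local Notation C := (Cplx R).
Local Notation normc := (@ComplexField.Normc.normc R).
Local Notation inv := (ginv gr).
Local Notation src := (src gr).
Local Notation rng := (rng gr).
Local Notation gdiv := (gdiv gr).
Local Notation fball := (fball gr l).
Implicit Types (f xi eta : G -> C) (K : G -> G -> C).
Local Notation E := (@E R G gr).
Local Notation sec_le := (sec_le gr).
Local Notation op_le := (@op_le R G gr).
Implicit Types (T S : (G -> C) -> (G -> C)).

Hypothesis hopen : open (units gr).
Local Notation one := (@one_Cc R G gr).
Local Notation Lam := (Lambda gr).
Variable X : set (G -> C).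
Hypothesis hX : operator_system (star gr) one X.
Hypothesis XCc : X `<=` Cc.
Local Notation state := (@state_space R (G -> C) one (Cc_pos gr) X).

Lemma starK f : star gr (star gr f) = f.
Proof. by apply/funext => g; rewrite /star ginvK conjcK. Qed.

Lemma star_linear (a : R[i]) f h : star gr (a *: f + h) = conjc a *: star gr f + star gr h.
Proof.
apply/funext => g; rewrite /star -[(a *: f + h) _]/(a * f (inv g) + h (inv g)).
by rewrite rmorphD rmorphM.
Qed.

Lemma star_scale (a : R[i]) f : star gr (a *: f) = conjc a *: star gr f.
Proof. by apply/funext => g; exact: rmorphM. Qed.

(* [t - phi x >= 0] and [t + phi x >= 0] for every [t > r], because [1 - x / t] and
   [1 + x / t] are squares. *)
Lemma state_selfadjoint_le (phi : X -> C) r (x : X) : state phi ->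
  star gr (val x) = val x -> op_le r (Lam (val x)) -> normc (phi x) <= r.
Proof.
move=> sphi sx hr; have [r0 _] := hr; apply/ler_addgt0Pr => e e0.
have re0 : 0 < r + e by rewrite ltr_wpDl.
have Xx : X (val x) by exact: set_mem (valP x).
have X1 : X one by case: hX.
have key (t : R) : `|t| <= (r + e)^-1 -> 0 <= - t%:C%C * phi x + 1.
  move=> ht; pose z := inX (X_lin hX (- t%:C%C) Xx X1).
  have ez : val z = - t%:C%C *: val x + one by [].
  have e1 : phi (inX X1) = 1 by have [_ h _] := sphi; exact: h.
  have := state_lin (y := inX X1) sphi ez; rewrite e1 => <-.
  have [_ _] := sphi; apply; rewrite ez addrC scaleNr.
  have Ctx : Cc (t%:C%C *: val x) by apply: (CcZ hlch hl hproper); exact: XCc.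
  have rr : 0 <= (r + e)^-1 * r < 1.
    rewrite mulr_ge0 ?invr_ge0 ?(ltW re0)//= mulrC ltr_pdivrMr// mul1r ltrDl//.
  apply: (one_sub_Cc_pos hlch het hl hproper hunif hopen Ctx _ rr).
    by rewrite star_scale sx; congr (_ *: _); exact: conjc_real.
  have := op_leZ t%:C%C hr; rewrite normc_real => h.
  apply: (@op_le_eq _ _ _ _ _ _ _ (op_le_weaken _ h)); last by rewrite ler_wpM2r.
  by move=> xi _; apply/esym/(Lambda_scale hlch hl hproper hunif); exact: XCc.
have h1 := key (r + e)^-1; have h2 := key (- (r + e)^-1).
rewrite normrN in h2; rewrite ger0_norm ?invr_ge0 ?(ltW re0)// in h1 h2.
move: (h1 (lexx _)) (h2 (lexx _)); case: (phi x) => p q.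
rewrite !lecE /= => /andP[/eqP hq hp] /andP[_ hp'].
have ri : 0 < (r + e)^-1 by rewrite invr_gt0.
(* Positivity in [R[i]] includes a vanishing imaginary part, so [phi] is real on self-adjoint
   elements. *)
have q0 : q = 0.
  have : (r + e)^-1 * q = 0 by lra.
  by move/eqP; rewrite mulf_eq0 gt_eqF//= => /eqP.
rewrite q0 expr0n addr0 sqrtr_sqr ler_norml.
have hr1 : (r + e)^-1 * (r + e) = 1 by rewrite mulVf// gt_eqF.
apply/andP; split; rewrite -(ler_pM2l ri) ?mulrN hr1; rewrite q0 in hp hp'; lra.
Qed.

(** Compatibility of [phi] with the involution is not part of being a state. So self-adjoint real
    and imaginary parts [y1], [y2] are formed inside [X], with [x = y1 + i y2]; each has norm at
    most [r], whence the factor 2. *)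
Lemma state_le (phi : X -> C) r (x : X) : state phi ->
  op_le r (Lam (val x)) -> normc (phi x) <= 2 * r.
Proof.
move=> sphi hr; have Xx : X (val x) by exact: set_mem (valP x).
have Cx := XCc Xx.
have Xs : X (star gr (val x)) by case: hX => _ _ h; exact: h.
have hs : op_le r (Lam (star gr (val x))).
  exact: (delta_star hlch het hl hproper hunif (n := 0) Cx).
have Cs := XCc Xs.
pose xs := inX Xs.
have part (b c : R[i]) : normc (b : C) = 2^-1 -> c = conjc b ->
    exists2 y : X, normc (phi y) <= r & phi y = b * phi x + c * phi xs.
  move=> nb ec; have Xc : X (c *: star gr (val x)) by exact: (X_scale hX).
  pose z := inX Xc; have ez : val z = c *: val xs by [].
  pose y := inX (X_lin hX b Xx Xc).
  have ey : val y = b *: val x + val z by [].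
  exists y; last by rewrite (state_lin sphi ey) (state_scale hX sphi ez).
  apply: state_selfadjoint_le => //.
    by rewrite ey star_linear ez star_scale starK ec conjcK addrC.
  have nc : normc (c : C) = 2^-1 by rewrite ec normc_conj.
  have := op_leD (op_leZ b hr) (op_leZ c hs).
  rewrite nb nc => h; apply: (@op_le_eq _ _ _ _ _ _ _ (op_le_weaken _ h)); last lra.
  move=> xi _; rewrite ey (Lambda_linear hlch hl hproper hunif)//; last exact: XCc.
  congr (_ + _); exact/esym/(Lambda_scale hlch hl hproper hunif).
have [||y1 n1 e1] := part (2^-1)%:C%C (2^-1)%:C%C.
- by rewrite normc_real ger0_norm// invr_ge0.
- by rewrite [RHS]conjc_real.
pose j : R[i] := Complex 0 (2^-1).
have [||y2 n2 e2] := part (- j) j.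
- by rewrite normcN /j /= expr0n add0r sqrtr_sqr ger0_norm// invr_ge0.
- by rewrite /j; apply/eqP; rewrite eq_complex /= oppr0 opprK !eqxx.
have -> : phi x = phi y1 + Complex 0 1 * phi y2.
  rewrite e1 e2; case: (phi x) => a b; case: (phi xs) => a' b'.
  by apply/eqP; rewrite eq_complex /=; apply/andP; split; apply/eqP; field.
apply: le_trans (normcD _ _) _; rewrite normcM.
have -> : normc (Complex 0 1 : C) = 1 by rewrite /= expr0n expr1n add0r sqrtr1.
lra.
Qed.

End StateBound.

(** * The operator system of Lipschitz functions and its seminorm *)

Section LipschitzAlgebra.
Context {R : realType} {G : topologicalType} (gr : groupoid G) (l : G -> R).
Hypotheses (hlch : lch_groupoid gr) (het : etale gr).
Hypotheses (hl : length_function gr l) (hproper : proper_length l).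
Hypothesis hunif : forall t, 0 <= t -> exists2 F : R, 1 <= F & fiber_card_le gr l t F.
Local Notation C := (Cplx R).
Local Notation normc := (@ComplexField.Normc.normc R).
Local Notation inv := (ginv gr).
Local Notation src := (src gr).
Local Notation rng := (rng gr).
Local Notation gdiv := (gdiv gr).
Local Notation fball := (fball gr l).
Implicit Types (f xi eta : G -> C) (K : G -> G -> C).
Local Notation E := (@E R G gr).
Local Notation sec_le := (sec_le gr).
Local Notation op_le := (@op_le R G gr).
Implicit Types (T S : (G -> C) -> (G -> C)).

Variables (d : G -> G -> R) (I : Type) (K : I -> set G).
Hypothesis hK : metric_stratification gr d K.
Local Notation one := (@one_Cc R G gr).
Local Notation Lam := (Lambda gr).
Local Notation dK := (dK gr d).
Local Notation X := (@Lipc R G gr d I K).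

Lemma units_open : open (units gr).
Proof. by have [e <-] := strat_units hK; have [_ ] := strat_open hK e. Qed.

Definition lip_le (M : R) f := forall i x y, K i x -> K i y -> normc (f x - f y) <= M * dK x y.

Lemma dK_ge0 i x y : K i x -> K i y -> 0 <= dK x y.
Proof. by have [[h _ _ _] _] := strat_metric hK i; exact: h. Qed.

Lemma LLip_leP M f : 0 <= M -> (LLip gr d K f <= M%:E)%E <-> lip_le M f.
Proof.
move=> M0; have [pos eq] : (forall i x y, K i x -> K i y -> x <> y -> 0 < dK x y) /\
    (forall i x, K i x -> dK x x = 0).
  split=> [i x y Kx Ky ne|i x Kx]; have [[h0 h1 _ _] _] := strat_metric hK i.
    by rewrite lt0r h0// andbT; apply/eqP => /(h1 x y Kx Ky).
  exact/(h1 x x Kx Kx).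
rewrite /LLip nnsup_leP//; split=> [h i x y Kx Ky|h _ [i [x [y [Kx Ky ne ->]]]]].
  have [->|ne] := pselect (x = y); first by rewrite subrr normc0 (eq i)// mulr0.
  rewrite -ler_pdivrMr ?(pos i)// -lee_fin; apply: h.
  by exists i, x, y.
by rewrite lee_fin ler_pdivrMr ?(pos i)//; exact: (h i).
Qed.

Lemma lip_le_lin (a : R[i]) f h M N : lip_le M f -> lip_le N h -> lip_le (normc a * M + N) (a *: f + h).
Proof.
move=> hf hh i x y Kx Ky.
rewrite -[(a *: f + h) x]/(a * f x + h x) -[(a *: f + h) y]/(a * f y + h y).
have -> : a * f x + h x - (a * f y + h y) = a * (f x - f y) + (h x - h y) by ring.
apply: le_trans (normcD _ _) _; rewrite normcM mulrDl -mulrA.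
by apply: lerD; [rewrite ler_wpM2l ?normc_ge0//; exact: (hf i x y)|exact: (hh i x y)].
Qed.

(** Inversion permutes the strata and swaps source and range, in which [dK] is symmetric. *)
Lemma lip_le_star f M : lip_le M f -> lip_le M (star gr f).
Proof.
move=> hf i x y Kx Ky; have [j ej] := strat_inv hK i.
rewrite /star -rmorphB normc_conj.
have -> : dK x y = dK (inv x) (inv y) by rewrite /Defs.dK !src_inv !rng_inv maxC.
by apply: (hf j); rewrite ej; [exists x|exists y].
Qed.

(** The units form a stratum, so [one] is constant on every stratum. *)
Lemma lip_le_one M : 0 <= M -> lip_le M one.
Proof.
move=> M0 i x y Kx Ky; have [e he] := strat_units hK.
suff -> : one x = one y by rewrite subrr normc0 mulr_ge0// (dK_ge0 Kx Ky).
have [ie|ne] := pselect (i = e).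
  by rewrite ie he in Kx Ky; rewrite !one_unit.
have nu z : K i z -> ~ units gr z.
  move=> Kz; rewrite -he => Kez.
  by have := strat_disjoint hK ne => h; have : (K i `&` K e) z by []; rewrite h.
by rewrite !one_nunit//; exact: nu.
Qed.

Lemma LLip_ge0 f : (0 <= LLip gr d K f)%E.
Proof. exact: nnsup_ge0. Qed.

Lemma Lipc_Cc : X `<=` Cc. Proof. by move=> f []. Qed.

Lemma LipcP f : X f <-> Cc f /\ exists2 M, 0 <= M & lip_le M f.
Proof.
split=> -[Cf h]; split=> //.
  exists (fine (LLip gr d K f)); first by rewrite fine_ge0// LLip_ge0.
  by apply/LLip_leP; rewrite ?fine_ge0 ?LLip_ge0// fineK// ge0_fin_numE// LLip_ge0.
have [M M0 hM] := h; apply: (@le_lt_trans _ _ M%:E); last exact: ltry.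
exact/LLip_leP.
Qed.

Lemma Lipc_operator_system : operator_system (star gr) one X.
Proof.
split.
- apply/LipcP; split; last by exists 0 => //; exact: lip_le_one.
  exact: (one_in_Cc hlch hl hproper units_open).
- move=> a f h /LipcP[Cf [M M0 hM]] /LipcP[Ch [N N0 hN]]; apply/LipcP; split.
    by apply: (CcD hlch hl hproper) => //; exact: (CcZ hlch hl hproper).
  exists (normc a * M + N); first by rewrite addr_ge0// mulr_ge0// normc_ge0.
  exact: lip_le_lin.
- move=> f /LipcP[Cf [M M0 hM]]; apply/LipcP; split; first exact: (star_Cc hlch hl hproper).
  by exists M => //; exact: lip_le_star.
Qed.

Variable n : nat.
Hypothesis n0 : (0 < n)%N.
Local Notation L := (Ltotal gr d l K n).

Lemma L_leP f M : Cc f -> 0 <= M ->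
  (L f <= M%:E)%E <-> op_le M (delta gr l n f) /\ lip_le M f.
Proof.
move=> Cf M0; rewrite /Ltotal ge_max; split.
  by move=> /andP[/(Ll_leP hlch het hl hproper hunif n Cf M0) h1 /LLip_leP h2]; split=> //; exact: h2.
by move=> [h1 h2]; apply/andP; split; [exact/Ll_leP|exact/LLip_leP].
Qed.

Lemma L_ge0 f : (0 <= L f)%E.
Proof. by rewrite /Ltotal le_max LLip_ge0 orbT. Qed.

Lemma L_fin f : X f -> L f \is a fin_num.
Proof.
move=> /LipcP[Cf [M M0 hM]]; have [A hA] := delta_op_le hlch hl hproper hunif n Cf.
have A0 : 0 <= A by case: hA.
rewrite ge0_fin_numE ?L_ge0//; apply: (@le_lt_trans _ _ (A + M)%:E); last exact: ltry.
apply/L_leP => //; first exact: addr_ge0.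
split; first by apply: op_le_weaken hA; rewrite lerDl.
move=> i x y Kx Ky; apply: le_trans (hM i x y Kx Ky) _.
by rewrite ler_wpM2r ?(dK_ge0 Kx Ky)// lerDr.
Qed.

Lemma L_fine f : X f -> exists2 M, 0 <= M & L f = M%:E /\ op_le M (delta gr l n f) /\ lip_le M f.
Proof.
move=> Xf; exists (fine (L f)); first by rewrite fine_ge0// L_ge0.
split; first by rewrite fineK// L_fin.
by apply/L_leP; [exact: Lipc_Cc|rewrite fine_ge0// L_ge0|rewrite fineK// L_fin].
Qed.

Lemma L_lin_le (a : R[i]) f h M N : X f -> X h -> L f = M%:E -> L h = N%:E ->
  (L (a *: f + h)%R <= (normc a * M + N)%:E)%E.
Proof.
move=> Xf Xh; have [M' M0 [-> [h1 h2]]] := L_fine Xf; have [N' N0 [-> [h3 h4]]] := L_fine Xh.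
move=> [<-] [<-]; have [_ Xl _] := Lipc_operator_system.
apply/L_leP; first by apply: Lipc_Cc; exact: Xl.
  by rewrite addr_ge0// mulr_ge0// normc_ge0.
split; last exact: lip_le_lin.
apply: (op_le_eq _ (op_leD (op_leZ a h1) h3)) => xi _.
by rewrite (delta_linear hlch hl hproper hunif)//; exact: Lipc_Cc.
Qed.

Lemma L_one : L one = 0%E.
Proof.
apply/eqP; rewrite eq_le L_ge0 andbT; apply/L_leP => //.
  exact: (one_in_Cc hlch hl hproper units_open).
split; last exact: lip_le_one.
split=> // xi N _ hN; rewrite mul0r (delta_one hlch hl hproper hunif units_open)//.
by split=> // u s _ _; rewrite big1 ?expr0n// => m _; rewrite normc0 expr0n.
Qed.

(** Only upper bounds are proved directly. Equality in homogeneity follows by applying the bound to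
    [a^-1], and equality for the involution by applying it twice. *)
Lemma L_star_seminorm : star_seminorm (star gr) one X L.
Proof.
have [X1 Xl Xs] := Lipc_operator_system.
have hX := Lipc_operator_system.
have L0 : L 0 = 0%E.
  apply/eqP; rewrite eq_le L_ge0 andbT.
  have := @L_lin_le (-1) one one 0 0 X1 X1 L_one L_one.
  by rewrite mulr0 add0r scaleN1r addNr.
have Zle (a : R[i]) f M : X f -> L f = M%:E -> (L (a *: f)%R <= (normc a * M)%:E)%E.
  move=> Xf hf; have := @L_lin_le a f 0 M 0 Xf (X_zero hX) hf L0.
  by rewrite !addr0.
split.
- by move=> f Xf; rewrite L_ge0 L_fin.
- move=> f h Xf Xh; have [M M0 [hf _]] := L_fine Xf; have [N N0 [hh _]] := L_fine Xh.
  by have := @L_lin_le 1 f h M N Xf Xh hf hh; rewrite normc1 mul1r scale1r hf hh.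
- move=> a f Xf; have [M M0 [hf _]] := L_fine Xf.
  have [->|a0] := eqVneq a 0; first by rewrite scale0r L0 normc0 mul0e.
  have Xaf : X (a *: f) by exact: (X_scale hX).
  have [N N0 [hN _]] := L_fine Xaf.
  apply/eqP; rewrite eq_le hf Zle//= hN -EFinM lee_fin.
  have na : 0 < normc (a : C) by rewrite lt0r normc_ge0 andbT normc_eq0.
  have := Zle a^-1 _ _ Xaf hN; rewrite scalerA mulVf// scale1r hf lee_fin.
  have -> : normc (a^-1 : R[i]) = (normc (a : C))^-1 by exact: ComplexField.Normc.normcV.
  by rewrite ler_pdivlMl.
- suff le f : X f -> (L (star gr f) <= L f)%E.
    move=> f Xf; apply/eqP; rewrite eq_le le//= -{1}(starK gr f) le//; exact: Xs.
  move=> Xf; have [M M0 [-> [h1 h2]]] := L_fine Xf; apply/L_leP => //.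
    by apply: Lipc_Cc; exact: Xs.
  split; last exact: lip_le_star.
  by apply: (delta_star hlch het hl hproper hunif) => //; exact: Lipc_Cc.
- exact: L_one.
Qed.

End LipschitzAlgebra.

(* Pigeonhole: sort the functions by the cells of a square grid in which their
   values at the points of [P] lie. *)
Lemma finite_net (R : realType) (T : choiceType) (U : eqType) (S : set T) (P : seq U)
    (ev : T -> U -> Cplx R) (B e : R) : 0 < e ->
  (forall f p, S f -> p \in P -> ComplexField.Normc.normc (ev f p) <= B) ->
  exists H : seq T, (forall h, h \in H -> S h) /\ forall f, S f -> exists2 h, h \in H &
    forall p, p \in P -> ComplexField.Normc.normc (ev f p - ev h p : R[i]) <= e.
Proof.
move=> e0 hB.
(* For negative [B] an element of [S] forces [P] to be empty, and then that one element is a net. *)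
have [B0|Bneg] := leP 0 B; last first.
  have [[f Sf]|nS] := pselect (exists f, S f); last first.
    by exists [::]; split=> // f Sf; exfalso; apply: nS; exists f.
  exists [:: f]; split=> [h|h Sh]; first by rewrite inE => /eqP ->.
  exists f => [|p pP]; first by rewrite inE.
  by have := hB f p Sf pP; have := normc_ge0 (ev f p); lra.
pose q := e / 2; have q0 : 0 < q by rewrite divr_gt0.
pose cell (x : R) := Num.truncn ((x + B) / q).
have cellP (x y : R) : `|x| <= B -> `|y| <= B -> cell x = cell y -> `|x - y| <= q.
  rewrite !ler_norml => /andP[x1 x2] /andP[y1 y2] exy.
  have hx : 0 <= (x + B) / q by rewrite divr_ge0 ?(ltW q0)//; lra.
  have hy : 0 <= (y + B) / q by rewrite divr_ge0 ?(ltW q0)//; lra.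
  have := truncn_itv hx; have := truncn_itv hy; rewrite -/(cell x) -/(cell y) exy -natr1.
  move=> /andP[a1 a2] /andP[a3 a4].
  rewrite ler_pdivlMr// in a1; rewrite ler_pdivlMr// in a3.
  rewrite ltr_pdivrMr// in a2; rewrite ltr_pdivrMr// in a4.
  rewrite !mulrDl !mul1r in a2 a4; move: (_ * q) a1 a2 a3 a4 => k a1 a2 a3 a4.
  by apply/andP; split; lra.
pose m := Num.truncn (2 * B / q).
have cell_le x : `|x| <= B -> (cell x < m.+1)%N.
  rewrite ler_norml => /andP[x1 x2]; rewrite ltnS; apply: le_truncn.
  by rewrite ler_pM2r ?invr_gt0//; lra.
pose cls f : {ffun 'I_(size P) -> 'I_m.+1 * 'I_m.+1} := [ffun i =>
  (inord (cell (complex.Re (ev f (tnth (in_tuple P) i)))),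
   inord (cell (complex.Im (ev f (tnth (in_tuple P) i)))))].
(* A cell may be empty, so its representative is a list of at most one element. *)
have rep c : exists o : seq T, (forall h, h \in o -> S h) /\
    forall f, S f -> cls f = c -> exists2 h, h \in o & cls h = c.
  have [[f [Sf ef]]|nf] := pselect (exists f, S f /\ cls f = c).
    exists [:: f]; split=> [h|h _ _]; first by rewrite inE => /eqP ->.
    by exists f => //; rewrite inE.
  by exists [::]; split=> // f Sf ef; exfalso; apply: nf; exists f.
have [rp hrp] := choice rep.
exists (flatten [seq rp c | c <- enum {: {ffun 'I_(size P) -> 'I_m.+1 * 'I_m.+1}}]); split.
  by move=> h /flatten_mapP[c _]; have [hh _] := hrp c; exact: hh.
move=> f Sf; have [hS hc] := hrp (cls f); have [h hin ec] := hc f Sf erefl.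
exists h; first by apply/flatten_mapP; exists (cls f) => //; rewrite mem_enum.
move=> p pP; have Sh := hS _ hin.
have idx : (index p P < size P)%N by rewrite index_mem.
have := congr1 (fun g : {ffun 'I_(size P) -> 'I_m.+1 * 'I_m.+1} => g (Ordinal idx)) ec.
rewrite /= !ffunE (tnth_nth p) /= nth_index// => -[].
have nf := hB f p Sf pP; have nh := hB h p Sh pP.
have lef : `|complex.Re (ev f p)| <= B by exact: le_trans (normc_ge_Re _) nf.
have lef' : `|complex.Im (ev f p)| <= B by exact: le_trans (normc_ge_Im _) nf.
have leh : `|complex.Re (ev h p)| <= B by exact: le_trans (normc_ge_Re _) nh.
have leh' : `|complex.Im (ev h p)| <= B by exact: le_trans (normc_ge_Im _) nh.
move=> /(congr1 val) /=; rewrite !inordK ?cell_le// => e1.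
move=> /(congr1 val) /=; rewrite !inordK ?cell_le// => e2.
have d1 := cellP _ _ lef leh (esym e1); have d2 := cellP _ _ lef' leh' (esym e2).
apply: le_trans (normc_le_ReIm _) _; rewrite !raddfB /= [e]splitr.
exact: lerD.
Qed.

Lemma totally_bounded_bounded (R : realType) (T : choiceType) (A : set T) (d : T -> T -> R) x0 :
  metric_on A d -> totally_bounded_on A d -> A x0 ->
  exists D, forall x, A x -> d x0 x <= D.
Proof.
move=> [d0 _ _ dt] tb Ax0; have [F [fF FA cF]] := tb 1 ltr01.
exists (\sum_(z <- fset_set F) `|d x0 z| + 1) => x Ax.
have [z Fz /= zx] := cF x Ax.
apply: le_trans (dt x0 z x Ax0 (FA _ Fz) Ax) _; apply: lerD; last exact: ltW.
have zF : z \in fset_set F by rewrite in_fset_set// inE.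
rewrite (big_rem z)//=; apply: le_trans (ler_norm _) _.
by rewrite lerDl sumr_ge0.
Qed.

(** * Comparison of the weights [(1 + l) ^ s] and [l ^ n] *)

Section Weights.
Context {R : realType}.

Lemma powR_double (x s : R) : (1 + x) `^ (2 * s) = ((1 + x) `^ s) ^+ 2.
Proof. by rewrite [2 * s]mulrC powRrM powR_mulrn ?powR_ge0. Qed.

(** As [x >= 1], the left side is at most [(2 x) ^ s]; then [x ^ s = x ^ n / x ^ (n - s)] and
    [x >= N]. *)
Lemma powR_tail (s N x : R) (n : nat) : 0 <= s -> s <= n%:R -> 1 <= N -> N <= x ->
  (1 + x) `^ s <= 2 `^ s / N `^ (n%:R - s) * x ^+ n.
Proof.
move=> s0 sn N1 Nx; have N0 : 0 < N by exact: lt_le_trans N1.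
have x0 : 0 < x by exact: lt_le_trans Nx.
apply: (@le_trans _ _ (2 `^ s * x `^ s)).
  rewrite -powRM ?(ltW x0)//; apply: ge0_ler_powR; rewrite ?nnegrE//; lra.
rewrite -mulrA ler_wpM2l ?powR_ge0// -powR_mulrn ?(ltW x0)//.
rewrite [X in _ <= _ * x `^ X](_ : _ = s + (n%:R - s)); last by ring.
rewrite powRD; last by apply/implyP => _; rewrite gt_eqF.
rewrite mulrCA ler_peMr ?powR_ge0//.
rewrite mulrC ler_pdivlMr ?powR_gt0// mul1r.
by apply: ge0_ler_powR => //; rewrite ?nnegrE ?subr_ge0// ltW.
Qed.

Lemma powR_tail_small (s e : R) (n : nat) : s < n%:R -> 0 < e ->
  exists2 N : R, 1 <= N & 2 `^ s / N `^ (n%:R - s) <= e.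
Proof.
move=> sn e0; pose a := n%:R - s; have a0 : 0 < a by rewrite subr_gt0.
(* [N] is the root for which [N ^ (n - s) = t]; the maximum with 1 gives [N >= 1]. *)
pose t := Num.max 1 (2 `^ s / e).
have t1 : 1 <= t by rewrite le_max lexx.
exists (t `^ a^-1).
  apply: (@le_trans _ _ (1 `^ a^-1)); first by rewrite powR1.
  by apply: ge0_ler_powR => //; rewrite ?invr_ge0 ?(ltW a0) ?nnegrE//; exact: le_trans t1.
rewrite -powRrM mulVf ?gt_eqF// powRr1; last exact: le_trans t1.
rewrite ler_pdivrMr ?(lt_le_trans _ t1)// mulrC -ler_pdivrMr//.
by rewrite le_max lexx orbT.
Qed.

End Weights.

(** * Bounding the weighted norm by the commutator *)

Section RapidDecay.
Context {R : realType} {G : topologicalType} (gr : groupoid G) (l : G -> R).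
Hypotheses (hlch : lch_groupoid gr) (het : etale gr).
Hypotheses (hl : length_function gr l) (hproper : proper_length l).
Hypothesis hunif : forall t, 0 <= t -> exists2 F : R, 1 <= F & fiber_card_le gr l t F.
Local Notation C := (Cplx R).
Local Notation normc := (@ComplexField.Normc.normc R).
Local Notation inv := (ginv gr).
Local Notation src := (src gr).
Local Notation rng := (rng gr).
Local Notation gdiv := (gdiv gr).
Local Notation fball := (fball gr l).
Implicit Types (f xi eta : G -> C) (K : G -> G -> C).
Local Notation E := (@E R G gr).
Local Notation sec_le := (sec_le gr).
Local Notation op_le := (@op_le R G gr).
Implicit Types (T S : (G -> C) -> (G -> C)).

Local Notation one := (@one_Cc R G gr).
Local Notation Lam := (Lambda gr).
Local Notation weight s m := ((1 + l m) `^ (2 * s)).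

(** Inversion maps range fibers to source fibers and preserves [l], so only source fibers have to be
    estimated, for [w] and for its involution. *)
Lemma norm2_le M s w : 0 <= M ->
  (forall u (S : seq G), uniq S -> (forall m, m \in S -> src m = u) ->
    \sum_(m <- S) normc (w m) ^+ 2 * weight s m <= M ^+ 2) ->
  (forall u (S : seq G), uniq S -> (forall m, m \in S -> src m = u) ->
    \sum_(m <- S) normc (star gr w m) ^+ 2 * weight s m <= M ^+ 2) ->
  (norm2 gr l s w <= M%:E)%E.
Proof.
move=> M0 h1 h2; rewrite /norm2 ge_max; apply/andP; split; apply/nnsup_leP => // _ [u uu <-].
  apply/(sqrte_esum_leP _ M0) => [m|S uS hS]; first by rewrite mulr_ge0 ?sqr_ge0// powR_ge0.
  exact: (h1 u).
apply/(sqrte_esum_leP _ M0) => [m|S uS hS]; first by rewrite mulr_ge0 ?sqr_ge0// powR_ge0.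
have := h2 u [seq inv m | m <- S]; rewrite big_map map_inj_uniq; last exact: ginv_inj.
have -> : \sum_(m <- S) normc (star gr w (inv m)) ^+ 2 * weight s (inv m) =
    \sum_(m <- S) normc (w m) ^+ 2 * weight s m.
  by apply: eq_bigr => m _; rewrite /star ginvK normc_conj (length_inv hl).
by apply=> // _ /mapP[m mS ->]; rewrite src_inv; exact: hS.
Qed.

Lemma norm2_ge M s w : 0 <= M -> (norm2 gr l s w <= M%:E)%E ->
  (forall u (S : seq G), uniq S -> (forall m, m \in S -> src m = u) ->
    \sum_(m <- S) normc (w m) ^+ 2 * weight s m <= M ^+ 2) /\
  (forall u (S : seq G), uniq S -> (forall m, m \in S -> rng m = u) ->
    \sum_(m <- S) normc (w m) ^+ 2 * weight s m <= M ^+ 2).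
Proof.
move=> M0; rewrite /norm2 ge_max => /andP[/(nnsup_leP _ M0) h1 /(nnsup_leP _ M0) h2].
have pos (m : G) : 0 <= normc (w m) ^+ 2 * weight s m.
  by rewrite mulr_ge0 ?sqr_ge0// powR_ge0.
split=> u [|m0 S] uS hS; try by rewrite big_nil sqr_ge0.
  apply: (sqrte_esum_leP (fiber_src gr u) M0 pos).1 => //; apply: h1; exists u => //.
  by rewrite -(hS m0 (mem_head _ _)); exact: units_src.
apply: (sqrte_esum_leP (fiber_rng gr u) M0 pos).1 => //; apply: h2; exists u => //.
by rewrite -(hS m0 (mem_head _ _)); exact: units_rng.
Qed.

Hypothesis hopen : open (units gr).

(* [delta n w] maps the unit vector [one] to [l ^ n * w]. *)
Lemma sum_length_le n w B u (S : seq G) : Cc w -> op_le B (delta gr l n w) -> uniq S ->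
  (forall m, m \in S -> src m = u) ->
  \sum_(m <- S) (normc (w m) * l m ^+ n) ^+ 2 <= B ^+ 2.
Proof.
move=> Cw [B0 hB] uS hS.
have := hB one 1 (Cc_E gr (one_in_Cc hlch hl hproper hopen)) (@sec_le_one R G gr).
rewrite mulr1 => -[_ /(_ u S uS hS)]; apply: le_trans.
apply: ler_sum => m _; rewrite (delta_at_one hlch hl hproper hunif)//.
by rewrite normcM normcX normc_real ger0_norm ?(length_ge0 hl)// mulrC.
Qed.

Lemma pointwise_length_le n w B g : Cc w -> op_le B (delta gr l n w) ->
  normc (w g) * l g ^+ n <= B.
Proof.
move=> Cw hB; have := sum_length_le (u := src g) (S := [:: g]) Cw hB.
rewrite big_seq1 => h; have {}h : (normc (w g) * l g ^+ n) ^+ 2 <= B ^+ 2.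
  by apply: h => // m; rewrite inE => /eqP ->.
rewrite -(ler_pXn2r (n := 2))// ?nnegrE; last by case: hB.
by rewrite mulr_ge0 ?normc_ge0// exprn_ge0// (length_ge0 hl).
Qed.

(* Inside the ball of radius [N] use the uniform bound on [w], outside it use
   that [(1 + l) ^ s] is small compared to [l ^ n]. *)
Lemma norm2_tail (s : R) (n : nat) w (B eta N F : R) : Cc w -> op_le B (delta gr l n w) ->
  0 <= s -> s <= n%:R -> 1 <= N -> 1 <= F -> fiber_card_le gr l N F -> 0 <= eta ->
  (forall g, l g <= N -> normc (w g) <= eta) ->
  (norm2 gr l s w <= (eta * (1 + N) `^ s * F + 2 `^ s / N `^ (n%:R - s) * B)%:E)%E.
Proof.
move=> Cw hB s0 sn N1 F1 hF eta0 hw; have B0 : 0 <= B by case: hB.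
set a := eta * _ * F; set tau := _ / _.
have tau0 : 0 <= tau by rewrite divr_ge0 ?powR_ge0.
have F0 : 0 <= F by exact: le_trans F1.
have a0 : 0 <= a by rewrite !mulr_ge0 ?powR_ge0.
have tB0 : 0 <= tau * B by exact: mulr_ge0.
suff src_bound f u (S : seq G) : Cc f -> op_le B (delta gr l n f) ->
    (forall g, l g <= N -> normc (f g) <= eta) -> uniq S ->
    (forall m, m \in S -> src m = u) ->
    \sum_(m <- S) normc (f m) ^+ 2 * weight s m <= (a + tau * B) ^+ 2.
  apply: norm2_le; first exact: addr_ge0.
    by move=> u S uS hS; exact: (src_bound w u S).
  move=> u S uS hS; apply: (src_bound (star gr w) u S) => //.
  - exact: (star_Cc hlch hl hproper).
  - exact: (delta_star hlch het hl hproper hunif).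
  by move=> g lg; rewrite /star normc_conj; apply: hw; rewrite (length_inv hl).
move=> Cf hf hfw; case: S => [|m0 S] uS hS; first by rewrite big_nil sqr_ge0.
have uu : units gr u by rewrite -(hS m0 (mem_head _ _)); exact: units_src.
set S' := m0 :: S in uS hS *.
rewrite (bigID (fun m => l m <= N)) /=.
apply: (@le_trans _ _ (a ^+ 2 + (tau * B) ^+ 2)); last by nra.
apply: lerD.
  rewrite -big_filter; set T := [seq m <- S' | l m <= N].
  apply: (@le_trans _ _ (\sum_(m <- T) (eta * (1 + N) `^ s) ^+ 2)).
    rewrite !big_seq; apply: ler_sum => m; rewrite mem_filter => /andP[lm _].
    rewrite exprMn powR_double; apply: ler_pM; rewrite ?sqr_ge0//.
      by rewrite lerXn2r ?nnegrE ?normc_ge0//; exact: hfw.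
    rewrite lerXn2r ?nnegrE ?powR_ge0//; apply: ge0_ler_powR => //; rewrite ?nnegrE ?lerD2l//.
      by rewrite addr_ge0// (length_ge0 hl).
    by rewrite addr_ge0//; exact: le_trans N1.
  rewrite big_const_seq iter_addr_0 count_predT -mulr_natr /a exprMn.
  rewrite [leRHS]exprMn -exprMn ler_wpM2l ?sqr_ge0//.
  apply: (@le_trans _ _ F); last by rewrite expr2 ler_peMr.
  apply: (size_fball_le hl hunif hF uu); first exact: filter_uniq.
  by move=> m; rewrite mem_filter => /andP[lm /hS].
rewrite -big_filter; set T := [seq m <- S' | ~~ (l m <= N)].
apply: (@le_trans _ _ (\sum_(m <- T) tau ^+ 2 * (normc (f m) * l m ^+ n) ^+ 2)).
  rewrite !big_seq; apply: ler_sum => m; rewrite mem_filter -ltNge => /andP[/ltW lm _].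
  rewrite -exprMn mulrCA exprMn powR_double ler_wpM2l ?sqr_ge0//.
  rewrite lerXn2r ?nnegrE ?powR_ge0//.
    by rewrite mulr_ge0// exprn_ge0// (length_ge0 hl).
  exact: powR_tail.
rewrite -mulr_sumr [leRHS]exprMn ler_wpM2l ?sqr_ge0//.
apply: (sum_length_le (u := u) Cf hf); first exact: filter_uniq.
by move=> m; rewrite mem_filter => /andP[_ /hS].
Qed.

Lemma rapid_decay_op_le c s w M : 0 < c -> rapid_decay gr l c s -> Cc w -> 0 <= M ->
  (norm2 gr l s w <= M%:E)%E -> op_le (c * M) (Lam w).
Proof.
move=> c0 hrd Cw M0 hM.
apply/(opnorm_leP hlch hl hproper); first by move=> a xi _; exact: (delta_Z hlch hl hproper hunif 0).
  by rewrite mulr_ge0// ltW.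
apply: le_trans (hrd w Cw) _; rewrite EFinM.
by apply: lee_wpmul2l => //; rewrite lee_fin ltW.
Qed.

End RapidDecay.

(** * Rapid decay gives a compact quantum metric space *)

Section RapidDecayMetric.
Context {R : realType} {G : topologicalType} (gr : groupoid G) (l : G -> R).
Hypotheses (hlch : lch_groupoid gr) (het : etale gr).
Hypotheses (hl : length_function gr l) (hproper : proper_length l).
Hypothesis hunif : forall t, 0 <= t -> exists2 F : R, 1 <= F & fiber_card_le gr l t F.
Local Notation C := (Cplx R).
Local Notation normc := (@ComplexField.Normc.normc R).
Local Notation inv := (ginv gr).
Local Notation src := (src gr).
Local Notation rng := (rng gr).
Local Notation gdiv := (gdiv gr).
Local Notation fball := (fball gr l).
Implicit Types (f xi eta : G -> C) (K : G -> G -> C).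
Local Notation E := (@E R G gr).
Local Notation sec_le := (sec_le gr).
Local Notation op_le := (@op_le R G gr).
Implicit Types (T S : (G -> C) -> (G -> C)).

Hypothesis hgap : forall t, range l t ->
  exists2 del : R, 0 < del & `[t, t + del[ `&` range l = [set t].
Variables (d : G -> G -> R) (I : Type) (K : I -> set G).
Hypothesis hK : metric_stratification gr d K.
Local Notation one := (@one_Cc R G gr).
Local Notation Lam := (Lambda gr).
Local Notation dK := (dK gr d).
Local Notation X := (@Lipc R G gr d I K).
Local Notation lip_le := (lip_le gr d K).

(** The gap hypothesis at 0, which is a value of [l] unless the groupoid is empty. *)
Lemma length_gap : exists2 del : R, 0 < del & forall g, ~ units gr g -> del <= l g.
Proof.
have [[g0 _]|nG] := pselect (exists g : G, True); last first.
  by exists 1 => // g; exfalso; apply: nG; exists g.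
have r0 : range l 0 by exists (src g0) => //; apply/(length_eq0 hl); exact: units_src.
have [del del0 h] := hgap r0; exists del => // g ng.
rewrite leNgt; apply/negP => lt; apply: ng; apply/(length_eq0 hl).
have : [set 0] (l g); last by [].
rewrite -h; split; last by exists g.
by rewrite /= in_itv /= add0r lt (length_ge0 hl).
Qed.

(** The strata form an open cover of the compact ball, and each of the finitely many that suffice is
    totally bounded. *)
Lemma ball_net (N e : R) : 0 <= N -> 0 < e -> exists P : seq G, forall g, l g <= N ->
  exists i p, [/\ p \in P, K i g, K i p & dK p g < e].
Proof.
move=> N0 e0.
have hi g : exists i, K i g.
  have : [set: G] g by []; by rewrite -(strat_cover hK) => -[i _ Kg]; exists i.
have [ind hind] := choice hi.
have tb i : exists F : seq G, (forall p, p \in F -> K i p) /\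
    forall g, K i g -> exists2 p, p \in F & dK p g < e.
  have [_ /(_ e e0) [F [fF FK cF]]] := strat_metric hK i.
  exists (fset_set F); split=> [p|g Kg].
    by rewrite in_fset_set// inE => /FK.
  by have [p Fp pg] := cF g Kg; exists p => //; rewrite in_fset_set// inE.
have [F hF] := choice tb.
have TF := @summability.totally_filter G.
(* Compactness in filter form: along the directed family of finite sets of points, the strata
   through these points eventually cover the ball. *)
have [D _ cD] : \forall D \near @summability.totally G,
    lball l N `<=` [set g | exists2 h, h \in D & K (ind h) g].
  have /compact_near_coveringP := hproper N0; apply=> g _ /=.
  exists (K (ind g), [set D : {fset G} | g \in D]) => /=.
    split; last by exists [fset g]%fset => // D /fsubsetP; apply; rewrite inE.
    apply: open_nbhs_nbhs; split=> //; by have [] := strat_open hK (ind g).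
  by move=> [h D] /= [Kh gD]; exists g.
have {}cD := cD D (fsubset_refl D).
exists (flatten [seq F (ind h) | h <- D]) => g lg.
have [h hD Kg] := cD g lg; have [FK cF] := hF (ind h).
have [p pF pg] := cF g Kg; exists (ind h), p; split => //; last exact: FK.
by apply/flatten_mapP; exists h.
Qed.

Theorem rapid_decay_cqms (c s : R) (n : nat) : 0 < c -> 0 < s -> s < n%:R ->
  rapid_decay gr l c s ->
  compact_quantum_metric_space (star gr) one (Cc_pos gr) X (Ltotal gr d l K n).
Proof.
move=> c0 s0 sn hrd.
have n0 : (0 < n)%N by rewrite -(ltr_nat R); exact: lt_trans sn.
have ho := units_open hK.
have hX := Lipc_operator_system hlch hl hproper hK.
have XCc : X `<=` Cc by exact: Lipc_Cc.
have hL := L_star_seminorm hlch het hl hproper hunif hK n0.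
apply: (cqms_of_net hX hL) => e e0.
have [[x0 ux0]|nu] := pselect (exists x0, units gr x0); last first.
  exists [:: inX (X_zero hX)] => x _; exists (inX (X_zero hX)); first by rewrite inE.
  move=> phi psi _ _; suff -> : x = inX (X_zero hX) by rewrite subrr normc0 ltW.
  apply: val_inj; apply/funext => g; exfalso; apply: nu; exists (src g).
  exact: units_src.
have [i0 hi0] := strat_units hK.
have [D hD] : exists D, forall x, units gr x -> dK x0 x <= D.
  have [] := strat_metric hK i0; rewrite hi0 => hm ht.
  exact: totally_bounded_bounded hm ht ux0.
have [del del0 hdel] := length_gap.
(* Adding a multiple of [one] changes neither [delta n], as [n > 0], nor differences within a
   stratum; this multiple makes the value at [x0] vanish. *)
pose nrm (x : X) : G -> C := (- (val x x0)) *: one + val x.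
have X1 : X one by case: hX.
have Xx (x : X) : X (val x) by exact: set_mem (valP x).
have Xnrm x : X (nrm x) by exact: (X_lin hX).
have C1 : Cc one by exact: XCc.
pose S : set X := [set x | (Ltotal gr d l K n (val x) <= 1)%E].
have hnrm x : S x -> op_le 1 (delta gr l n (nrm x)) /\ lip_le 1 (nrm x).
  move=> /(L_leP hlch het hl hproper hunif hK n (XCc _ (Xx x)) ler01) [h1 h2]; split.
    apply: (op_le_eq _ h1) => xi _.
    rewrite (delta_linear hlch hl hproper hunif)//; last exact: XCc.
    by rewrite (delta_one hlch hl hproper hunif ho)// scaler0 add0r.
  have := lip_le_lin (- val x x0) (lip_le_one hK (lexx 0)) h2.
  by rewrite mulr0 add0r.
have nrm0 x : nrm x x0 = 0.
  by rewrite -[LHS]/(- val x x0 * one x0 + val x x0) one_unit// mulr1 addNr.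
pose B := Num.max D (del ^- n).
have hB x p : S x -> normc (nrm x p) <= B.
  move=> /hnrm [h1 h2]; rewrite le_max; have [up|np] := pselect (units gr p).
    apply/orP; left; apply: le_trans (hD p up).
    have Kp : K i0 p by rewrite hi0.
    have K0 : K i0 x0 by rewrite hi0.
    by have := h2 i0 x0 p K0 Kp; rewrite nrm0 sub0r normcN mul1r.
  apply/orP; right; have := pointwise_length_le hlch hl hproper hunif ho p (XCc _ (Xnrm x)) h1.
  have lp := hdel p np; have dn : 0 < del ^+ n by rewrite exprn_gt0.
  move=> h; rewrite -[leRHS]mul1r ler_pdivlMr//; apply: le_trans h.
  by rewrite ler_wpM2l ?normc_ge0// lerXn2r// ?nnegrE ?(length_ge0 hl)// ltW.
(* [w] below is a difference of two elements with commutator bound 1, whence the bound 2 in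
   [norm2_tail]. The constants [e1] and [eta] make the outer and inner parts of [M] at most
   [e / (8 * c)] each, so [c * M <= e / 4]; the factor 2 of [state_le], for two states, gives
   [e]. *)
pose e1 := e / (16 * c).
have e10 : 0 < e1 by rewrite divr_gt0// mulr_gt0.
have [N N1 hN] := powR_tail_small sn e10.
have N0 : 0 <= N by exact: le_trans N1.
have [F F1 hF] := hunif N0.
pose A := (1 + N) `^ s * F.
have A0 : 0 < A.
  by apply: mulr_gt0; [apply: powR_gt0; lra|exact: lt_le_trans F1].
pose eta := e / (8 * c * A).
have eta0 : 0 < eta.
  by apply: divr_gt0 => //; apply: mulr_gt0 => //; exact: mulr_gt0.
(* One third each for moving [nrm x] from [g] to [p], for the net at [p], and for moving [nrm h]
   back to [g]. *)
have eta3 : 0 < eta / 3 by rewrite divr_gt0.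
have [P hP] := ball_net N0 eta3.
have [H [HS hH]] := finite_net (S := S) (P := P) (ev := nrm) (B := B) eta3 (fun x p Sx _ => hB x p Sx).
exists H => x Sx; have [h hin hclose] := hH x Sx; have Sh := HS h hin.
exists h => // phi psi sphi spsi.
have Xw : X ((-1) *: nrm h + nrm x) by exact: (X_lin hX).
pose w := inX Xw; have ew : val w = (-1) *: nrm h + nrm x by [].
have wE g : val w g = nrm x g - nrm h g.
  by rewrite ew -[LHS]/(-1 * nrm h g + nrm x g) mulN1r addrC.
have [hx1 hx2] := hnrm x Sx; have [hh1 hh2] := hnrm h Sh.
have hw : op_le 2 (delta gr l n (val w)).
  apply: (op_le_eq _ (op_leB hx1 hh1)) => xi _.
  rewrite ew [RHS](delta_linear hlch hl hproper hunif); [|exact: XCc|exact: XCc].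
  by rewrite scaleN1r [RHS]addrC.
have wsmall g : l g <= N -> normc (val w g) <= eta.
  move=> lg; have [i [p [pP Kg Kp pg]]] := hP g lg; rewrite wE.
  have h1 := hx2 i p g Kp Kg; have h2 := hh2 i p g Kp Kg; have h3 := hclose p pP.
  rewrite mul1r normcB in h1; rewrite mul1r in h2.
  have h4 := normc_dist (nrm x g) (nrm x p) (nrm h g).
  have h5 := normc_dist (nrm x p) (nrm h p) (nrm h g).
  lra.
have := norm2_tail hlch het hl hproper hunif ho (XCc _ Xw) hw (ltW s0) (ltW sn) N1 F1 hF
  (ltW eta0) wsmall.
set M := eta * _ * F + _ => hM.
have M0 : 0 <= M.
  have F0 : 0 <= F by exact: le_trans F1.
  by rewrite addr_ge0//; apply: mulr_ge0 => //; rewrite ?divr_ge0 ?powR_ge0// mulr_ge0 ?powR_ge0 ?ltW.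
have hcM : c * M <= e / 4.
  have h1 : c * (eta * (1 + N) `^ s * F) = e / 8.
    by rewrite -(mulrA eta) -/A /eta; field; rewrite !gt_eqF.
  have h2 : c * (e1 * 2) = e / 8 by rewrite /e1; field; rewrite gt_eqF.
  have h3 : c * (2 `^ s / N `^ (n%:R - s) * 2) <= c * (e1 * 2).
    by rewrite ler_wpM2l ?(ltW c0)// ler_wpM2r.
  rewrite /M mulrDr; lra.
have hop := rapid_decay_op_le hlch hl hproper hunif c0 hrd (XCc _ Xw) M0 hM.
have hphi := state_le hlch het hl hproper hunif ho hX XCc (x := w) sphi hop.
have hpsi := state_le hlch het hl hproper hunif ho hX XCc (x := w) spsi hop.
(* The scalars removed by [nrm] contribute the same constant to every state, so they cancel between
   [phi] and [psi]. *)
have sval (f : X -> C) : @state_space R (G -> C) one (Cc_pos gr) X f ->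
    f w = f x - f h - (val x x0 - val h x0).
  move=> sf; have f1 : f (inX X1) = 1 by have [_ h1 _] := sf; exact: h1.
  have fn (y : X) : f (inX (Xnrm y)) = - val y x0 + f y.
    by rewrite (state_lin (x := inX X1) (y := y) (a := - val y x0) sf)// f1 mulr1.
  rewrite (state_lin (x := inX (Xnrm h)) (y := inX (Xnrm x)) (a := -1) sf)// !fn.
  ring.
have -> : phi x - psi x - (phi h - psi h) = phi w - psi w.
  by rewrite !sval//; ring.
apply: le_trans (normcBD _ _) _; lra.
Qed.

End RapidDecayMetric.

(** * Polynomial growth implies rapid decay *)

Section PolynomialGrowth.
Context {R : realType} {G : topologicalType} (gr : groupoid G) (l : G -> R).
Hypotheses (hlch : lch_groupoid gr) (het : etale gr).
Hypotheses (hl : length_function gr l) (hproper : proper_length l).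
Hypothesis hunif : forall t, 0 <= t -> exists2 F : R, 1 <= F & fiber_card_le gr l t F.
Local Notation C := (Cplx R).
Local Notation normc := (@ComplexField.Normc.normc R).
Local Notation inv := (ginv gr).
Local Notation src := (src gr).
Local Notation rng := (rng gr).
Local Notation gdiv := (gdiv gr).
Local Notation fball := (fball gr l).
Implicit Types (f xi eta : G -> C) (K : G -> G -> C).
Local Notation E := (@E R G gr).
Local Notation sec_le := (sec_le gr).
Local Notation op_le := (@op_le R G gr).
Implicit Types (T S : (G -> C) -> (G -> C)).

Local Notation Lam := (Lambda gr).

(** The induction needs the sharper bound [2 - 2 / (m + 1)]; its step is
    [1 / x ^ 2 <= 2 / (x * (x + 1))] for [x >= 1]. *)
Lemma sum_inv_sq_le (m : nat) : \sum_(0 <= k < m) (k.+1%:R ^- 2 : R) <= 2.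
Proof.
suff h : \sum_(0 <= k < m) (k.+1%:R ^- 2 : R) <= 2 - 2 / m.+1%:R.
  by apply: le_trans h _; rewrite gerBl divr_ge0.
elim: m => [|m IH]; first by rewrite big_geq// divr1 subrr.
rewrite big_nat_recr//=; apply: le_trans (lerD IH (lexx _)) _.
rewrite -[m.+2%:R]natr1; set x : R := m.+1%:R.
have x1 : 1 <= x by rewrite ler1n.
clearbody x.
have -> : 2 - 2 / (x + 1) = 2 - 2 / x + 2 / (x * (x + 1)) by field; lra.
rewrite lerD2l -[leLHS]mul1r ler_pdivrMr ?exprn_gt0//; last by lra.
rewrite mulrAC ler_pdivlMr ?mulr_gt0//; try lra.
have : 0 <= x * (x - 1) by apply: mulr_ge0; lra.
rewrite mul1r; lra.
Qed.

Lemma horner_le (p : {poly R}) (q : nat) : (size p <= q.+1)%N ->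
  exists2 c : R, 0 <= c & forall t, 0 <= t -> p.[t] <= c * (1 + t) ^+ q.
Proof.
move=> sp; exists (\sum_(i < size p) `|p`_i|); first exact: sumr_ge0.
move=> t t0; rewrite horner_coef mulr_suml; apply: ler_sum => i _.
apply: le_trans (ler_norm _) _; rewrite normrM ler_wpM2l// ger0_norm ?exprn_ge0//.
apply: (@le_trans _ _ ((1 + t) ^+ i)).
  by rewrite lerXn2r ?nnegrE//; lra.
by apply: ler_weXn2l; [lra|rewrite -ltnS (leq_trans (ltn_ord i))].
Qed.

(** Sort the points by the integer part [j] of their length. At most [c * 2 ^ q * (j + 1) ^ q]
    points share a given [j], each term is at most [(j + 1) ^ (-2 * (q + 1))], and
    [q + 2 <= 2 * (q + 1)] leaves a multiple of [(j + 1) ^ (-2)]. *)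
Lemma sum_weight_le (p : {poly R}) (q : nat) : (size p <= q.+1)%N ->
  polynomial_growth gr l p -> exists2 A : R, 0 <= A & forall u (S : seq G), uniq S ->
    (forall m, m \in S -> src m = u) -> \sum_(m <- S) ((1 + l m) ^- q.+1) ^+ 2 <= A.
Proof.
move=> sp hp; have [c c0 hc] := horner_le sp.
exists (c * 2 ^+ q * 2); first by rewrite !mulr_ge0// exprn_ge0.
move=> u [|m0 S0] uS hS; first by rewrite big_nil !mulr_ge0// exprn_ge0.
have uu : units gr u by rewrite -(hS m0 (mem_head _ _)); exact: units_src.
set S := m0 :: S0 in uS hS *.
pose k (m : G) := Num.truncn (l m).
have hk m : (k m)%:R <= l m < (k m).+1%:R by apply: truncn_itv; exact: (length_ge0 hl).
clearbody k.
pose F (j : nat) : R := (j.+1%:R ^- q.+1) ^+ 2.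
pose N := (\max_(m <- S) k m).+1.
have step1 : \sum_(m <- S) ((1 + l m) ^- q.+1) ^+ 2 <= \sum_(m <- S) F (k m).
  apply: ler_sum => m _; have /andP[h _] := hk m.
  have l0 := length_ge0 hl m.
  have h1 : (k m).+1%:R <= 1 + l m by rewrite -natr1; lra.
  have h2 : 0 < 1 + l m by lra.
  rewrite lerXn2r ?nnegrE ?invr_ge0 ?exprn_ge0 ?(ltW h2)//.
  rewrite lef_pV2 ?posrE ?exprn_gt0//.
  by rewrite lerXn2r ?nnegrE ?(ltW h2).
apply: le_trans step1 _.
have -> : \sum_(m <- S) F (k m) = \sum_(0 <= j < N) \sum_(m <- S | k m == j) F j.
  under [RHS]eq_bigr do rewrite big_mkcond.
  rewrite exchange_big /= !big_seq; apply: eq_bigr => m mS.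
  rewrite (bigD1_seq (k m)) ?iota_uniq//=; last first.
    by rewrite mem_index_iota /= ltnS; exact: leq_bigmax_seq.
  by rewrite eqxx big1 ?addr0// => j; rewrite eq_sym => /negPf ->.
apply: (@le_trans _ _ (\sum_(0 <= j < N) c * 2 ^+ q * j.+1%:R ^- 2)); last first.
  by rewrite -mulr_sumr ler_wpM2l ?sum_inv_sq_le// mulr_ge0// exprn_ge0.
apply: ler_sum => j _; rewrite -big_filter big_const_seq iter_addr_0 count_predT -[leLHS]mulr_natr.
set T := [seq m <- S | k m == j].
have j0 : 0 <= j.+1%:R :> R by [].
have cT : (size T)%:R <= c * (1 + j.+1%:R) ^+ q.
  apply: le_trans (hc _ j0); apply: (size_fball_le hl hunif (hp _ j0) uu).
    exact: filter_uniq.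
  move=> m; rewrite mem_filter => /andP[/eqP <- /hS em]; split=> //.
  by have /andP[_ /ltW] := hk m.
have j1 : 1 <= j.+1%:R :> R by rewrite ler1n.
set x : R := j.+1%:R in j0 cT j1 *.
have x0 : 0 < x by lra.
have cT' : (size T)%:R <= c * 2 ^+ q * x ^+ q.
  apply: le_trans cT _; rewrite -mulrA ler_wpM2l// -exprMn lerXn2r ?nnegrE//; lra.
have F0 : 0 <= F j by exact: sqr_ge0.
rewrite [leLHS]mulrC; apply: (le_trans (ler_wpM2r F0 cT')).
rewrite -[leLHS]mulrA ler_wpM2l ?mulr_ge0 ?exprn_ge0// /F -/x.
rewrite exprVn -exprM ler_pdivrMr ?exprn_gt0// [leRHS]mulrC ler_pdivlMr ?exprn_gt0//.
rewrite -exprD; apply: ler_weXn2l => //.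
by rewrite mulSn addnC leq_add2l muln2 -addnn leq_addr.
Qed.

(** Rows of the kernel [f (gdiv g m)] run over the range fiber of [rng g] and columns over its
    source fiber, so Schur's test consumes both suprema in [norm2]. *)
Lemma polynomial_growth_rapid_decay (p : {poly R}) (q : nat) : (size p <= q.+1)%N ->
  polynomial_growth gr l p -> exists2 c : R, 0 < c & rapid_decay gr l c q.+1%:R.
Proof.
move=> sp hp; have [A A0 hA] := sum_weight_le sp hp.
exists (A + 1); first by rewrite ltr_wpDl.
move=> f Cf; set s : R := q.+1%:R.
have n20 : (0 <= norm2 gr l s f)%E by rewrite /norm2 le_max nnsup_ge0.
have [fin|] := boolP (norm2 gr l s f \is a fin_num); last first.
  rewrite ge0_fin_numE// -leNgt leye_eq => /eqP ->.
  by rewrite gt0_muley ?leey// lte_fin ltr_wpDl.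
pose M := fine (norm2 gr l s f); have M0 : 0 <= M by exact: fine_ge0.
have eM : norm2 gr l s f = M%:E by rewrite fineK.
have [hsrc hrng] := norm2_ge M0 (eq_ind_r (fun z => (z <= M%:E)%E) (lexx _) eM).
have pw (g : G) : (1 + l g) `^ (2 * s) = ((1 + l g) ^+ q.+1) ^+ 2.
  by rewrite powR_double powR_mulrn// addr_ge0// (length_ge0 hl).
have l1 (g : G) : 0 < 1 + l g by rewrite ltr_wpDr// (length_ge0 hl).
have CS (S : seq G) : \sum_(m <- S) normc (f m) ^+ 2 * (1 + l m) `^ (2 * s) <= M ^+ 2 ->
    \sum_(m <- S) ((1 + l m) ^- q.+1) ^+ 2 <= A -> \sum_(m <- S) normc (f m) <= M * (A + 1).
  move=> h1 h2.
  have -> : \sum_(m <- S) normc (f m) =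
      \sum_(m <- S) (normc (f m) * (1 + l m) ^+ q.+1) * (1 + l m) ^- q.+1.
    by apply: eq_bigr => m _; rewrite mulfK// expf_neq0// gt_eqF.
  apply: sum_mul_le => //.
  - by move=> m; rewrite mulr_ge0 ?normc_ge0// exprn_ge0// ltW.
  - by move=> m; rewrite invr_ge0 exprn_ge0// ltW.
  - exact: addr_ge0.
  - apply: le_trans h1; apply: ler_sum => m _; by rewrite pw exprMn.
  - by apply: le_trans h2 _; nra.
have hsch : schur_le gr (M * (A + 1)) (fun g m => f (gdiv g m)).
  split; first by rewrite mulr_ge0// addr_ge0.
  move=> g S uS hS; split.
    rewrite -(big_map (fun m => gdiv g m) xpredT (fun h => normc (f h))).
    have uT : uniq [seq gdiv g m | m <- S].
      rewrite map_inj_in_uniq// => m m' mS m'S e.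
      have e1 := congr1 inv e; rewrite !inv_div ?hS// in e1.
      by rewrite -(mul_divK (hS m mS)) e1 mul_divK// hS.
    apply: CS; first by apply: (hrng (rng g)) => // _ /mapP[m mS ->]; rewrite rng_div// hS.
    (* [hA] concerns source fibers; inversion preserves [l] and carries the range fiber of [rng g]
       to its source fiber. *)
    have -> : \sum_(m <- [seq gdiv g m | m <- S]) ((1 + l m) ^- q.+1) ^+ 2 =
        \sum_(m <- [seq inv (gdiv g m) | m <- S]) ((1 + l m) ^- q.+1) ^+ 2.
      by rewrite !big_map; apply: eq_bigr => m _; rewrite (length_inv hl).
    apply: (hA (rng g)).
      by rewrite (map_comp inv) map_inj_uniq//; exact: ginv_inj.
    by move=> _ /mapP[m mS ->]; rewrite src_inv rng_div// hS.
  rewrite -(big_map (fun m => gdiv m g) xpredT (fun h => normc (f h))).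
  have uT : uniq [seq gdiv m g | m <- S].
    rewrite map_inj_in_uniq// => m m' mS m'S e.
    by rewrite -(mul_divK (hS m mS)) e mul_divK// hS.
  have sT m : m \in [seq gdiv m g | m <- S] -> src m = rng g.
    by move=> /mapP[m' mS ->]; rewrite src_div// hS.
  by apply: CS; [exact: (hsrc (rng g))|exact: (hA (rng g))].
have /(Cc_bounded_support hlch hl hproper) [_ [t t0 ht]] := Cf.
have h : op_le (M * (A + 1)) (Lam f).
  exact: (schur_op_le hl hunif (banded_Lambda (gr := gr) ht) hsch).
by rewrite eM -EFinM mulrC; exact: opnorm_le.
Qed.

End PolynomialGrowth.

Theorem proposition3p17 (R : realType) (G : topologicalType) (gr : groupoid G)
  (hlch : lch_groupoid gr) (het : etale gr) (hcpt : compact (units gr))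
  (l : G -> R) (hl : length_function gr l) (hproper : proper_length l)
  (hunif : forall t, 0 <= t -> exists2 F : R, 1 <= F & fiber_card_le gr l t F)
  (hgap : forall t, range l t ->
     exists2 del : R, 0 < del & `[t, t + del[ `&` range l = [set t])
  (d : G -> G -> R) (hd : metrizes (units gr) d)
  (I : Type) (K : I -> set G) (hK : metric_stratification gr d K)
  (hKl : forall i, exists r : R, K i `<=` l @^-1` [set r]) :
  (forall c s : R, 0 < c -> 0 < s -> rapid_decay gr l c s ->
     forall n : nat, Num.floor s + 1 <= n%:Z ->
       compact_quantum_metric_space (star gr) (one_Cc gr) (Cc_pos gr)
         (Lipc gr d K) (Ltotal gr d l K n)) /\
  (forall (q : nat) (p : {poly R}), size p = q.+1 -> polynomial_growth gr l p ->
     forall n : nat, Num.floor (q%:R + 2^-1 : R) + 1 < n%:Z ->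
       compact_quantum_metric_space (star gr) (one_Cc gr) (Cc_pos gr)
         (Lipc gr d K) (Ltotal gr d l K n)).

Proof.
split=> [c s c0 s0 hrd n hn|q p sp hp n hn].
  apply: (rapid_decay_cqms hlch het hl hproper hunif hgap hK c0 s0 _ hrd).
  have := floorD1_gt s; move/lt_le_trans; apply.
  by rewrite -(ler_int R) in hn.
have [c c0 hrd] := polynomial_growth_rapid_decay hlch hl hproper hunif (eq_leq sp) hp.
apply: (rapid_decay_cqms hlch het hl hproper hunif hgap hK c0 _ _ hrd); first exact: ltr0Sn.
(* With the floor equal to [q], the hypothesis reads [q + 1 < n], and [q + 1] is the decay exponent
   just obtained. *)
have fq : Num.floor (q%:R + 2^-1 : R) = q%:Z.
  by apply: floor_def; rewrite -!pmulrn; lra.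
rewrite fq in hn; rewrite ltr_nat.
by move: hn; rewrite -PoszD addn1 ltz_nat.
Qed.
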